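(* Let $p>3$ be a prime and let $G$ be a group of order $p^5$. Then $\mathrm{B}_0(G)\neq 0$ if and only if $G$ belongs to the isoclinism family $\Phi_{10}$. Moreover, there are precisely $\gcd(p-1,4)+\gcd(p-1,3)+1$ isomorphism classes of groups $G$ of order $p^5$ with $\mathrm{B}_0(G)\neq 0$.
   Context: For a finite group $G$, the Bogomolov multiplier (unramified Brauer group) of $G$ is $$\mathrm{B}_0(G)=\bigcap_{A\le G,\ A\text{ abelian}}\ker\bigl(\mathrm{res}^G_A:\mathrm{H}^2(G,\mathbb{Q}/\mathbb{Z})\to \mathrm{H}^2(A,\mathbb{Q}/\mathbb{Z})\bigr),$$ where $\mathrm{res}^G_A$ is the cohomological restriction map and $\mathbb{Q}/\mathbb{Z}$ carries the trivial action. Commutators are $[x,y]=x^{-1}y^{-1}xy$. Two groups $G,H$ are isoclinic if there are isomorphisms $\theta:G/Z(G)\to H/Z(H)$ and $\psi:[G,G]\to[H,H]$ such that $\psi([g_1,g_2])=[h_1,h_2]$ whenever $h_iZ(H)=\theta(g_iZ(G))$, $i=1,2$. For a prime $p>3$, the family $\Phi_{10}$ (in R. James's notation) consists of the groups isoclinic to the following group of order $p^5$ (a member of the family): the group $\Phi_{10}(1^5)$ with generators $\alpha,\alpha_1,\alpha_2,\alpha_3,\alpha_4$ and defining relations $[\alpha_i,\alpha]=\alpha_{i+1}$ for $i=1,2,3$, $[\alpha_1,\alpha_2]=\alpha_4$, all other commutators of pairs of generators trivial, and $\alpha^p=\alpha_1^p=\alpha_2^p=\alpha_3^p=\alpha_4^p=1$.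 *)

(* Defs.v *)
From HB Require Import structures.
From mathcomp Require Import all_boot all_order all_algebra all_fingroup.
From mathcomp Require Import all_solvable.
From mathcomp Require Import generic_quotient ring_quotient boolp.

Set Implicit Arguments.
Unset Strict Implicit.
Unset Printing Implicit Defensive.

Import GRing.Theory.
Local Open Scope ring_scope.
Local Open Scope quotient_scope.

(* Q / Z: int_num_subdef is the predicate underlying the qualifier Num.int. *)
Definition QZ : Type :=
  {ideal_quot (GRing.ZmodClosed.clone rat Num.int_num_subdef _)}.
HB.instance Definition _ := GRing.Zmodule.on QZ.
HB.instance Definition _ := EqQuotient.on QZ.

Lemma subrACA (V : zmodType) (a b c d : V) :
  (a - b) - (c - d) = (a - c) - (b - d).
Proof. by rewrite !opprB [d - c]addrC [d - b]addrC addrACA. Qed.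

Section H2.
Variable G : finGroupType.

Definition cochain2 : zmodType := {ffun G * G -> QZ}.

(* Inhomogeneous cochains for the trivial action of G on Q / Z; cochains are not
   assumed to be normalized. *)
Definition is_cocycle2 : {pred cochain2} := fun f =>
  [forall x, forall y, forall z,
     f (y, z) - f ((x * y)%g, z) + f (x, (y * z)%g) - f (x, y) == 0].

Lemma is_cocycle2P (f : cochain2) :
  reflect (forall x y z : G,
     f (y, z) - f ((x * y)%g, z) + f (x, (y * z)%g) - f (x, y) = 0)
    (f \in is_cocycle2).
Proof.
apply: (iffP idP) => [h x y z|h].
  by apply/eqP; move: h => /forallP/(_ x)/forallP/(_ y)/forallP/(_ z).
by apply/forallP => x; apply/forallP => y; apply/forallP => z; apply/eqP.
Qed.

Lemma is_cocycle2_zmod_closed : zmod_closed is_cocycle2.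
Proof.
split=> [|f g /is_cocycle2P hf /is_cocycle2P hg]; apply/is_cocycle2P => x y z.
  by rewrite !ffunE !(subr0, addr0).
move: (hf x y z) (hg x y z); rewrite !ffunE => f0 g0.
by rewrite subrACA [X in X - _]addrACA -opprD subrACA f0 g0 subrr.
Qed.

HB.instance Definition _ :=
  GRing.isZmodClosed.Build cochain2 is_cocycle2 is_cocycle2_zmod_closed.

Record cocycle2 := Cocycle2 {
  cocycle2_val :> cochain2;
  _ : cocycle2_val \in is_cocycle2 }.

HB.instance Definition _ := [isSub for cocycle2_val].
HB.instance Definition _ := [Choice of cocycle2 by <:].
HB.instance Definition _ := [SubChoice_isSubZmodule of cocycle2 by <:].

Definition is_coboundary2 : {pred cocycle2} := fun f =>
  `[< exists u : G -> QZ, forall x y : G,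
        cocycle2_val f (x, y) = u y - u (x * y)%g + u x >].

Lemma is_coboundary2_zmod_closed : zmod_closed is_coboundary2.
Proof.
split=> [|f g /asboolP[u hu] /asboolP[v hv]]; apply/asboolP.
  by exists (fun=> 0) => x y; rewrite ffunE subrr addr0.
exists (fun x => u x - v x) => x y; rewrite !ffunE hu hv.
by rewrite subrACA [RHS]addrACA -opprD.
Qed.

HB.instance Definition _ :=
  GRing.isZmodClosed.Build cocycle2 is_coboundary2 is_coboundary2_zmod_closed.

Definition H2 : Type :=
  {ideal_quot (GRing.ZmodClosed.clone cocycle2 is_coboundary2 _)}.
HB.instance Definition _ := GRing.Zmodule.on H2.
HB.instance Definition _ := EqQuotient.on H2.
End H2.

Section Restriction.
Variables (G : finGroupType) (A : {group G}).

Definition res_cochain2 (f : cochain2 G) : cochain2 (subg_of A) :=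
  [ffun xy => f (sgval xy.1, sgval xy.2)].

Fact res_cochain2_cocycle (f : cocycle2 G) :
  res_cochain2 f \in @is_cocycle2 (subg_of A).
Proof.
apply/is_cocycle2P => x y z; rewrite !ffunE /=.
by have /is_cocycle2P -> := valP f.
Qed.

Definition res_cocycle2 (f : cocycle2 G) : cocycle2 (subg_of A) :=
  Cocycle2 (res_cochain2_cocycle f).

Definition res (c : H2 G) : H2 (subg_of A) :=
  \pi_(H2 (subg_of A)) (res_cocycle2 (repr c)).

Lemma res_pi (f : cocycle2 G) : res (\pi_(H2 G) f) = \pi_(H2 (subg_of A)) (res_cocycle2 f).
Proof.
apply/eqP; rewrite -Quotient.idealrBE.
have: repr (\pi_(H2 G) f) - f \in @is_coboundary2 G.
  by rewrite [_ \in _]Quotient.idealrBE reprK.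
move=> /asboolP[u hu]; apply/asboolP; exists (u \o sgval) => x y.
by have := hu (sgval x) (sgval y); rewrite !ffunE.
Qed.

Lemma res_additive : zmod_morphism res.
Proof.
move=> c d; rewrite -[c]reprK -[d]reprK -raddfB !res_pi -raddfB.
congr (\pi _); apply/val_inj/ffunP => xy; rewrite !ffunE //.
Qed.

HB.instance Definition _ := GRing.isZmodMorphism.Build _ _ res res_additive.
End Restriction.

Definition B0 (G : finGroupType) : {pred H2 G} := fun c =>
  [forall A : {group G}, abelian A ==> (res A c == 0)].

Arguments B0 : clear implicits.

Definition B0_neq0 (G : finGroupType) : Prop :=
  exists2 c : H2 G, c \in B0 G & c != 0.

Local Open Scope group_scope.

(* MathComp's [~ x, y] is x^-1 * y^-1 * x * y. *)
Definition isoclinic (gT hT : finGroupType)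
  (G : {group gT}) (H : {group hT}) : Prop :=
  exists (theta : {morphism G / 'Z(G) >-> coset_of 'Z(H)})
         (psi : {morphism [~: G, G] >-> hT}),
  [/\ isom (G / 'Z(G)) (H / 'Z(H)) theta,
      isom [~: G, G] [~: H, H] psi
    & {in G &, forall g1 g2, {in H &, forall h1 h2,
        coset 'Z(H) h1 = theta (coset 'Z(G) g1) ->
        coset 'Z(H) h2 = theta (coset 'Z(G) g2) ->
        psi [~ g1, g2] = [~ h1, h2]}}].

(* By definition [\isog Grp] describes the largest finite quotient of the
   presented group.  Here this is the presented group itself, because the
   relations present a polycyclic group of order at most p ^ 5. *)
Definition Phi10_1p5 (p : nat) (gT : finGroupType) (H : {set gT}) : Prop :=
  H \isog Grp (a : a1 : a2 : a3 : a4 :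
    ([~ a1, a] = a2, [~ a2, a] = a3, [~ a3, a] = a4, [~ a1, a2] = a4,
     [~ a4, a], [~ a1, a3], [~ a1, a4], [~ a2, a3], [~ a2, a4], [~ a3, a4],
     a ^+ p, a1 ^+ p, a2 ^+ p, a3 ^+ p, a4 ^+ p)).

Definition in_Phi10 (p : nat) (gT : finGroupType) (G : {group gT}) : Prop :=
  exists (hT : finGroupType) (H : {group hT}), Phi10_1p5 p H /\ isoclinic G H.

(* F is a system of representatives of the isomorphism classes of finite groups
   satisfying P, so that there are exactly n classes. *)
Definition num_isoclasses (P : finGroupType -> Prop) (n : nat) : Prop :=
  exists F : 'I_n -> finGroupType,
  [/\ forall i, P (F i),
      forall i j, [set: F i] \isog [set: F j] -> i = j
    & forall G : finGroupType, P G -> exists i, [set: G] \isog [set: F i]].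

(* Main.v *)
(* A class in B_0(G) of order p corresponds to a central extension E of G by a
   group Z of order p such that Z lies in [E, E] and commuting pairs of G lift
   to commuting pairs of E: a class which vanishes on every abelian subgroup
   <x, y> is symmetric on commuting pairs, and conversely every character of Z
   extends to the preimage of an abelian subgroup, since that preimage is
   abelian.  If |G| = p^5, such an E of order p^6 has a center of order p^2, and
   the absence of an abelian maximal subgroup in G forces G to have maximal
   class.  Choosing generators a, a1 outside the two-step centralizers, one
   reaches the relations of Phi_10(1^5), except that now a^p = a4^s and
   a1^p = a4^t.  All these groups are isoclinic to Phi_10(1^5).

   Conversely, these groups, and the extension E of Phi_10(1^5), are built from
   the Baker-Campbell-Hausdorff product, whose denominators in class 4 are
   invertible for p > 3, with carry cocycles to prescribe a^p and a1^p; that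
   B_0 <> 0 then passes to isoclinic groups by a pullback of E.

   The substitution a -> a^i a1^j, a1 -> a1^(i^2) replaces (s, t) by the pair
   (s', t') such that s' i^5 = s i + t j and t' i^3 = t.  Hence the isomorphism
   classes are those of t modulo cubes when t <> 0, of s modulo fourth powers
   when t = 0 <> s, and of (0, 0). *)

Require Import Defs.
From HB Require Import structures.
From mathcomp Require Import all_boot all_order all_algebra all_fingroup.
From mathcomp Require Import all_solvable finfield.
From mathcomp Require Import generic_quotient ring_quotient boolp.
From mathcomp Require Import zify ring.

Set Implicit Arguments.
Unset Strict Implicit.
Unset Printing Implicit Defensive.

Import GRing.Theory Num.Theory GroupScope.

(** * Unramified classes and central extensions *)

(** The obstacle throughout is that E' consists of products of commutators, whereas the lifting
    condition speaks of single ones: no nontrivial element of Z is a commutator of E, although Z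
    lies in E'. Each structural step shows that, were E or G too small or too abelian, a nontrivial
    element of Z could be rewritten as one commutator. This yields |Z(E)| = p^2, class at least 4
    for E, and the absence of an abelian maximal subgroup in G.

    The bound p > 3 also enters through p-th powers: conjugation by a^p brings in the binomial
    coefficients C(p, 2) and C(p, 3), which p divides, so that G' has exponent p.

    The extension E of Phi_10(1^5) keeps apart the commutators [a3, a] and [a1, a2], which coincide
    in the group; their quotient is the central element that witnesses nonvanishing. *)

Section QZ.
Local Open Scope ring_scope.
Local Open Scope quotient_scope.

Definition QZ_of (q : rat) : QZ := \pi_QZ q.

Lemma QZ_of_zmod_morphism : zmod_morphism QZ_of.
Proof. by move=> q r; rewrite /QZ_of; exact: (raddfB (\pi_QZ)). Qed.

HB.instance Definition _ := GRing.isZmodMorphism.Build _ _ QZ_of QZ_of_zmod_morphism.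

Lemma QZ_of_eq0 q : (QZ_of q == 0) = (q \is a Num.int).
Proof.
by rewrite -[RHS]/(q \in Num.int_num_subdef) -[q in RHS]subr0 [RHS]Quotient.idealrBE -(raddf0 QZ_of).
Qed.

Lemma QZ_ofP (x : QZ) : {q | x = QZ_of q}.
Proof. by exists (repr x); rewrite /QZ_of reprK. Qed.

Lemma QZ_divisible (x : QZ) n : (0 < n)%N -> exists y : QZ, y *+ n = x.
Proof.
move=> n_gt0; have [q ->] := QZ_ofP x.
exists (QZ_of (q / n%:R)); rewrite -raddfMn -[_ *+ n]mulr_natr divfK //.
by rewrite pnatr_eq0 -lt0n.
Qed.

(** Identifies ['F_p] with the p-torsion of Q / Z, so that p-torsion cocycles become cocycles with
    values in ['F_p]. *)
Definition iotaQZ (p : nat) (a : 'F_p) : QZ := QZ_of (a%:R / p%:R).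

Section Fp.
Variable p : nat.
Hypothesis p_pr : prime p.

Let p_neq0 : p%:R != 0 :> rat.
Proof. by rewrite pnatr_eq0 -lt0n prime_gt0. Qed.

Lemma QZ_of_int (m : int) : QZ_of m%:~R = 0.
Proof. by apply/eqP; rewrite QZ_of_eq0 intr_int. Qed.

Lemma QZ_of_nat (m : nat) : QZ_of m%:R = 0.
Proof. by rewrite pmulrn QZ_of_int. Qed.

Lemma iotaQZ_nat (m : nat) : iotaQZ (m%:R : 'F_p) = QZ_of (m%:R / p%:R).
Proof.
rewrite /iotaQZ val_Fp_nat // {2}(divn_eq m p) natrD natrM mulrDl mulfK //.
by rewrite raddfD /= QZ_of_nat add0r.
Qed.

Lemma iotaQZ_zmod_morphism : zmod_morphism (@iotaQZ p).
Proof.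
suff addi : {morph (@iotaQZ p) : a b / a + b >-> a + b}.
  by move=> a b; apply: (addIr (iotaQZ b)); rewrite -addi !subrK.
move=> a b; rewrite -[a]natr_Zp -[b]natr_Zp -natrD !iotaQZ_nat.
by rewrite -raddfD -mulrDl -natrD.
Qed.

Lemma iotaQZ_eq0 (a : 'F_p) : iotaQZ a = 0 -> a = 0.
Proof.
move/eqP; rewrite QZ_of_eq0 => /intrP[m] /(canRL (divfK p_neq0)) am.
have /eqP : (a%:R : rat) = (m * p)%:~R by rewrite am intrM.
rewrite pmulrn eqr_int => /eqP E.
have : (p %| a)%N by rewrite -[(p %| a)%N]/(p%:Z %| a%:Z)%Z E dvdz_mull.
move=> pa; apply/val_inj => /=.
have ap : (a < p)%N by rewrite -{2}(Fp_cast p_pr) ltn_ord.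
by apply/eqP; rewrite -leqn0 leqNgt; apply: contraL pa => a0; rewrite gtnNdvd.
Qed.

Lemma iotaQZ_onto (x : QZ) : x *+ p = 0 -> exists a : 'F_p, x = iotaQZ a.
Proof.
have [q ->] := QZ_ofP x; rewrite -raddfMn => /eqP /=.
rewrite QZ_of_eq0 => /intrP[m qm].
have {qm} -> : q = m%:~R / p%:R by rewrite -qm -[_ *+ p]mulr_natr mulfK.
exists (`|(m %% p)%Z|%N%:R); rewrite iotaQZ_nat.
rewrite {1}(divz_eq m p) intrD intrM mulrDl mulfK // raddfD /= QZ_of_int add0r.
by rewrite [in RHS]pmulrn gez0_abs ?modz_ge0 // -lt0n prime_gt0.
Qed.

End Fp.
End QZ.

(** * Extension of characters with values in Q / Z *)

Section CharExtension.
Local Open Scope ring_scope.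

(** A total function, additive on A only, so that extending a character is plain agreement on a
    subset. *)
Definition charQZ (gT : finGroupType) (A : {set gT}) (chi : gT -> QZ) :=
  {in A &, forall x y, chi (x * y)%g = chi x + chi y}.

Variable gT : finGroupType.
Implicit Types A B : {group gT}.

Lemma charQZ1 A chi : charQZ A chi -> chi 1%g = 0.
Proof.
by move=> h; apply: (addIr (chi 1%g)); rewrite -h ?group1 // mulg1 add0r.
Qed.

Lemma charQZX A chi x n : charQZ A chi -> x \in A -> chi (x ^+ n)%g = chi x *+ n.
Proof.
move=> h xA; elim: n => [|n IH]; first by rewrite expg0 mulr0n (charQZ1 h).
by rewrite expgS h ?groupX // IH mulrS.
Qed.

Lemma charQZV A chi x : charQZ A chi -> x \in A -> chi x^-1%g = - chi x.
Proof.
move=> h xA; apply: (addIr (chi x)).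
by rewrite -h ?groupV // mulVg addNr (charQZ1 h).
Qed.

(** With n the order of a modulo B, divisibility gives q such that n q = chi(a^n). The extension
    sends a^i b to chi(b) + i q, which the choice of q makes independent of i. *)
Lemma charQZ_extend1 A B a chi : abelian A -> B \subset A -> a \in A ->
  charQZ B chi ->
  exists2 psi, charQZ (<[a]> <*> B) psi & {in B, psi =1 chi}.
Proof.
move=> cAA sBA aA hchi.
have nBa : a \in 'N(B) by apply: subsetP aA; apply: sub_abelian_norm.
pose n := #[coset B a]; have n_gt0 : (0 < n)%N by apply: order_gt0.
have aXB k : ((a ^+ k)%g \in B) = (n %| k)%N.
  rewrite order_dvdn -morphX //; apply/idP/eqP => [/coset_id //|].
  by apply: coset_idr; rewrite groupX.
have [q qE] := QZ_divisible (chi (a ^+ n)%g) n_gt0.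
pose ok x (i : nat) := (a ^- i * x)%g \in B.
pose f x : QZ := if [pick i : 'I_#[a] | ok x i] is Some i
                 then chi (a ^- i * x)%g + q *+ i else 0.
have fwd x i j : ok x i -> ok x j -> (i <= j)%N ->
    chi (a ^- i * x)%g + q *+ i = chi (a ^- j * x)%g + q *+ j.
  move=> oki okj lij.
  have ajB : (a ^+ (j - i))%g \in B.
    rewrite (_ : (_ ^+ _)%g = ((a ^- i * x) * (a ^- j * x)^-1)%g).
      by rewrite groupM ?groupV.
    by rewrite invMg invgK mulgA mulgK -{2}(subnKC lij) expgD mulKg.
  have := ajB; rewrite aXB => /dvdnP[m jm].
  have -> : (a ^- i * x)%g = (a ^+ (j - i) * (a ^- j * x))%g.
    rewrite mulgA; congr (_ * _)%g; apply: (mulgI (a ^+ i)%g).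
    by rewrite mulgV mulgA -expgD subnKC // mulgV.
  rewrite hchi // jm mulnC expgM (charQZX _ hchi) ?aXB // -qE -mulrnA.
  by rewrite [(n * m)%N]mulnC -jm addrAC -mulrnDr subnK // addrC.
have fE x i : ok x i -> f x = chi (a ^- i * x)%g + q *+ i.
  move=> oki; rewrite /f; case: pickP => [j okj|none].
    by case: (leqP i j) => [|/ltnW] lij; [symmetry|]; apply: fwd.
  have := none (Ordinal (ltn_pmod i (order_gt0 a))).
  by rewrite /ok /= expg_mod_order; move: oki; rewrite /ok => ->.
have fP x : x \in <[a]> <*> B -> exists i, ok x i.
  rewrite norm_joinEl ?cycle_subG // => /mulsgP[_ b /cycleP[i ->] bB ->].
  by exists i; rewrite /ok mulKg.
exists f => [x y /fP[i xi] /fP[j yj]|x xB].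
  have xA : x \in A.
    by rewrite -(groupMl _ (groupVr (groupX i aA))) (subsetP sBA).
  have E : (a ^- (i + j) * (x * y) = (a ^- i * x) * (a ^- j * y))%g.
    rewrite expgD invMg !mulgA; congr (_ * _)%g; rewrite -!mulgA.
    have cax k : commute (a ^- k)%g x.
      by apply/commute_sym/commuteV/commuteX; apply: (centsP cAA).
    by rewrite -(cax j) !mulgA -!invMg -!expgD addnC.
  have okij : ok (x * y)%g (i + j)%N by rewrite /ok E; apply: groupM.
  by rewrite (fE _ _ okij) (fE _ _ xi) (fE _ _ yj) E hchi // mulrnDr addrACA.
by rewrite (fE _ 0%N) /ok expg0 invg1 mul1g // mulr0n addr0.
Qed.

Lemma charQZ_extend A B chi : abelian A -> B \subset A -> charQZ B chi ->
  exists2 psi, charQZ A psi & {in B, psi =1 chi}.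
Proof.
move=> cAA; have [m] := ubnP (#|A| - #|B|); elim: m => // m IH in B chi *.
move=> lm sBA hchi; have [sAB | /subsetPn[a aA aNB]] := boolP (A \subset B).
  by exists chi => // x y xA yA; apply: hchi; apply: (subsetP sAB).
have [psi hpsi eqpsi] := charQZ_extend1 cAA sBA aA hchi.
have sB1A : <[a]> <*> B \subset A by rewrite join_subG cycle_subG aA.
have ltB : (#|B| < #|<[a]> <*> B|)%N.
  apply: proper_card; rewrite properE joing_subr join_subG cycle_subG.
  by rewrite (negPf aNB).
have [|psi' hpsi' eqpsi'] := IH [group of <[a]> <*> B] psi _ sB1A hpsi.
  rewrite -ltnS; apply: leq_trans lm; rewrite ltnS ltn_sub2l //.
  by apply: leq_trans ltB _; apply: subset_leq_card.
exists psi' => // x xB; rewrite eqpsi' ?eqpsi //.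
by apply: (subsetP (joing_subr _ _)).
Qed.
End CharExtension.

(** * From central extensions to classes in B_0 *)

Section ExtensionToB0.
Local Open Scope ring_scope.

Lemma charQZ_der1 (gT : finGroupType) (E : {group gT}) chi z :
  charQZ E chi -> z \in E^`(1)%g -> chi z = 0.
Proof.
move=> h zE'.
pose K := [set x in E | chi x == 0].
have gK : group_set K.
  apply/group_setP; split=> [|x y]; first by rewrite inE group1 (charQZ1 h) /=.
  rewrite !inE => /andP[xE /eqP x0] /andP[yE /eqP y0].
  by rewrite groupM //= h // x0 y0 addr0.
suff: z \in group gK by rewrite inE => /andP[_ /eqP].
apply: subsetP zE'; rewrite gen_subG; apply/subsetP => _ /imset2P[x y xE yE ->].
rewrite inE groupR //= commgEl conjgE !(h, groupV, groupM) //.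
by rewrite !(charQZV h) // addrA -opprD addNr.
Qed.

Lemma charQZ_neq0 (gT : finGroupType) (A : {group gT}) z :
  abelian A -> z \in A -> z != 1%g -> exists2 chi, charQZ A chi & chi z != 0.
Proof.
move=> cAA zA z1; pose n := #[z].
have n_gt0 : (0 < n)%N by apply: order_gt0.
have n_neq0 : n%:R != 0 :> rat by rewrite pnatr_eq0 -lt0n.
pose chi0 x : QZ := if [pick i : 'I_n | (x == z ^+ i)%g] is Some i
                    then QZ_of (i%:R / n%:R) else 0.
have chi0E k : chi0 (z ^+ k)%g = QZ_of (k%:R / n%:R).
  rewrite /chi0; case: pickP => [i|/(_ (Ordinal (ltn_pmod k n_gt0)))]; last first.
    by rewrite /= expg_mod_order eqxx.
  rewrite eq_expg_mod_order [(i %% _)%N]modn_small // => /eqP <-.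
  rewrite {2}(divn_eq k n) natrD natrM mulrDl mulfK // raddfD /=.
  by rewrite QZ_of_nat add0r.
have hchi0 : charQZ <[z]> chi0.
  move=> _ _ /cycleP[i ->] /cycleP[j ->]; rewrite -expgD !chi0E -raddfD.
  by rewrite -mulrDl -natrD.
have [|chi hchi eqchi] := charQZ_extend cAA _ hchi0; first by rewrite cycle_subG.
exists chi; rewrite // eqchi ?cycle_id // -[z]expg1 chi0E QZ_of_eq0 mul1r.
apply: contra z1 => /intrP[m] /(congr1 (fun x => x * n%:R)) /=.
rewrite mulVf // pmulrn -[1]/(1%:~R) -intrM => /eqP; rewrite eqr_int => /eqP E.
have : (n%:Z %| 1%R)%Z by rewrite E dvdz_mull.
rewrite dvdzE; change (n %| 1 -> z == 1%g)%N.
by rewrite dvdn1 order_eq1.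
Qed.

(** The class is the image of the factor set of E under a character chi of the kernel with chi(z)
    nonzero. Over an abelian A the preimage is abelian, so chi extends to it, and the extension
    composed with a section trivialises the restriction. A trivialisation over all of G would extend
    chi to a character of E, which vanishes on E' and hence at z. *)
Lemma B0_neq0_of_extension (G eT : finGroupType) (E : {group eT})
    (pi : {morphism E >-> G}) z :
  pi @* E = [set: G] ->
  {in E &, forall x y, commute (pi x) (pi y) -> commute x y} ->
  z \in 'ker pi -> z \in E^`(1)%g -> z != 1%g -> B0_neq0 G.
Proof.
move=> piE CP zW zE' z1; pose W := 'ker pi.
have sWE : W \subset E by apply: subsetIl.
have cWE : {in W & E, forall w x, commute w x}.
  move=> w x wW xE; apply: CP => //; first exact: (subsetP sWE).
  by rewrite (mker wW); apply: commute_sym; apply: commute1.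
have cWW : abelian W.
  by apply/centsP => w ww v vw; apply: cWE => //; apply: (subsetP sWE).
have [chi hchi chiz] := charQZ_neq0 cWW zW z1.
pose s g := odflt 1%g [pick x in E | pi x == g].
have sP g : s g \in E /\ pi (s g) = g.
  rewrite /s; case: pickP => [x /andP[xE /eqP]|] //= none.
  have : g \in pi @* E by rewrite piE inE.
  by case/morphimP => x xE _ gE; have := none x; rewrite xE gE eqxx.
have sE g : s g \in E by case: (sP g).
have piS g : pi (s g) = g by case: (sP g).
pose phi x y := (s x * s y * (s (x * y))^-1)%g.
have phiW x y : phi x y \in W.
  by apply/kerP; rewrite ?(groupM, groupV) // !morphM ?morphV ?(groupM, groupV) // !piS mulgV.
have phiM x y : (s x * s y = phi x y * s (x * y))%g by rewrite /phi mulgKV.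
have phiC x y t : t \in E -> (t * phi x y = phi x y * t)%g.
  by move=> tE; rewrite (cWE _ _ (phiW x y) tE).
pose f0 : cochain2 G := [ffun xy => chi (phi xy.1 xy.2)].
have f0E x y : f0 (x, y) = chi (phi x y) by rewrite ffunE.
have f0c : f0 \in @is_cocycle2 G.
  apply/is_cocycle2P => x y t; rewrite !f0E.
  have E1 : (phi y t * phi x (y * t) = phi x y * phi (x * y) t)%g.
    have L : (phi y t * (phi x (y * t) * s (x * (y * t))) = s x * s y * s t)%g.
      by rewrite -phiM mulgA -phiC // -mulgA -phiM mulgA.
    have R : (phi x y * (phi (x * y) t * s (x * y * t)) = s x * s y * s t)%g.
      by rewrite -phiM mulgA -phiM.
    by apply: (mulIg (s (x * y * t)%g)); rewrite -[RHS]mulgA R -L !mulgA.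
  rewrite [X in X - _]addrAC -hchi // E1 hchi // -addrA -opprD.
  by rewrite [X in _ - X]addrC subrr.
pose f := Cocycle2 f0c.
have fE x y : cocycle2_val f (x, y) = chi (phi x y) by apply: f0E.
exists (\pi_(H2 G) f)%qT.
  apply/forallP => A; apply/implyP => cAA.
  rewrite res_pi -(raddf0 (\pi_(H2 (subg_of A)))%qT) -Quotient.idealrBE subr0.
  pose EA := (pi @*^-1 A)%G.
  have cEA : abelian EA.
    apply/centsP => x /morphpreP[xE xA] y /morphpreP[yE yA]; apply: CP => //.
    exact: (centsP cAA).
  have sWEA : W \subset EA by apply: morphpreS; apply: sub1G.
  have [psi hpsi eqpsi] := charQZ_extend cEA sWEA hchi.
  have sEA x : x \in A -> s x \in EA by move=> xA; rewrite mem_morphpre // piS.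
  apply/asboolP; exists (fun x => psi (s (sgval x))) => x y; rewrite ffunE /= f0E.
  have [xA yA] := (valP x, valP y).
  apply/eqP; rewrite addrAC eq_sym subr_eq; apply/eqP.
  have [sx sy sxy] := And3 (sEA _ xA) (sEA _ yA) (sEA _ (groupM xA yA)).
  have phA := subsetP sWEA _ (phiW (sgval x) (sgval y)).
  rewrite -eqpsi // -(hpsi _ _ sy sx) -(hpsi _ _ phA sxy) -phiM.
  by congr psi; apply: (centsP cEA).
suff: f \notin @is_coboundary2 G.
  by rewrite -[X in X \notin _]subr0 Quotient.idealrBE raddf0.
apply/negP=> /asboolP[u hu]; move: chiz.
(* The character of E built from u; since the section need not send 1 to 1, its value at z is
   compared with its value at 1. *)
pose w x := (x * (s (pi x))^-1)%g.
have wW x : x \in E -> w x \in W.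
  by move=> xE; apply/kerP; rewrite ?groupM ?groupV // morphM ?groupV // morphV // piS mulgV.
pose psi x := chi (w x) + u (pi x).
have hpsi : charQZ E psi.
  move=> x y xE yE; rewrite /psi addrACA -hchi ?wW //.
  have -> : w (x * y)%g = (w x * w y * phi (pi x) (pi y))%g.
    rewrite /phi -mulgA; rewrite [in RHS](_ : w y * _ = s (pi x) * w y * s (pi y) * (s (pi x * pi y)%g)^-1)%g; last first.
      by rewrite -(cWE _ _ (wW y yE) (sE (pi x))) !mulgA.
    by rewrite /w -morphM // !mulgA !mulgKV.
  have wxy : (w x * w y)%g \in W by apply: groupM; apply: wW.
  rewrite (hchi _ _ wxy (phiW _ _)) -fE hu morphM // -addrA.
  by congr (_ + _); rewrite addrAC subrK addrC.
have psi1 : psi 1%g = 0 by rewrite (charQZ1 hpsi).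
have : psi z = 0 by apply: charQZ_der1 hpsi zE'.
rewrite /psi /w (mker zW) hchi ?groupV // -?addrA.
  by move: psi1; rewrite /psi /w morph1 mul1g => ->; rewrite addr0 => ->; rewrite eqxx.
by apply/kerP; rewrite ?piS.
Qed.
End ExtensionToB0.

(** * The central extension defined by a cocycle *)

Section CentralExtension.
Local Open Scope ring_scope.
Variables (p : nat) (G : finGroupType) (phi : G -> G -> 'F_p).

Definition cocycleF := forall x y z : G,
  phi y z + phi x (y * z)%g = phi x y + phi (x * y)%g z.

Hypothesis phiP : cocycleF.

Lemma cocycleF1l x : phi 1%g x = phi 1%g 1%g.
Proof. by apply: (addIr (phi 1%g x)); have := phiP 1%g 1%g x; rewrite !mul1g. Qed.

(** The cocycle proof is a phantom argument, so that each cocycle has its own group structure on the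
    same pairs. *)
Definition extn of cocycleF := (G * 'F_p)%type.
HB.instance Definition _ := Finite.on (extn phiP).

Definition extn_mul (u v : extn phiP) : extn phiP :=
  ((u.1 * v.1)%g, u.2 + v.2 + phi u.1 v.1).
(** Cocycles are not normalised, whence the correction by phi(1, 1). *)
Definition extn_one : extn phiP := (1%g, - phi 1%g 1%g).
Definition extn_inv (u : extn phiP) : extn phiP :=
  ((u.1)^-1%g, - u.2 - phi (u.1)^-1%g u.1 - phi 1%g 1%g).

Lemma extn_mulA : associative extn_mul.
Proof.
move=> [x a] [y b] [z c]; congr (_, _); rewrite /= ?mulgA //.
transitivity (a + b + c + (phi y z + phi x (y * z)%g)); first by ring.
by rewrite phiP; ring.
Qed.

Lemma extn_mul1 : left_id extn_one extn_mul.
Proof.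
by move=> [x a]; congr (_, _); rewrite /= ?mul1g // cocycleF1l addrAC addNr add0r.
Qed.

Lemma extn_mulV : left_inverse extn_one extn_inv extn_mul.
Proof.
move=> [x a]; congr (_, _); rewrite /= ?mulVg //.
by ring.
Qed.

HB.instance Definition _ := Finite_isGroup.Build (extn phiP)
  extn_mulA extn_mul1 extn_mulV.

Lemma extnM (u v : extn phiP) : (u * v)%g = ((u.1 * v.1)%g, u.2 + v.2 + phi u.1 v.1).
Proof. by []. Qed.

Lemma extn1 : 1%g = (1%g, - phi 1%g 1%g) :> extn phiP.
Proof. by []. Qed.

Definition extn_proj (u : extn phiP) : G := u.1.
Lemma extn_projM : {in [set: extn phiP] &, {morph extn_proj : u v / (u * v)%g}}.
Proof. by []. Qed.
Canonical extn_proj_morphism := Morphism extn_projM.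

Lemma extn_proj_onto : (extn_proj @* [set: extn phiP] = [set: G])%g.
Proof.
apply/setP => x; rewrite !inE; apply/morphimP.
by exists ((x, 0) : extn phiP); rewrite ?inE.
Qed.

Lemma card_extn : #|[set: extn phiP]| = (#|G| * #|'F_p|)%N.
Proof. by rewrite cardsT card_prod. Qed.

End CentralExtension.

(** The cocycle identity for the coboundary of a function, whose values at three elements, at their
    products and at the triple product are the seven letters. *)
Lemma coboundary_sum (V : zmodType) (x y z xy yz w : V) : (
  (z - yz + y) + (yz - w + x) = (y - xy + x) + (z - w + xy))%R.
Proof.
transitivity (z + y + (x - w))%R.
  rewrite [(z - yz + y)%R]addrAC [(yz - w + x)%R]addrAC -[LHS]addrA; congr (_ + _)%R.
  by rewrite -addrA addKr.
rewrite [(y - xy + x)%R]addrAC [(z - w + xy)%R]addrC -[RHS]addrA addKr.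
by rewrite [(z + y)%R]addrC addrACA.
Qed.

(** * From classes in B_0 to central extensions *)

Section B0ToExtension.
Local Open Scope ring_scope.
Variables (p : nat) (G : finGroupType).
Hypothesis p_pr : prime p.

Lemma extnC (phi : G -> G -> 'F_p) (phiP : cocycleF phi) (x y : extn phiP) :
  commute x.1 y.1 -> phi x.1 y.1 = phi y.1 x.1 -> commute x y.
Proof.
by move=> cxy exy; rewrite /commute !extnM cxy exy [X in (_, X + _)]addrC.
Qed.

(** Sum the cocycle identity over its third variable. *)
Lemma coboundary2_card (f : cocycle2 G) : f *+ #|G| \in @is_coboundary2 G.
Proof.
apply/asboolP; exists (fun x => \sum_z cocycle2_val f (x, z)) => x y.
have /is_cocycle2P fP := valP f.
have -> : cocycle2_val (f *+ #|G|) (x, y) = cocycle2_val f (x, y) *+ #|G|.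
  by elim: #|G| => [|m IH]; rewrite ?mulr0n ?mulrS ffunE // IH.
rewrite [X in _ + X](reindex_inj (mulgI y)) /=.
rewrite -sumrB -big_split /= -sumr_const; apply: eq_bigr => z _.
by apply/eqP; rewrite eq_sym -subr_eq0 fP.
Qed.

(** If p^(k+1) is the least power of p that kills the class c, then p^k c has order p and stays in
    B_0. On the abelian group <x, y> it is a coboundary, hence symmetric. *)
Lemma B0_order_p n : #|G| = (p ^ n)%N -> B0_neq0 G ->
  exists f : cocycle2 G, [/\ f *+ p \in @is_coboundary2 G,
    f \notin @is_coboundary2 G &
    forall x y, commute x y -> cocycle2_val f (x, y) = cocycle2_val f (y, x)].
Proof.
move=> oG [c cB c0].
have pi0 (f : cocycle2 G) :
    (f \in @is_coboundary2 G) = (\pi_(H2 G) f == 0)%qT.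
  by rewrite -[X in X \in _]subr0 Quotient.idealrBE raddf0.
have ex : exists k, c *+ (p ^ k) == 0.
  exists n; rewrite -oG -[c]reprK -raddfMn /= -pi0; exact: coboundary2_card.
case: (ex_minnP ex) => -[|k] ck0 kmin.
  by move: c0; rewrite -[c]mulr1n -(expn0 p) ck0.
have [f fE] : exists f : cocycle2 G, \pi_(H2 G)%qT f = c *+ (p ^ k).
  by exists (repr (c *+ (p ^ k))); rewrite reprK.
exists f; split.
- by rewrite pi0 raddfMn /= fE -mulrnA -expnSr.
- by rewrite pi0 fE; apply/negP => /kmin; rewrite ltnn.
move=> x y cxy.
pose A := (<[x]> <*> <[y]>)%G.
have cAA : abelian A.
  rewrite /= abelianY !cycle_abelian cycle_subG /=.
  by apply/centP => _ /cycleP[i ->]; apply/commuteX/commute_sym.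
have : res A (\pi_(H2 G)%qT f) == 0.
  rewrite fE (raddfMn (res A)) /=; have /forallP/(_ A)/implyP/(_ cAA)/eqP -> := cB.
  by rewrite mul0rn.
have -> : 0 = \pi_(H2 (subg_of A))%qT 0 by rewrite raddf0.
rewrite res_pi -Quotient.idealrBE subr0 => /asboolP[u hu].
have xA : x \in A by rewrite mem_gen // inE cycle_id.
have yA : y \in A by rewrite mem_gen // inE cycle_id orbT.
have := hu (subg A x) (subg A y); have := hu (subg A y) (subg A x).
rewrite !ffunE /= !subgK // => -> ->.
have -> : (subg A y * subg A x = subg A x * subg A y)%g.
  by apply: val_inj; rewrite /= !subgK.
by rewrite addrAC [RHS]addrAC [X in X - _]addrC.
Qed.

(** If p f is the coboundary of u, dividing u by p in Q / Z replaces f by a cohomologous cocycle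
    with values in the p-torsion. If Z were not in E' it would meet E' trivially; the embedding of Z
    in Q / Z would extend through E / E', and its values on a section would trivialise f. *)
Lemma extension_of_B0 n : #|G| = (p ^ n)%N -> B0_neq0 G ->
  exists (phi : G -> G -> 'F_p) (phiP : cocycleF phi),
    (forall x y : extn phiP, commute x.1 y.1 -> commute x y) /\
    ('ker (@extn_proj _ _ _ phiP) \subset [set: extn phiP]^`(1))%g.
Proof.
move=> oG nz; have [f [/asboolP[u hu] ncob fC]] := B0_order_p oG nz.
have p_gt0 := prime_gt0 p_pr.
have [v vE] := @choice _ _ (fun x y => y *+ p = u x)
  (fun x => QZ_divisible (u x) p_gt0).
pose f1 x y := cocycle2_val f (x, y) - (v y - v (x * y)%g + v x).
have fp x y : cocycle2_val (f *+ p) (x, y) = cocycle2_val f (x, y) *+ p.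
  by elim: p => [|m IH]; rewrite ?mulr0n ?mulrS ffunE // IH.
have f1p x y : f1 x y *+ p = 0.
  by rewrite mulrnBl -fp hu mulrnDl mulrnBl !vE subrr.
have [phi phiE] : exists phi : G -> G -> 'F_p,
    forall x y, f1 x y = iotaQZ (phi x y).
  have [h hE] := @choice _ _ (fun (xy : G * G) a => f1 xy.1 xy.2 = iotaQZ a)
    (fun xy => iotaQZ_onto p_pr (f1p xy.1 xy.2)).
  by exists (fun x y => h (x, y)) => x y; rewrite -hE.
have iB := iotaQZ_zmod_morphism p_pr.
have iD (a b : 'F_p) : iotaQZ (a + b) = iotaQZ a + iotaQZ b.
  by apply: (addIr (- iotaQZ b)); rewrite -iB !addrK.
have i_inj (a b : 'F_p) : iotaQZ a = iotaQZ b -> a = b.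
  move/eqP; rewrite -subr_eq0 -iB => /eqP /(iotaQZ_eq0 p_pr)/eqP.
  by rewrite subr_eq0 => /eqP.
have phiP : cocycleF phi.
  move=> x y z; apply: i_inj; rewrite !iD -!phiE /f1.
  have /is_cocycle2P/(_ x y z)/eqP := valP f.
  rewrite subr_eq0 addrAC subr_eq => /eqP E.
  by rewrite addrACA [RHS]addrACA -!opprD E mulgA (coboundary_sum _ _ _ (v (x * y)%g)).
have phiC x y : commute x y -> phi x y = phi y x.
  move=> cxy; apply: i_inj; rewrite -!phiE /f1 (fC x y) // cxy.
  congr (_ - _); rewrite addrAC [RHS]addrAC; congr (_ - _); exact: addrC.
exists phi, phiP; split=> [x y cxy|].
  exact: extnC cxy (phiC _ _ cxy).
set E := [set: extn phiP]%G; set Z := 'ker _.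
have ZE r : (r \in Z) = (r.1 == 1%g) by apply/kerP/eqP; rewrite ?inE.
have oZ : #|Z| = p.
  transitivity #|[set: 'F_p]|; last by rewrite cardsT card_Fp.
  rewrite -(card_imset _ (_ : injective (fun a => (1%g, a) : extn phiP))) => [|a b [] //].
  apply: eq_card => -[x a]; rewrite ZE; apply/eqP/imsetP => [/= ->|[b _ [-> _]] //].
  by exists a; rewrite ?inE.
have [// | /(prime_TIg _) tiZ] := boolP (Z \subset E^`(1))%g.
move: tiZ; rewrite oZ => /(_ p_pr) tiZ.
case/negP: ncob.
(* The shift sends the identity (1, - phi(1, 1)) to 0. *)
pose g (z : extn phiP) := iotaQZ (z.2 + phi 1%g 1%g).
pose chi0 (y : coset_of E^`(1)%g) : QZ :=
  if [pick z in Z | coset E^`(1)%g z == y] is Some z then g z else 0.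
have cE : abelian (E / E^`(1))%g by apply: der_abelian.
have nE x : x \in 'N(E^`(1))%g by apply: (subsetP (der_norm 1 E)); rewrite inE.
have chi0E z : z \in Z -> chi0 (coset E^`(1)%g z) = g z.
  move=> zZ; rewrite /chi0; case: pickP => [z1 /andP[z1Z /eqP E1]|/(_ z)]; last by rewrite /= zZ eqxx.
  suff -> : z1 = z by [].
  have : (z1 * z^-1)%g \in (Z :&: E^`(1))%g.
    rewrite inE groupM ?groupV //=; apply: coset_idr; rewrite // morphM ?morphV //.
    by rewrite /= E1 mulgV.
  by rewrite tiZ => /set1P/(canRL (mulgKV _)); rewrite mul1g.
have hchi0 : charQZ (Z / E^`(1))%g chi0.
  move=> _ _ /morphimP[x _ xZ ->] /morphimP[y _ yZ ->].
  rewrite -morphM // !chi0E ?groupM // /g -iD; congr iotaQZ.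
  have := ZE x; have := ZE y; rewrite xZ yZ => /esym/eqP ey /esym/eqP ex. rewrite extnM /= ex ey.
  by ring.
have [psi hpsi eqpsi] := charQZ_extend cE (quotientS _ (subsetT Z)) hchi0.
pose s x : extn phiP := (x, 0).
pose w x := psi (coset E^`(1)%g (s x)).
have wE x y : f1 x y = w x + w y - w (x * y)%g.
  apply/eqP; rewrite eq_sym subr_eq eq_sym phiE; apply/eqP.
  have sE t : coset E^`(1)%g (s t) \in (E / E^`(1))%g by rewrite mem_quotient // inE.
  pose z : extn phiP := (1%g, phi x y - phi 1%g 1%g).
  have zZ : z \in Z by rewrite ZE.
  have -> : iotaQZ (phi x y) = psi (coset E^`(1)%g z).
    by rewrite eqpsi ?mem_quotient // chi0E // /g subrK.
  rewrite -!hpsi ?mem_quotient ?inE // -!morphM //; congr (psi (coset _ _)).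
  rewrite !extnM /= mul1g (cocycleF1l phiP) !addr0 subrK.
  by congr (_, _); rewrite add0r.
apply/asboolP; exists (fun x => v x + w x) => x y /=.
rewrite -[LHS](subrK (v y - v (x * y)%g + v x)) -/(f1 x y) wE.
rewrite [w x + w y]addrC [w y + w x - _]addrAC [LHS]addrC opprD.
by rewrite [X in _ = X + _]addrACA [RHS]addrACA.
Qed.
End B0ToExtension.

(** * Groups whose commuting pairs lift *)

Section Commutators.
Variable gT : finGroupType.
Implicit Types (x y z : gT) (E V Z : {group gT}).

Lemma commgMl x y z : commute [~ x, z] y -> [~ x * y, z] = [~ x, z] * [~ y, z].
Proof. by move=> c; rewrite commMgJ (conjg_fixP _) //; apply/commgP. Qed.

Lemma commgMr x y z : commute [~ x, y] z -> [~ x, y * z] = [~ x, z] * [~ x, y].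
Proof. by move=> c; rewrite commgMJ (conjg_fixP _) //; apply/commgP. Qed.

Lemma commg_central E x y z : [~ x, y] \in 'Z(E) -> z \in E -> commute [~ x, y] z.
Proof. by case/setIP => _ /centP c /c. Qed.

(** Central commutators make v -> [x, v] multiplicative. A subgroup made of single commutators is
    what the condition on commuting pairs applies to. *)
Lemma group_set_comm_r E V x : V \subset E ->
  {in V, forall v, [~ x, v] \in 'Z(E)} -> group_set [set [~ x, v] | v in V].
Proof.
move=> /subsetP sVE c; apply/group_setP; split=> [|_ _ /imsetP[u uV ->] /imsetP[v vV ->]].
  by apply/imsetP; exists 1; rewrite ?group1 ?commg1.
apply/imsetP; exists (v * u); rewrite ?groupM // commgMr //.
by apply: commg_central (c v vV) _; apply: sVE.
Qed.

Lemma group_set_comm_l E V y : V \subset E ->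
  {in V, forall v, [~ v, y] \in 'Z(E)} -> group_set [set [~ v, y] | v in V].
Proof.
move=> /subsetP sVE c; apply/group_setP; split=> [|_ _ /imsetP[u uV ->] /imsetP[v vV ->]].
  by apply/imsetP; exists 1; rewrite ?group1 ?comm1g.
apply/imsetP; exists (u * v); rewrite ?groupM // commgMl //.
by apply: commg_central (c u uV) _; apply: sVE.
Qed.

Lemma mem_expg_coprime (A : {group gT}) x m n :
  coprime m n -> 0 < m -> x ^+ m \in A -> x ^+ n \in A -> x \in A.
Proof.
move=> co m_gt0 xm xn; case: (egcdnP n m_gt0) => a b E _.
move: co E; rewrite /coprime => /eqP -> E.
have : x ^+ (a * m) \in A by rewrite mulnC expgM groupX.
by rewrite E expgD expg1 groupMl // mulnC expgM groupX.
Qed.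

Lemma der1_sub_gen (E M : {group gT}) (S : {set gT}) : E = <<S>> :> {set gT} ->
  E \subset 'N(M) -> {in S &, forall x y, [~ x, y] \in M} -> E^`(1) \subset M.
Proof.
move=> defE nME cS; have sSE : S \subset E by rewrite defE subset_gen.
apply: der1_min => //; rewrite defE quotient_gen ?(subset_trans sSE) //.
rewrite abelian_gen; apply/centsP=> _ /morphimP[x nx xS ->] _ /morphimP[y ny yS ->].
by apply/commgP; rewrite -morphR //= coset_id ?cS.
Qed.
End Commutators.

Section CommutingPairs.
Variables (gT : finGroupType) (p : nat) (E Z : {group gT}).
Hypotheses (p_pr : prime p) (pE : p.-group E) (oZ : #|Z| = p).
Hypotheses (cZE : Z \subset 'Z(E)) (sZE' : Z \subset E^`(1)).
Hypothesis CP : {in E &, forall x y, [~ x, y] \in Z -> [~ x, y] = 1}.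

Let p_gt0 := prime_gt0 p_pr.
Let p_gt1 := prime_gt1 p_pr.

Lemma ZE_sub : 'Z(E) \subset E. Proof. exact: subsetIl. Qed.

(** X and Z form a direct product inside a centre of order p^2, so X has order at most p. *)
Lemma TI_Z_central (X : {group gT}) d : #|'Z(E)| = (p ^ 2)%N ->
  X \subset 'Z(E) -> X :&: Z = 1 -> d \in X -> d != 1 -> X = <[d]> :> {set gT}.
Proof.
move=> oC sXC tiXZ dX d1; apply/eqP; rewrite eq_sym eqEcard cycle_subG dX /=.
have sXE := subset_trans sXC ZE_sub.
have leX : #|X| <= p.
  rewrite -(leq_pmul2r p_gt0) -{1}oZ -TI_cardMg // [(p * p)%N]mulnn -oC.
  by apply: subset_leq_card; rewrite mul_subG.
apply: leq_trans leX _; apply: dvdn_leq => //.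
have /p_natP[k ok] : p.-nat #[d] by apply: (mem_p_elt pE); apply: (subsetP sXE).
by move: d1; rewrite -order_eq1 -orderE ok; case: k {ok} => // k _; rewrite expnS dvdn_mulr.
Qed.

(** For fixed v the elements [v, e], and for fixed g the elements [v, g], form central subgroups
    made of commutators, which therefore avoid Z. By [TI_Z_central] two such subgroups coincide once
    they share a nontrivial element, so all commutators [v, e] lie in a single one. *)
Lemma TI_Z_comm2 (V : {group gT}) : #|'Z(E)| = (p ^ 2)%N -> V \subset E ->
  {in V & E, forall v e, [~ v, e] \in 'Z(E)} -> [~: V, E] :&: Z = 1.
Proof.
move=> oC sVE cVE.
have sub : forall v, v \in V -> v \in E := subsetP sVE.
have [cc | ] := boolP [forall v in V, forall e in E, [~ v, e] == 1].
  apply/trivgP; apply: subset_trans (subsetIl _ _) _; rewrite gen_subG.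
  apply/subsetP => _ /imset2P[v e vV eE ->].
  by rewrite inE; move/forall_inP/(_ v vV)/forall_inP: cc; apply.
rewrite negb_forall_in => /exists_inP[v0 v0V]; rewrite negb_forall_in.
case/exists_inP=> g gE nt.
pose Y := group (group_set_comm_l sVE (fun v vV => cVE v g vV gE)).
have YC : Y \subset 'Z(E).
  by apply/subsetP=> _ /imsetP[v vV ->]; apply: (cVE).
have YZ : Y :&: Z = 1.
  apply/trivgP/subsetP=> _ /setIP[/imsetP[v vV ->] dZ]; rewrite inE.
  by apply/eqP/CP => //; apply: sub.
have YE v : v \in V -> [~ v, g] \in Y by move=> vV; apply/imsetP; exists v.
(* The row X of v and the column Y of g share the nontrivial entry [v, g]. *)
have key v e : v \in V -> e \in E -> [~ v, g] != 1 -> [~ v, e] \in Y.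
  move=> vV eE vg.
  have hX : {in E, forall e, [~ v, e] \in 'Z(E)} by move=> f fE; apply: (cVE).
  pose X := group (group_set_comm_r (subxx E) hX).
  have XC : X \subset 'Z(E) by apply/subsetP=> _ /imsetP[f fE ->]; apply: (cVE).
  have XZ : X :&: Z = 1.
    apply/trivgP/subsetP=> _ /setIP[/imsetP[f fE ->] dZ]; rewrite inE.
    by apply/eqP/CP => //; apply: sub.
  have XE f : f \in E -> [~ v, f] \in X by move=> fE; apply/imsetP; exists f.
  have /setP/(_ [~ v, e]) := TI_Z_central oC XC XZ (XE g gE) vg.
  by rewrite XE // => /esym; apply: subsetP; rewrite cycle_subG; apply: YE.
apply/trivgP; rewrite -YZ setSI // gen_subG.
apply/subsetP => _ /imset2P[v e vV eE ->].
have [vg1|] := eqVneq [~ v, g] 1; last exact: key.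
(* If v commutes with g, then v v0 does not. *)
have vv0 : v * v0 \in V by rewrite groupM.
have : [~ v * v0, e] \in Y.
  apply: key => //; rewrite commgMl ?vg1 ?mul1g //; exact: commute_sym (commute1 _).
rewrite commgMl ?(groupMr _ (key _ _ v0V eE nt)) //.
by apply: commg_central (cVE v e vV eE) _; apply: sub.
Qed.

(** E is generated by V and two elements u, y, so E' is generated by c = [u, y] and D = [V, E]. As D
    avoids Z, a nontrivial z in Z is c^k d with d in D and k prime to p, which makes c central. Then
    D is contained in the product of [u^k, V] and [V, y], so d = [u^k, v1] [v, y], and z becomes the
    single commutator [u^k v, y v1]. *)
Lemma no_frame (V : {group gT}) : V \subset E -> 'Z(E) \subset V -> abelian V ->
  {in V & E, forall v e, [~ v, e] \in 'Z(E)} -> #|E : V| = (p ^ 2)%N ->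
  [~: V, E] :&: Z = 1 -> False.
Proof.
move=> sVE sCV cVV cVE iV tiDZ; set D := [~: V, E] in tiDZ.
have subV : forall v, v \in V -> v \in E := subsetP sVE.
have sDC : D \subset 'Z(E).
  by rewrite gen_subG; apply/subsetP => _ /imset2P[v e vV eE ->]; apply: (cVE).
have DVE v e : v \in V -> e \in E -> [~ v, e] \in D by apply: mem_commg.
have sDE := subset_trans sDC ZE_sub.
have nVE : E \subset 'N(V) by rewrite -commg_subl (subset_trans sDC).
have nDE : E \subset 'N(D) by apply: normal_norm (sub_center_normal sDC).
have oEV : #|E / V| = (p ^ 2)%N by rewrite card_quotient.
have sE'V : E^`(1) \subset V.
  by apply: der1_min => //; apply: (p2group_abelian (p := p)); rewrite ?oEV ?pfactorK ?quotient_pgroup.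
have [ub ubE oub] : exists2 ub, ub \in E / V & #[ub] = p.
  by have [//||x ? ?] := @Cauchy _ p (E / V); rewrite ?oEV ?dvdn_exp //; exists x.
have [u uE [uV upV ou]] : exists2 u, u \in E & [/\ u \notin V, u ^+ p \in V & #[coset V u] = p].
  case/morphimP: ubE oub => u nu uE -> ou; exists u => //; split=> //.
    by apply: contraL p_gt1 => /coset_id u1; rewrite -ou /= u1 order1.
  by apply: coset_idr; rewrite ?groupX // morphX // -ou expg_order.
pose U := (<[u]> <*> V)%G.
have sVU : V \subset U by apply: joing_subr.
have uU : u \in U by rewrite mem_gen // inE cycle_id.
have sUE : U \subset E by rewrite join_subG cycle_subG uE.
have iU : #|E : U| = p.
  have oU : #|U : V| = p.
    rewrite -card_quotient ?(subset_trans sUE) // quotientYidr ?cycle_subG ?(subsetP nVE) //.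
    by rewrite quotient_cycle ?(subsetP nVE).
  by apply/eqP; rewrite -(eqn_pmul2r p_gt0) mulnn -iV -(Lagrange_index sUE sVU) oU.
have [y yE yU] : exists2 y, y \in E & y \notin U.
  by apply/subsetPn; rewrite -indexg_eq1 iU neq_ltn p_gt1 orbT.
have defE : <[y]> <*> U = E.
  have pU : prime #|E : U| by rewrite iU.
  have /maxgroupP[_ maxU] := p_index_maximal sUE pU.
  apply/eqP; rewrite eqEproper join_subG cycle_subG yE sUE /=.
  apply: contra yU => /maxU <-; first by rewrite mem_gen // inE cycle_id.
  exact: joing_subr.
have genE : E = <<y |: (u |: V)>> :> {set gT}.
  apply/eqP; rewrite eqEsubset; apply/andP; split; last first.
    by rewrite gen_subG !subUset !sub1set yE uE.
  rewrite -defE !join_subG !cycle_subG !mem_gen ?inE ?eqxx ?orbT //=.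
  by rewrite sub_gen // setUA subsetUr.
have gE (F : {group gT}) : V \subset F -> u \in F -> y \in F -> E \subset F.
  by move=> VF uF yF; rewrite -defE !join_subG !cycle_subG yF uF.
pose c := [~ u, y].
have cE' : c \in E^`(1) by rewrite mem_commg.
have cV : c \in V := subsetP sE'V _ cE'.
have cD e : e \in E -> [~ c, e] \in D by apply: DVE.
have cE := subV c cV.
pose M := (<[c]> <*> D)%G.
have sDM : D \subset M by apply: joing_subr.
have nME : E \subset 'N(M).
  rewrite -commg_subl gen_subG; apply/subsetP => _ /imset2P[m e mM eE ->].
  apply: (subsetP sDM); apply: DVE => //; apply: subsetP mM.
  rewrite join_subG cycle_subG cV; exact: subset_trans sDC sCV.
have sE'M : E^`(1) \subset M.
  apply: der1_sub_gen genE nME _ => a b; rewrite !in_setU1.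
  have cM : c \in M by rewrite mem_gen // inE cycle_id.
  have VEM v e : v \in V -> e \in E -> [~ v, e] \in M.
    by move=> vV eE; apply/(subsetP sDM)/DVE.
  have EVM v e : v \in V -> e \in E -> [~ e, v] \in M.
    by move=> vV eE; rewrite -invg_comm groupV VEM.
  have inE3 x : [|| x == y, x == u | x \in V] -> x \in E.
    by case/or3P=> [/eqP->|/eqP->|/subV].
  case/or3P=> [/eqP->|/eqP->|aV] /or3P[/eqP->|/eqP->|bV];
    try solve [exact: VEM | exact: EVM | by rewrite commgg group1 | by []].
    by rewrite -invg_comm groupV.
  by apply: VEM; rewrite ?subV.
have [z zZ z1] : exists2 z, z \in Z & z != 1.
  by apply/trivgPn; rewrite -cardG_gt1 oZ.
have zC := subsetP cZE z zZ.
have /mulsgP[_ d /cycleP[k ->] dD zcd] : z \in <[c]> * D.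
  rewrite -norm_joinEl ?cycle_subG ?(subsetP nDE) //.
  exact: (subsetP sE'M _ (subsetP sZE' z zZ)).
have dC := subsetP sDC d dD.
(* Modulo D, c commutes with u, so c^p is [u^p, y], and u^p lies in V. *)
have cpD : c ^+ p \in D.
  apply: coset_idr; first by rewrite groupX ?(subsetP nDE).
  have [nu ny nc] := And3 (subsetP nDE u uE) (subsetP nDE y yE) (subsetP nDE c cE).
  have cuc : commute (coset D u) (coset D c).
    by apply/commgP; rewrite -morphR //= coset_id // -invg_comm groupV cD.
  have ce : coset D c = [~ coset D u, coset D y] by rewrite -morphR.
  rewrite morphX //= ce -commXg -?ce //.
  by rewrite -morphX // -morphR ?groupX //= coset_id ?DVE.
have coPk : coprime p k.
  rewrite prime_coprime //; apply/negP => /dvdnP[m km].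
  have zD : z \in D by rewrite zcd km mulnC expgM groupM // groupX.
  have : z \in D :&: Z by rewrite inE zD.
  by rewrite tiDZ inE (negPf z1).
have cC : c \in 'Z(E).
  apply: mem_expg_coprime coPk p_gt0 _ _; first exact: subsetP cpD.
  by rewrite -(groupMr _ dC) -zcd.
pose u1 := u ^+ k.
have cEc e : e \in E -> commute c e by apply: (@commg_central _ E u y).
have u1E : u1 \in E by apply: groupX.
have u1y : [~ u1, y] = c ^+ k by apply: commXg; apply/commute_sym/cEc.
have cVr v : v \in V -> [~ u1, v] \in 'Z(E).
  by move=> vV; rewrite -invg_comm groupV cVE.
have cVl v : v \in V -> [~ v, y] \in 'Z(E) by move=> vV; apply: (cVE).
pose X := group (group_set_comm_r sVE cVr).
pose Y := group (group_set_comm_l sVE cVl).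
have cXY : Y \subset 'C(X).
  apply/centsP=> _ /imsetP[v vV ->] _ /imsetP[w wV ->].
  apply: commg_central (cVl v vV) _; exact: (subsetP ZE_sub _ (cVr w wV)).
have sDXY : D \subset X * Y.
  rewrite -(cent_joinEr cXY) gen_subG; apply/subsetP => _ /imset2P[w e wV eE ->].
  have wC f : f \in E -> [~ w, f] \in 'Z(E) by apply: (cVE).
  have gF : group_set [set f in E | [~ w, f] \in X <*> Y].
    apply/group_setP; split=> [|f g]; first by rewrite inE group1 commg1 group1.
    rewrite !inE => /andP[fE fXY] /andP[gE' gXY]; rewrite groupM //=.
    by rewrite commgMr; [rewrite groupM | apply: commg_central (wC f fE) _].
  suff /subsetP/(_ e eE) : E \subset group gF by rewrite inE => /andP[].
  have sVF : V \subset group gF.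
    apply/subsetP => v vV; rewrite inE subV //=.
    have -> : [~ w, v] = 1 by apply/eqP/commgP/(centsP cVV).
    exact: group1.
  apply: gE => //.
    apply: mem_expg_coprime coPk p_gt0 _ _; first exact: (subsetP sVF).
    rewrite inE u1E /= mem_gen // inE -invg_comm; apply/orP; left.
    by rewrite (groupV X); apply/imsetP; exists w.
  rewrite inE yE /= mem_gen // inE; apply/orP; right; apply/imsetP; by exists w.
have /mulsgP[_ _ /imsetP[v1 v1V ->] /imsetP[v vV ->] dE] := subsetP sDXY d dD.
have zE : z = [~ u1 * v, y * v1].
  have uvC : [~ u1, v1] \in 'Z(E) by apply: (cVr).
  have vyC : [~ v, y] \in 'Z(E) by apply: (cVl).
  have vv1 : [~ v, v1] = 1 by apply/eqP/commgP/(centsP cVV).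
  have ccC x : x \in E -> commute (c ^+ k) x by move=> xE; apply/commute_sym/commuteX/commute_sym/cEc.
  have e1 : [~ u1 * v, y] = c ^+ k * [~ v, y] by rewrite commgMl u1y //; apply: ccC; apply: subV.
  have e2 : [~ u1 * v, v1] = [~ u1, v1].
    by rewrite commgMl ?vv1 ?mulg1 //; apply: commg_central uvC _; apply: subV.
  rewrite commgMr e1 ?e2; last first.
    apply/commute_sym/commuteM; apply: commute_sym; first exact/ccC/subV.
    by apply: commg_central vyC _; apply: subV.
  rewrite zcd dE mulgA [in RHS]mulgA; congr (_ * _).
  by apply: ccC; apply: subsetP ZE_sub _ uvC.
by move: z1; rewrite zE CP ?eqxx -?zE //; apply: groupM => //; apply: subV.
Qed.

Lemma commXg_central (G : {group gT}) x y n : [~ x, y] \in 'Z(G) -> x \in G ->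
  [~ x ^+ n, y] = [~ x, y] ^+ n.
Proof. by move=> c xG; apply/commXg/commute_sym; apply: commg_central c xG. Qed.

End CommutingPairs.

(** The group would be extraspecial, hence of order an odd power of p. *)
Lemma class2_p4_center (gT : finGroupType) (p : nat) (Q : {group gT}) :
  prime p -> #|Q| = (p ^ 4)%N -> Q^`(1) \subset 'Z(Q) -> #|'Z(Q)| != p.
Proof.
move=> p_pr oQ sQ'Z; apply/negP=> /eqP oZ.
have pQ : p.-group Q by rewrite /pgroup oQ pnatX pnat_id.
have Q'Z : Q^`(1) = 'Z(Q).
  apply/eqP; have := prime_subgroupVti; rewrite eqEsubset sQ'Z /=.
  have [// | /(prime_TIg _) ti] := boolP ('Z(Q) \subset Q^`(1)).
  move: ti; rewrite oZ => /(_ p_pr) ti _.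
  have /derG1P/center_idP : Q^`(1) = 1.
    by apply/trivgP; rewrite -ti subsetI sQ'Z subxx.
  move=> ZQ; move: oZ; rewrite ZQ oQ => /eqP.
  by rewrite -{2}(expn1 p) eqn_exp2l ?prime_gt1.
have spQ : extraspecial Q.
  split; last by rewrite oZ.
  split=> //; rewrite (Phi_joing pQ) Q'Z; apply/joing_idPl.
  rewrite (MhoE 1 pQ) gen_subG; apply/subsetP => _ /imsetP[x xQ ->].
  rewrite inE groupX //=; apply/centP => y yQ; apply/commgP.
  have xyZ : [~ x, y] \in 'Z(Q) by rewrite -Q'Z mem_commg.
  rewrite expn1 (commXg_central _ xyZ) //.
  by rewrite -order_dvdn -oZ order_dvdG.
have [n _] := card_extraspecial pQ spQ; rewrite oQ => /eqP.
by rewrite eqn_exp2l ?prime_gt1 // => /eqP /(congr1 odd); rewrite /= odd_double.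
Qed.

(** * Centre and nilpotency class of the extension *)

Section Class.
Variables (gT : finGroupType) (p : nat) (E Z : {group gT}).
Hypotheses (p_pr : prime p) (oE : #|E| = (p ^ 6)%N) (oZ : #|Z| = p).
Hypotheses (cZE : Z \subset 'Z(E)) (sZE' : Z \subset E^`(1)).
Hypothesis CP : {in E &, forall x y, [~ x, y] \in Z -> [~ x, y] = 1}.

Let p_gt0 := prime_gt0 p_pr.
Let p_gt1 := prime_gt1 p_pr.
Let pE : p.-group E. Proof. by rewrite /pgroup oE pnatX pnat_id. Qed.

Let Z_neq1 : ~ Z \subset (1 : {set gT}).
Proof. by move/trivgP => Z1; move: p_gt1; rewrite -oZ Z1 cards1. Qed.

Let Enab : ~ abelian E.
Proof. by move/derG1P => E1; apply: Z_neq1; rewrite -E1. Qed.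

Lemma ucn2P x e : x \in 'Z_2(E) -> e \in E -> [~ x, e] \in 'Z(E).
Proof. by move=> xZ2 eE; rewrite -ucn1; apply: (subsetP (ucn_comm 1 E)); apply: mem_commg. Qed.

Lemma sub_ucn12 : 'Z(E) \subset 'Z_2(E).
Proof. by rewrite -ucn1; apply: ucn_subS. Qed.

Lemma mem_ucn2 x : x \in E -> {in E, forall e, [~ x, e] \in 'Z(E)} ->
  x \in 'Z_2(E).
Proof.
move=> xE xZ; rewrite ucnSnR inE xE ucn1 gen_subG.
by apply/subsetP => _ /imset2P[y e /set1P-> eE ->]; apply: xZ.
Qed.

Lemma mem_ucn2_coset x : x \in E -> coset 'Z(E) x \in 'Z(E / 'Z(E)) -> x \in 'Z_2(E).
Proof.
move=> xE /setIP[_ cx]; apply: mem_ucn2 => // e eE.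
have nZ y : y \in E -> y \in 'N('Z(E)).
  by apply/subsetP/normal_norm/center_normal.
apply: coset_idr; rewrite ?groupR ?nZ // morphR ?nZ //.
by apply/eqP/commgP; apply: (centP cx); apply: mem_quotient.
Qed.

Let frame (V : {group gT}) := no_frame p_pr pE oZ cZE sZE' CP (V := V).

(** Index 1 or p makes E abelian. Index p^2 contradicts [no_frame] for V = Z(E), and index p^3 does
    so for V generated by Z(E) and some v in the second centre: there [V, E] consists of commutators
    [v, e], so it avoids Z. *)
Lemma index_center_neq k : #|E : 'Z(E)| = (p ^ k)%N -> 3 < k.
Proof.
have CE := ZE_sub E.
have nCE : E \subset 'N('Z(E)) by apply/normal_norm/center_normal.
case: k => [|[|[|[|k]]]] //.
- by move/index1g => /(_ CE) ZE; case: Enab; apply/center_idP.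
- rewrite expn1 => iZ; case: Enab; apply: cyclic_center_factor_abelian.
  by apply: prime_cyclic; rewrite card_quotient // iZ.
- move=> iZ; exfalso; apply: (@frame 'Z(E)%G) => //.
  + exact: center_abelian.
  + move=> x e xZ eE; apply: ucn2P => //; exact: (subsetP sub_ucn12).
  + apply/trivgP; apply: subset_trans (subsetIl _ _) _; apply/trivgP.
    by apply/commG1P; rewrite subIset // subxx orbT.
move=> iZ; exfalso.
have oQ : #|E / 'Z(E)| = (p ^ 3)%N by rewrite card_quotient.
have pQ : p.-group (E / 'Z(E)) by apply: quotient_pgroup.
have Zn1 : 'Z(E / 'Z(E)) != 1.
  rewrite (center_nil_eq1 (pgroup_nil pQ)) -cardG_gt1 oQ.
  by rewrite -(exp1n 3) ltn_exp2r.
have [_ pZ _] := pgroup_pdiv (pgroupS (center_sub _) pQ) Zn1.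
have [v0 vZ ov] := Cauchy p_pr pZ.
have /setIP[/morphimP[v nv vE v0E] _] := vZ; rewrite v0E /= in vZ ov.
have vZ2 := mem_ucn2_coset vE vZ.
pose V := (<[v]> <*> 'Z(E))%G.
have sVZ2 : V \subset 'Z_2(E) by rewrite join_subG cycle_subG vZ2 sub_ucn12.
have sCV : 'Z(E) \subset V by apply: joing_subr.
have sVE : V \subset E := subset_trans sVZ2 (ucn_sub 2 E).
have oV : #|V : 'Z(E)| = p.
  rewrite -card_quotient ?(subset_trans sVE) // quotientYidr ?cycle_subG //.
  by rewrite quotient_cycle.
have cVV : abelian V.
  rewrite /= abelianY cycle_abelian center_abelian /= centsC cycle_subG.
  by apply/centP => z /setIP[_ /centP cz]; apply/commute_sym/cz.
have cVE : {in V & E, forall w e, [~ w, e] \in 'Z(E)}.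
  by move=> w e wV eE; apply: ucn2P => //; apply: (subsetP sVZ2).
apply: (@frame V) => //.
  apply/eqP; rewrite -(eqn_pmul2r p_gt0) -expnSr -iZ.
  by rewrite -(Lagrange_index sVE sCV) oV.
have vC e : e \in E -> [~ v, e] \in 'Z(E) by apply: ucn2P.
pose X := group (group_set_comm_r (subxx E) vC).
have XZ : X :&: Z = 1.
  by apply/trivgP/subsetP=> _ /setIP[/imsetP[e eE ->] dZ]; rewrite inE; apply/eqP/CP.
apply/trivgP; rewrite -XZ setSI // gen_subG; apply/subsetP => _ /imset2P[w e wV eE ->].
move: wV; rewrite /= norm_joinEl ?cycle_subG // => /mulsgP[_ z /cycleP[m ->] zZ ->].
have ze : [~ z, e] = 1.
  by case/setIP: zZ => _ /centP cz; apply/eqP/commgP/cz.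
rewrite commgMl ?ze ?mulg1; last first.
  apply: commg_central (cVE (v ^+ m) e _ eE) (subsetP (ZE_sub E) _ zZ).
  by rewrite groupX // mem_gen // inE cycle_id.
rewrite (commXg_central _ (vC e eE)) //.
have vX : [~ v, e] \in X by apply/imsetP; exists e.
exact: (groupX m vX).
Qed.

(** The condition on commuting pairs lifts central elements of E / Z to central elements of E, so
    Z(E) is larger than Z; the index bound leaves only p^2. *)
Lemma card_center : #|'Z(E)| = (p ^ 2)%N.
Proof.
have CE := ZE_sub E.
have := cardSg CE; rewrite oE => /(dvdn_pfactor _ _ p_pr)[m m6 om].
have iZ : #|E : 'Z(E)| = (p ^ (6 - m))%N.
  by rewrite -divgS // oE om -expnB // ltnW.
have := index_center_neq iZ; rewrite om => lm.
suff m2 : 1 < m by congr (_ ^ _)%N; move: lm m2; clear; lia.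
rewrite ltnNge; apply/negP => m1.
have ZZ : Z = 'Z(E) :> {set gT}.
  apply/eqP; rewrite eqEcard cZE om oZ -{2}(expn1 p).
  by rewrite leq_exp2l.
have nZE : Z <| E := sub_center_normal cZE.
have : 'Z(E / Z) != 1.
  rewrite (center_nil_eq1 (pgroup_nil (quotient_pgroup _ pE))) -cardG_gt1.
  rewrite card_quotient ?normal_norm // -divgS ?normal_sub // oE oZ.
  by rewrite -{2}(expn1 p) -expnB // -(exp1n 5) ltn_exp2r.
case/trivgPn=> _ /setIP[/morphimP[x nx xE ->] cx] x1; case/negP: x1.
apply/eqP/coset_id; rewrite ZZ; apply/setIP; split=> //.
apply/centP => y yE; apply/commgP/eqP/CP => //.
have ny := subsetP (normal_norm nZE) y yE.
apply: coset_idr; rewrite ?groupR // morphR //.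
by apply/eqP/commgP; apply: (centP cx); apply: mem_quotient.
Qed.

Lemma center_quotient_center : 'Z(E / 'Z(E)) = 'Z_2(E) / 'Z(E).
Proof.
have nZ y : y \in E -> y \in 'N('Z(E)).
  by apply/subsetP/normal_norm/center_normal.
apply/eqP; rewrite eqEsubset; apply/andP; split; apply/subsetP => x xZ.
  have /setIP[/morphimP[y ny yE xy] _] := xZ; rewrite xy /= in xZ *.
  by apply: mem_quotient; apply: mem_ucn2_coset.
case/morphimP: xZ => {}x nx xV -> /=; have xE := subsetP (ucn_sub 2 E) x xV.
rewrite inE mem_quotient //; apply/centP => _ /morphimP[y ny yE ->].
by apply/commgP; rewrite -morphR ?nZ //= coset_id ?ucn2P.
Qed.

(** Suppose E' lies in V = Z_2(E), of order p^m. If m = 2, E / Z(E) has trivial centre; if m = 3, it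
    has order p^4, class at most 2 and centre of order p; if m = 5, V and one element generate E, so
    E' is central and m = 6; if m = 6, E' = [V, E] avoids Z. If m = 4, V is abelian and [no_frame]
    applies. *)
Lemma nil_class_gt3 : ~~ (E^`(1) \subset 'Z_2(E)).
Proof.
apply/negP => sE'V; set V := 'Z_2(E) in sE'V.
have oC := card_center.
have sVE : V \subset E := ucn_sub 2 E.
have cVE : {in V & E, forall w e, [~ w, e] \in 'Z(E)} by move=> w e; apply: ucn2P.
have tiVZ := TI_Z_comm2 p_pr pE oZ cZE CP oC sVE cVE.
have := cardSg sVE; rewrite oE => /(dvdn_pfactor _ _ p_pr)[m m6 om].
have nVE : V <| E := ucn_normal 2 E.
have sCV : 'Z(E) \subset V := sub_ucn12.
have iV : #|E : V| = (p ^ (6 - m))%N.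
  by rewrite -divgS // oE om -expnB.
have m2 : 1 < m.
  by move: (subset_leq_card sCV); rewrite oC om leq_exp2l.
have sE'C : E^`(1) \subset 'Z(E) -> m = 6.
  move=> sE'C; apply/eqP; rewrite -(eqn_exp2l _ _ p_gt1) -oE -om; apply/eqP/eq_card.
  apply/setP/eqP; rewrite eqEsubset sVE; apply/subsetP => x xE; apply: mem_ucn2 => // e eE.
  by apply: (subsetP sE'C); apply: mem_commg.
have nC : E \subset 'N('Z(E)) by apply/normal_norm/center_normal.
have oVC : #|V / 'Z(E)| = (p ^ (m - 2))%N.
  by rewrite card_quotient ?(subset_trans sVE) // -divgS // oC om -expnB.
have oQ : #|E / 'Z(E)| = (p ^ 4)%N.
  by rewrite card_quotient // -divgS ?ZE_sub // oC oE -expnB.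
have [m2' | [m3 | [m4 | [m5 | m6']]]] :
    m = 2 \/ m = 3 \/ m = 4 \/ m = 5 \/ m = 6 by move: m2 m6; clear; lia.
- have pQ : p.-group (E / 'Z(E)) by apply: quotient_pgroup.
  have : 'Z(E / 'Z(E)) != 1.
    by rewrite (center_nil_eq1 (pgroup_nil pQ)) -cardG_gt1 oQ -(exp1n 4) ltn_exp2r.
  by rewrite center_quotient_center -cardG_gt1 oVC m2'.
- have : #|'Z(E / 'Z(E))| != p.
    apply: class2_p4_center oQ _ => //; rewrite center_quotient_center.
    by rewrite -quotient_der // quotientS.
  by rewrite center_quotient_center oVC m3 eqxx.
- apply: (@frame 'Z_2(E)%G) => //; last by rewrite iV m4.
  (* By the three subgroups lemma E' centralises V. Hence Z(V) strictly contains Z(E), and its index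
     in V is at most p. *)
  have cE'V : [~: E, E, V] = 1.
    apply: three_subgroup; last first.
      apply/commG1P; apply: subset_trans (subsetIr E 'C(E)).
      rewrite gen_subG; apply/subsetP=> _ /imset2P[w e wV eE ->]; exact: cVE.
    rewrite [[~: E, _]]commGC.
    apply/commG1P; apply: subset_trans (subsetIr E 'C(E)).
    rewrite gen_subG; apply/subsetP=> _ /imset2P[w e wV eE ->]; exact: cVE.
  have sE'ZV : E^`(1) \subset 'Z(V) by rewrite subsetI sE'V; apply/commG1P.
  have sCZV : 'Z(E) \subset 'Z(V) by rewrite subsetI sCV (subset_trans (subsetIr _ _)) ?centS.
  have pr : 'Z(E) \proper 'Z(V).
    rewrite properE sCZV; apply/negP => s; move: m4.
    by rewrite sE'C // (subset_trans sE'ZV).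
  have := cardSg (subsetIl V 'C(V)); rewrite om => /(dvdn_pfactor _ _ p_pr)[k km ok].
  have k2 : 2 < k by move: (proper_card pr); rewrite oC ok ltn_exp2l.
  apply: cyclic_center_factor_abelian.
  have oVZ : #|V / 'Z(V)| = (p ^ (m - k))%N.
    by rewrite card_quotient ?normal_norm ?center_normal // -divgS ?subsetIl // om ok -expnB.
  have [kk | kk] : m - k = 0%N \/ m - k = 1%N by move: k2; rewrite m4; clear; lia.
    by rewrite (card1_trivg (_ : #|V / 'Z(V)| = 1%N)) ?cyclic1 // oVZ kk.
  by apply: prime_cyclic; rewrite oVZ kk.
- have iV1 : prime #|E : V| by rewrite iV m5.
  have /subsetPn[x xE xV] : ~~ (E \subset V).
    by rewrite -indexg_eq1; move: iV1; case: eqP => // ->.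
  have defE : E = <<x |: V>> :> {set gT}.
    have /maxgroupP[_ maxV] := p_index_maximal sVE iV1.
    apply/eqP; rewrite eq_sym eqEproper gen_subG subUset sub1set xE sVE /=.
    apply: contra xV => /maxV; rewrite sub_gen ?subsetUr // => /(_ isT).
    by rewrite /V => <-; rewrite mem_gen // setU11.
  suff: E^`(1) \subset 'Z(E) by move/sE'C; rewrite m5.
  apply: der1_sub_gen defE nC _ => a b; rewrite !in_setU1.
  case/predU1P=> [->|aV] /predU1P[->|bV]; rewrite ?commgg ?group1 //.
  + by rewrite -invg_comm groupV cVE.
  + exact: cVE.
  + by apply: cVE => //; apply: (subsetP sVE).
have VE : V = E.
  by apply/eqP; rewrite eqEcard sVE oE om m6' /=.
move: tiVZ; rewrite /= -/V VE => ti; apply: Z_neq1; rewrite -ti subsetI subxx andbT.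
exact: sZE'.
Qed.
End Class.

(** * Consequences for the quotient by Z *)

Section NoAbelianMaximal.
Variables (gT : finGroupType) (p : nat) (E Z : {group gT}).
Hypotheses (p_pr : prime p) (nZE : E \subset 'N(Z)) (sZE : Z \subset E) (Z1 : Z != 1 :> {set gT}).
Hypothesis sZE' : Z \subset E^`(1).
Hypothesis CP : {in E &, forall x y, [~ x, y] \in Z -> [~ x, y] = 1}.

(** E' reduces to the subgroup of single commutators [a, y] with a in A, so Z would contain a
    nontrivial commutator. *)
Lemma normal_abelian_cyclic_index (A : {group gT}) y :
  A \subset E -> y \in E -> E \subset 'N(A) -> abelian A ->
  E = <<y |: A>> :> {set gT} -> False.
Proof.
move=> sAE yE nAE cAA defE.
have sub : forall v, v \in A -> v \in E := subsetP sAE.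
have cA a e : a \in A -> e \in E -> [~ a, e] \in A.
  move=> aA eE; move: (nAE); rewrite -commg_subl => /subsetP; apply; exact: mem_commg.
have gX : group_set [set [~ a, y] | a in A].
  apply/group_setP; split=> [|_ _ /imsetP[u uA ->] /imsetP[v vA ->]].
    by apply/imsetP; exists 1; rewrite ?group1 ?comm1g.
  apply/imsetP; exists (u * v); rewrite ?groupM // commgMl //.
  by apply: (centsP cAA) vA; apply: cA.
have XA a : a \in A -> [~ a, y] \in group gX by move=> aA; apply/imsetP; exists a.
have nX : E \subset 'N(group gX).
  rewrite defE gen_subG subUset sub1set; apply/andP; split.
    rewrite inE; apply/subsetP => _ /imsetP[_ /imsetP[a aA ->] ->]; rewrite conjRg.
    rewrite [y ^ y]conjgE mulKg; apply: XA; rewrite memJ_norm //; exact: (subsetP nAE).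
  apply: cents_norm; apply/centsP => b bA _ /imsetP[a aA ->].
  by apply: (centsP cAA) => //; apply: cA.
have sE'X : E^`(1) \subset group gX.
  apply: der1_sub_gen defE nX _ => a b; rewrite !in_setU1.
  case/predU1P=> [->|aA] /predU1P[->|bA]; rewrite ?commgg ?group1 //.
  - by rewrite -invg_comm groupV XA.
  - exact: XA.
  - by have /commgP/eqP-> := centsP cAA _ aA _ bA; rewrite group1.
have /trivgPn[z zZ z1] := Z1.
have /imsetP[a aA za] := subsetP (subset_trans sZE' sE'X) z zZ.
by move: z1; rewrite za CP ?eqxx -?za // sub.
Qed.

(** The condition on commuting pairs makes the preimage of A abelian. *)
Lemma quotient_no_abelian_maximal (A : {group coset_of Z}) :
  p.-group E -> A \subset E / Z -> abelian A -> #|E / Z : A| != p.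
Proof.
move=> pE sAG cAA; apply/negP=> /eqP iA.
pose B := (coset Z @*^-1 A)%G.
have sBE : B \subset E by rewrite -(quotientGK (_ : Z <| E)) ?morphpreS // /normal sZE.
have sZB : Z \subset B by rewrite -{1}(ker_coset Z) morphpreS ?sub1G.
have nB x : x \in B -> x \in 'N(Z) by move=> xB; apply: (subsetP nZE); apply: (subsetP sBE).
have iB : #|E : B| = p.
  rewrite -iA -(cosetpreK A) [RHS]index_quotient_eq //.
  by rewrite setIC (setIidPl _) // (subset_trans sZB).
have mB := p_index_maximal sBE (_ : prime #|E : B|); move: mB; rewrite iB => /(_ p_pr) mB.
have [y yE yB] : exists2 y, y \in E & y \notin B.
  by apply/subsetPn; rewrite -indexg_eq1 iB neq_ltn prime_gt1 ?orbT.
apply: (@normal_abelian_cyclic_index B y) => //.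
- by apply: normal_norm; apply: p_maximal_normal pE mB.
- apply/centsP => x xB w wB; apply/commgP/eqP/CP; rewrite ?(subsetP sBE) //.
  apply: coset_idr; rewrite ?groupR ?nB // morphR ?nB //.
  move: xB wB => /morphpreP[_ xA] /morphpreP[_ wA].
  by apply/eqP/commgP; apply: (centsP cAA).
have /maxgroupP[_ maxB] := mB.
apply/eqP; rewrite eq_sym eqEproper gen_subG subUset sub1set yE sBE /=.
apply: contra yB => /maxB; rewrite sub_gen ?subsetUr // => /(_ isT) <-.
by rewrite mem_gen // setU11.
Qed.

(** If ['L_4(E)] lay in Z, its generators would be commutators in Z, hence trivial. *)
Lemma quotient_lcn4_neq1 : 'L_4(E) != 1 -> 'L_4(E / Z) != 1.
Proof.
apply: contra => /eqP L1; apply/eqP/trivgP.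
change ([~: 'L_3(E), E] \subset (1 : {set gT})); rewrite gen_subG.
have sLZ : 'L_4(E) \subset Z.
  by rewrite -quotient_sub1 ?(subset_trans (lcn_sub _ _)) // /quotient morphim_lcn // -/(quotient _ _) L1.
apply/subsetP => _ /imset2P[x y xL yE ->]; rewrite inE; apply/eqP/CP => //.
  exact: (subsetP (lcn_sub 3 E)).
by apply: (subsetP sLZ); rewrite (lcnSn 2 E); apply: mem_commg.
Qed.

End NoAbelianMaximal.

(** The relations shared by the whole family; the p-th powers of a and a1, which vary, are left to
    [phi10_gens]. *)
Record phi10_rels (p : nat) (gT : finGroupType) (a a1 a2 a3 a4 : gT) : Prop :=
  Phi10Rels {
    phi10_a2 : [~ a1, a] = a2;
    phi10_a3 : [~ a2, a] = a3;
    phi10_a4 : [~ a3, a] = a4;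
    phi10_12 : [~ a1, a2] = a4;
    phi10_40 : [~ a4, a] = 1;
    phi10_13 : [~ a1, a3] = 1;
    phi10_14 : [~ a1, a4] = 1;
    phi10_23 : [~ a2, a3] = 1;
    phi10_24 : [~ a2, a4] = 1;
    phi10_34 : [~ a3, a4] = 1;
    phi10_2p : a2 ^+ p = 1;
    phi10_3p : a3 ^+ p = 1;
    phi10_4p : a4 ^+ p = 1 }.

Definition phi10_gens (p s t : nat) (gT : finGroupType) (G : {set gT}) (a a1 : gT) :=
  exists a2 a3 a4, [/\ G = <<[set a; a1]>>, phi10_rels p a a1 a2 a3 a4,
    a ^+ p = a4 ^+ s & a1 ^+ p = a4 ^+ t].

(** * Generators of a group of maximal class of order p^5 *)

Section MaximalClass.
Variables (gT : finGroupType) (p : nat) (G : {group gT}).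
Hypotheses (p_pr : prime p) (p_gt3 : 3 < p) (oG : #|G| = (p ^ 5)%N).
Hypothesis L4n1 : 'L_4(G) != 1.
Hypothesis noab : forall A : {group gT}, A \subset G -> abelian A -> #|G : A| != p.

Let p_gt0 := prime_gt0 p_pr.
Let p_gt1 := prime_gt1 p_pr.
Let pG : p.-group G. Proof. by rewrite /pgroup oG pnatX pnat_id. Qed.

Let L k := 'L_k(G)%G.

Let LG k : L k \subset G. Proof. exact: lcn_sub. Qed.
Let nL k : G \subset 'N(L k). Proof. exact: normal_norm (lcn_normal k G). Qed.
Let LS k : L k.+1 \subset L k. Proof. exact: lcn_subS. Qed.

Let Lcomm k x g : x \in L k.+1 -> g \in G -> [~ x, g] \in L k.+2.
Proof. exact: mem_commg. Qed.

Let Lcommr k x g : x \in L k.+1 -> g \in G -> [~ g, x] \in L k.+2.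
Proof. by move=> xL gG; rewrite -invg_comm groupV Lcomm. Qed.

Let Lpow k : exists2 m, #|L k| = (p ^ m)%N & m <= 5.
Proof.
by have := cardSg (LG k); rewrite oG => /(dvdn_pfactor _ _ p_pr)[m m5 om]; exists m.
Qed.

Let Lprop k : L k.+1 != 1 :> {set gT} -> #|L k.+2| < #|L k.+1|.
Proof.
move=> n1; apply: proper_card; apply: nil_comm_properl (pgroup_nil pG) _ n1 _ => //.
by rewrite subsetI subxx nL.
Qed.

Let L2E : L 2 = G^`(1) :> {set gT}. Proof. exact: lcn2. Qed.

Let Gncyc : ~~ cyclic (G / L 2).
Proof.
apply/negP => c; have /cyclic_abelian/derG1P G1 : cyclic G.
  by apply: cyclic_nilpotent_quo_der1_cyclic (pgroup_nil pG) _; rewrite -lcn2.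
case/eqP: L4n1; apply/trivgP; rewrite -G1 -lcn2.
by apply: subset_trans (LS 3) (LS 2).
Qed.

(** The series decreases strictly while nontrivial, [L 4] is nontrivial, and G / G' is not cyclic,
    hence of order at least p^2; p^5 leaves no other orders. *)
Let orders : [/\ #|L 2| = (p ^ 3)%N, #|L 3| = (p ^ 2)%N, #|L 4| = p & #|L 5| = 1%N].
Proof.
have n4 : L 4 != 1 :> {set gT} by [].
have up k : L k.+1 != 1 :> {set gT} -> L k != 1 :> {set gT}.
  by apply: contra => /eqP e; apply/eqP/trivgP; rewrite -e.
have n3 := up 3 n4; have n2 := up 2 n3.
have [e2 o2 le2] := Lpow 2; have [e3 o3 _] := Lpow 3; have [e4 o4 _] := Lpow 4.
have [e5 o5 _] := Lpow 5.
have := Lprop n4; have := Lprop n3; have := Lprop n2.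
rewrite o2 o3 o4 o5 !ltn_exp2l // => l32 l43 l54.
have iL2 : #|G / L 2| = (p ^ (5 - e2))%N.
  by rewrite card_quotient // -divgS ?LG // oG o2 -expnB.
have e2_le3 : e2 <= 3.
  rewrite leqNgt; apply: contra Gncyc => e2_gt3.
  have [e | e] : 5 - e2 = 0%N \/ 5 - e2 = 1%N by move: e2_gt3; clear; lia.
    by rewrite (card1_trivg (_ : #|G / L 2| = 1%N)) ?cyclic1 // iL2 e.
  by apply: prime_cyclic; rewrite iL2 e.
have [-> -> -> ->] : [/\ e2 = 3, e3 = 2, e4 = 1%N & e5 = 0%N] by move: l32 l43 l54 e2_le3; clear; split; lia.
by split.
Qed.

Let o2 : #|L 2| = (p ^ 3)%N. Proof. by case: orders. Qed.
Let o3 : #|L 3| = (p ^ 2)%N. Proof. by case: orders. Qed.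
Let o4 : #|L 4| = p. Proof. by case: orders. Qed.
Let L5 : L 5 = 1 :> {set gT}. Proof. by apply: card1_trivg; case: orders. Qed.

Let i23 : #|L 2 : L 3| = p.
Proof. by rewrite -divgS ?LS // o2 o3 expnS mulnK ?expn_gt0 ?p_gt0. Qed.
Let i34 : #|L 3 : L 4| = p.
Proof. by rewrite -divgS ?LS // o3 o4 mulnK. Qed.
Let iG2 : #|G : L 2| = (p ^ 2)%N.
Proof. by rewrite -divgS ?LG // oG o2 -expnB. Qed.

Let cL4 x g : x \in L 4 -> g \in G -> commute x g.
Proof.
move=> xL gG; apply/commgP; rewrite -in_set1.
have := Lcomm xL gG; by rewrite L5.
Qed.

Let gen_index (X Y F : {group gT}) c : X \subset Y -> #|Y : X| = p ->
  c \in Y -> c \notin X -> X \subset F -> c \in F -> Y \subset F.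
Proof.
move=> sXY iXY cY cX XF cF.
have /maxgroupP[_ maxX] : maximal X Y by apply: p_index_maximal; rewrite ?iXY.
have <- : <<c |: X>> = Y.
  apply/eqP; rewrite eqEproper gen_subG subUset sub1set cY sXY /=.
  apply: contra cX => /maxX; rewrite sub_gen ?subsetUr // => /(_ isT) <-.
  by rewrite mem_gen // setU11.
by rewrite gen_subG subUset sub1set cF.
Qed.

Let class_le (hT : finGroupType) (H X : {group hT}) c :
  {in H, forall g, [~ c, g] \in X} -> #|H : 'C_H[c]| <= #|X|.
Proof.
move=> cX; rewrite index_cent1 -(card_lcoset X c); apply: subset_leq_card.
apply/subsetP => _ /imsetP[g gH ->]; rewrite conjg_mulR.
by rewrite mem_lcoset mulKg cX.
Qed.

(** For k = 4 and c spanning [L 2] modulo [L 3], this is the two-step centralizer of gamma_2 /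
    gamma_4. *)
Let CL k c := (coset (L k) @*^-1 'C[coset (L k) c] :&: G)%G.

Let CLP k c g : c \in G -> g \in G -> (g \in CL k c) = ([~ c, g] \in L k).
Proof.
move=> cG gG; have [nc ng] := (subsetP (nL k) c cG, subsetP (nL k) g gG).
apply/idP/idP=> [/setIP[/morphpreP[_ cg] _] | cg].
  apply: coset_idr; rewrite ?groupR // morphR //.
  by apply/eqP/commgP/cent1P; rewrite cent1C.
apply/setIP; split=> //; apply/morphpreP; split=> //; rewrite cent1C.
by apply/cent1P/commgP; rewrite -morphR //= coset_id.
Qed.

Let CLsym k c g : c \in G -> g \in G -> (g \in CL k c) = (c \in CL k g).
Proof. by move=> cG gG; rewrite !CLP // -invg_comm groupV. Qed.

Let in2 x : x \in L 2 -> x \in G. Proof. exact: (subsetP (LG 2)). Qed.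
Let in3 x : x \in L 3 -> x \in G. Proof. exact: (subsetP (LG 3)). Qed.
Let s32 x : x \in L 3 -> x \in L 2. Proof. exact: (subsetP (LS 2)). Qed.
Let s43 x : x \in L 4 -> x \in L 3. Proof. exact: (subsetP (LS 3)). Qed.

Let CL4_L3 g : g \in G -> L 3 \subset CL 4 g.
Proof. by move=> gG; apply/subsetP => x xL; rewrite (CLP _ gG (in3 xL)); apply: (@Lcommr 2). Qed.

(* The two-step centralizers of [gamma_2 / gamma_4] and of [gamma_3] are proper,
   so some element avoids both. *)
Let exists_gens : exists a a1 c c3,
  [/\ [/\ a \in G, a1 \in G & a1 \notin L 2],
       [/\ c \in L 2, c \notin L 3, c3 \in L 3 & c3 \notin L 4],
       [/\ a \notin CL 4 c, a1 \in CL 4 c & a \notin 'C[c3]] &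
       L 2 \subset 'C[c3]].
Proof.
have [c cL2 cL3] : exists2 c, c \in L 2 & c \notin L 3.
  by apply/subsetPn; rewrite -indexg_eq1 i23 neq_ltn p_gt1 orbT.
have [c3 c3L3 c3L4] : exists2 c, c \in L 3 & c \notin L 4.
  by apply/subsetPn; rewrite -indexg_eq1 i34 neq_ltn p_gt1 orbT.
have K1 : ~~ (G \subset CL 4 c).
  apply/negP=> sGK; move: (ltnn #|L 4|); rewrite -{2}(_ : L 3 = L 4) ?o3 ?o4.
    by rewrite -{1}(expn1 p) ltn_exp2l.
  apply/val_inj/eqP; rewrite eqEsubset LS andbT /=.
  rewrite gen_subG; apply/subsetP=> _ /imset2P[x g xL gG ->].
  have cG := in2 cL2; have cg : c \in CL 4 g by rewrite -CLsym //; apply: (subsetP sGK).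
  have xG := in2 xL; rewrite -[_ \in _](CLP 4 xG gG) (CLsym 4 xG gG).
  exact: (subsetP (gen_index (LS 2) i23 cL2 cL3 (CL4_L3 gG) cg)).
have K2 : ~~ (G \subset 'C[c3]).
  apply/negP=> sGK; case/eqP: L4n1; apply/trivgP.
  rewrite gen_subG; apply/subsetP=> _ /imset2P[x g xL gG ->].
  rewrite inE; apply/commgP.
  have xC : x \in 'C[g].
    have cC : c3 \in 'C[g] by rewrite cent1C (subsetP sGK).
    apply: subsetP xL; apply: (gen_index (LS 3) i34 c3L3 c3L4 _ cC).
    by apply/subsetP=> y yL; apply/cent1P/cL4.
  exact/cent1P.
have pidx (A : {group gT}) : A \subset G -> #|G : A| <= p -> ~~ (G \subset A) ->
    #|G : A| = p.
  move=> sAG; have := dvdn_indexg G A; rewrite oG => /(dvdn_pfactor _ _ p_pr)[m _ om].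
  rewrite -indexg_eq1 om; case: m {om} => [|[|m]]; rewrite ?eqxx ?expn1 //.
  by rewrite -{2}(expn1 p) leq_exp2l.
have iK2 : #|G : 'C_G[c3]| = p.
  apply: pidx; rewrite ?subsetIl ?subsetI ?subxx // -o4; apply: class_le => g.
  exact: (@Lcomm 2).
have cc3 : L 2 \subset 'C[c3].
  have mK : maximal 'C_G[c3] G by apply: p_index_maximal; rewrite ?subsetIl ?iK2.
  apply: subset_trans (subsetIr G _); rewrite L2E.
  have nK := normal_norm (p_maximal_normal pG mK).
  apply: der1_min => //; apply: cyclic_abelian; apply: prime_cyclic.
  by rewrite card_quotient // iK2.
(* A group is not the union of two proper subgroups: x, y or x y avoids both. *)
have [a aG [aK1 aK2]] : exists2 a, a \in G & a \notin CL 4 c /\ a \notin 'C[c3].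
  case/subsetPn: K1 => x xG xK1; case/subsetPn: K2 => y yG yK2.
  have [xK2|xK2] := boolP (x \in 'C[c3]); last by exists x.
  have [yK1|yK1] := boolP (y \in CL 4 c); last by exists y.
  exists (x * y); first exact: groupM.
  by split; [rewrite (groupMr _ yK1) | rewrite groupMl].
(* The centralizer of c modulo [L 4] has index at most p, hence more elements than [L 2]. *)
have [a1 a1K a1L2] : exists2 a1, a1 \in CL 4 c & a1 \notin L 2.
  apply/subsetPn; apply/negP => /subset_leq_card.
  rewrite o2 => leK.
  have cG := in2 cL2; have [nc n4] := (subsetP (nL 4) c cG, nL 4).
  suff iK : #|G : CL 4 c| <= p.
    have : #|G| <= p ^ 3 * p by rewrite -(Lagrange (subsetIr _ G : CL 4 c \subset G)) leq_mul.
    by rewrite oG -expnSr leq_exp2l.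
  have cb : {in G / L 4, forall g, [~ coset (L 4) c, g] \in L 3 / L 4}.
    move=> _ /morphimP[g ng gG ->]; rewrite -morphR //= mem_quotient //.
    exact: (@Lcomm 1).
  have := class_le cb; rewrite card_quotient ?(subset_trans (LG 3)) // i34.
  apply: leq_trans; rewrite -(index_quotient_eq _ _ (nL 4)) ?subsetIr //.
    apply: dvdn_leq; rewrite ?indexg_gt0 // indexgS //.
    apply/subsetP => _ /setIP[/morphimP[g ng gG ->] gc].
    by apply: mem_quotient; apply/setIP; split=> //; apply/morphpreP.
  apply/subsetP => x /setIP[xG xL]; rewrite CLP //.
  by apply: (subsetP (LS 4)); apply: (@Lcommr 3).
by exists a, a1, c, c3; split=> //; split=> //; case/setIP: a1K.
Qed.

(** The subgroup generated by x and [L 2] lies in the centralizer of c modulo [L 4], which excludes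
    a, so its index is p. As [L 2] lies in the Frattini subgroup, a and x generate G. *)
Let gens_of c a x : c \in L 2 -> c \notin L 3 -> a \in G -> a \notin CL 4 c ->
  x \in G -> x \notin L 2 -> x \in CL 4 c ->
  #|G : <<x |: L 2>>| = p /\ G = <<[set a; x]>> :> {set gT}.
Proof.
move=> cL2 cL3 aG aK1 xG xL2 xK; have cG := in2 cL2.
have L2K : L 2 \subset CL 4 c.
  by apply: (gen_index (LS 2) i23 cL2 cL3 (CL4_L3 cG) _); rewrite CLP ?commgg ?group1.
have L2Phi : L 2 \subset 'Phi(G) by rewrite (Phi_joing pG) L2E joing_subl.
pose X1 := <<x |: L 2>>%G; rewrite -[<<_>>]/(X1 : {set gT}).
have sL2X1 : L 2 \subset X1 by rewrite sub_gen ?subsetUr.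
have xX1 : x \in X1 by rewrite mem_gen ?setU11.
have sX1G : X1 \subset G by rewrite gen_subG subUset sub1set xG LG.
have sX1K : X1 \subset CL 4 c by rewrite gen_subG subUset sub1set xK L2K.
have iX1 : #|G : X1| = p.
  have := Lagrange_index sX1G sL2X1; rewrite iG2.
  have := dvdn_indexg G X1; rewrite oG => /(dvdn_pfactor _ _ p_pr)[m _ om].
  have := dvdn_indexg X1 (L 2) => /dvdn_trans/(_ (cardSg sX1G)).
  rewrite oG => /(dvdn_pfactor _ _ p_pr)[n _ on].
  rewrite om on -expnD => /eqP; rewrite eqn_exp2l // => /eqP mn.
  have m0 : m != 0%N.
    apply: contra aK1 => /eqP m0; apply: (subsetP sX1K).
    by have /subsetP-> : G \subset X1 by rewrite -indexg_eq1 om m0.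
  have n0 : n != 0%N.
    apply: contra xL2 => /eqP n0.
    by have /subsetP-> : X1 \subset L 2 by rewrite -indexg_eq1 on n0.
  suff -> : m = 1%N by rewrite expn1.
  by move: mn m0 n0; case: (m) => [|[|m']]; case: (n) => [|[|n']]; rewrite ?addSn ?addnS.
have aX1 : a \notin X1 by apply: contra aK1; apply: (subsetP sX1K).
split=> //.
apply/esym/Phi_nongen/eqP; rewrite eqEsubset join_subG Phi_sub subUset !sub1set aG xG /=.
  apply: (gen_index sX1G iX1 aG aX1); last by rewrite mem_gen ?inE ?eqxx ?orbT.
  rewrite gen_subG subUset sub1set mem_gen ?inE ?eqxx ?orbT //=.
  by apply: subset_trans L2Phi _; apply: joing_subl.
Qed.

(** The iterated commutators of a1 with a span the successive factors, and w = [a1, a2] lies in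
    [L 4]. It is nontrivial, since a1 and [L 2] would otherwise generate an abelian maximal
    subgroup; a power of a1 then makes w and a4 agree. *)
Lemma max_class_core a a1 c c3 :
  [/\ a \in G, a1 \in G & a1 \notin L 2] ->
  [/\ c \in L 2, c \notin L 3, c3 \in L 3 & c3 \notin L 4] ->
  [/\ a \notin CL 4 c, a1 \in CL 4 c & a \notin 'C[c3]] -> L 2 \subset 'C[c3] ->
  exists s t k, phi10_gens p s t G a (a1 ^+ k).
Proof.
move=> [aG a1G a1L2] [cL2 cL3 c3L3 c3L4] [aK1 a1K aK2] cc3.
have cG := in2 cL2.
have [a2 a2E] : exists x, x = [~ a1, a] by exists [~ a1, a].
have [a3 a3E] : exists x, x = [~ a2, a] by exists [~ a2, a].
have [a4 a4E] : exists x, x = [~ a3, a] by exists [~ a3, a].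
have a2L : a2 \in L 2 by rewrite a2E; apply: (@Lcomm 0).
have a3L : a3 \in L 3 by rewrite a3E; apply: (@Lcomm 1).
have a4L : a4 \in L 4 by rewrite a4E; apply: (@Lcomm 2).
have c23 x y : x \in L 2 -> y \in L 3 -> commute x y.
  move=> xL yL; apply/cent1P; rewrite cent1C; move: y yL; apply/subsetP.
  apply: (gen_index (LS 3) i34 c3L3 c3L4 _ _).
    by apply/subsetP=> z zL; apply/cent1P/cL4/in2.
  by rewrite cent1C; apply: (subsetP cc3).
have [iX1 defG] := gens_of cL2 cL3 aG aK1 a1G a1L2 a1K.
have a2L3 : a2 \notin L 3.
  apply/negP=> a2L3.
  have : G^`(1) \subset L 3.
    apply: der1_sub_gen defG (nL 3) _ => x y /set2P[->|->] /set2P[->|->];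
      rewrite ?commgg ?group1 -?a2E //.
    by rewrite -invg_comm groupV -a2E.
  by rewrite -L2E => /subset_leq_card; rewrite o2 o3 leq_exp2l.
have a2G := in2 a2L.
have a3L4 : a3 \notin L 4.
  rewrite a3E -CLP // CLsym //; apply: contra aK1 => a2a; rewrite CLsym //.
  by apply: (subsetP (gen_index (LS 2) i23 a2L a2L3 (CL4_L3 aG) a2a)).
have a4n1 : a4 != 1.
  apply: contra aK2; rewrite a4E => /commgP a3a; rewrite cent1C.
  apply: (subsetP (gen_index (LS 3) i34 a3L a3L4 _ _)) c3L3.
    by apply/subsetP=> z zL; apply/cent1P/cL4.
  exact/cent1P.
(* Meant for the p-th powers of the generators, which lie in [L 2] and commute with a. *)
have cLa x : x \in L 2 -> commute x a -> x \in L 4.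
  move=> xL cxa.
  have xL3 : x \in L 3.
    apply: contraNT a3L4 => xL3; rewrite a3E -CLP // CLsym //.
    apply: (subsetP (gen_index (LS 2) i23 xL xL3 (CL4_L3 aG) _)) a2L.
    rewrite (CLP _ aG (in2 xL)) (_ : [~ a, x] = 1) ?group1 //.
    by apply/eqP/commgP; apply: commute_sym.
  apply: contraNT a4n1 => xL4; rewrite a4E; apply/commgP/cent1P.
  apply: (subsetP (gen_index (LS 3) i34 xL3 xL4 _ _)) a3L.
    by apply/subsetP=> z zL; apply/cent1P/cL4.
  exact/cent1P.
pose w := [~ a1, a2].
have wL : w \in L 4.
  rewrite -CLP //.
  apply: (subsetP (gen_index (LS 2) i23 cL2 cL3 (CL4_L3 a1G) _)) a2L.
  by rewrite CLsym.
(* Conjugating the central w by a gives [a1 a2, a2 a3], which expands to w [a1, a3]. *)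
have a1a3 : [~ a1, a3] = 1.
  have wa : w ^ a = w by apply/conjg_fixP/commgP/cL4.
  move: wa; rewrite conjRg !conjg_mulR -a2E -a3E.
  have c23' : commute a2 (a2 * a3) by apply: commuteM => //; apply: c23.
  have a13L : [~ a1, a3] \in L 4 by apply: (@Lcommr 2).
  rewrite commMgJ (_ : [~ a2, _] = 1) ?mulg1; last by apply/eqP/commgP.
  rewrite commgMJ -/w (_ : w ^ a3 = w); last by apply/conjg_fixP/commgP/cL4/in3.
  rewrite (_ : _ ^ a2 = [~ a1, a3] * w); first by move/(canRL (mulgK _)); rewrite mulgV.
  by apply/conjg_fixP/commgP/cL4 => //; apply: groupM.
have cL2L2 : abelian (L 2).
  apply/centsP=> x xL y yL; apply/cent1P; rewrite cent1C; move: y yL; apply/subsetP.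
  apply: (gen_index (LS 2) i23 a2L a2L3 _ _).
    by apply/subsetP=> z zL; rewrite cent1C; apply/cent1P/c23.
  rewrite cent1C; move: x xL; apply/subsetP; apply: (gen_index (LS 2) i23 a2L a2L3 _ _).
    by apply/subsetP=> z zL; rewrite cent1C; apply/cent1P/c23.
  exact/cent1P.
have a1c3 x : x \in L 3 -> commute a1 x.
  move=> xL; apply/cent1P; rewrite cent1C; move: x xL; apply/subsetP.
  apply: (gen_index (LS 3) i34 a3L a3L4 _ _).
    by apply/subsetP=> z zL; apply/cent1P/cL4.
  by rewrite cent1C; apply/cent1P/commgP/eqP.
have wn1 : w != 1.
  apply/eqP=> w1; have : #|G : <<a1 |: L 2>>%G| != p; last by rewrite iX1 eqxx.
  apply: noab; rewrite ?gen_subG ?subUset ?sub1set ?a1G ?LG // abelian_gen.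
  have cX : L 2 \subset 'C[a1].
    apply: (gen_index (LS 2) i23 a2L a2L3 _ _).
      by apply/subsetP=> z zL; rewrite cent1C; apply/cent1P/a1c3.
    by rewrite cent1C; apply/cent1P/commgP/eqP.
  rewrite abelianE; apply/centsP=> x; rewrite in_setU1 => xA y; rewrite in_setU1 => yA.
  case/predU1P: xA => [->|xL]; case/predU1P: yA => [->|yL] //.
  - by apply/cent1P; rewrite cent1C (subsetP cX).
  - by apply/cent1P; apply: (subsetP cX).
  - exact: (centsP cL2L2).
have xpL2 x : x \in G -> x ^+ p \in L 2.
  move=> xG; have nx := subsetP (nL 2) x xG.
  apply: coset_idr; rewrite ?groupX // morphX //; apply/eqP; rewrite -order_dvdn.
  have oQ : #|G / L 2| = (p ^ 2)%N by rewrite card_quotient.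
  have xQ : coset (L 2) x \in G / L 2 by apply: mem_quotient.
  have := order_dvdG xQ; rewrite oQ => /(dvdn_pfactor _ _ p_pr)[m m2 om].
  rewrite om -{2}(expn1 p) dvdn_exp2l // leqNgt; apply: contra Gncyc => m1.
  apply/cyclicP; exists (coset (L 2) x); apply/eqP.
  rewrite eq_sym eqEcard cycle_subG xQ oQ -[#|_|]/(#[_]) om leq_exp2l //=.
have apL4 : a ^+ p \in L 4 by apply: cLa; [apply: xpL2 | apply/commute_sym/commuteX].
have a2a : a2 ^ a = a2 * a3 by rewrite conjg_mulR -a3E.
have a3a : a3 ^ a = a3 * a4 by rewrite conjg_mulR -a4E.
have a4a : a4 ^ a = a4 by apply/conjg_fixP/commgP/cL4.
have c23' := c23 _ _ a2L a3L.
have c34' : commute a3 a4 by apply/commute_sym/cL4/in3.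
have c24' : commute a2 a4 by apply/commute_sym/cL4.
(* For n = p the conjugation is trivial, as a^p is central. Since p divides C(p, 2) and C(p, 3),
   this gives a3^p = 1 and then a2^p = 1. *)
have Ha2 n : a2 ^ (a ^+ n) = a2 * a3 ^+ n * a4 ^+ 'C(n, 2).
  elim: n => [|n IH]; first by rewrite conjg1 !expg0 !mulg1.
  rewrite expgSr conjgM IH !conjMg !conjXg a2a a3a a4a expgMn // binS bin1 addnC expgD expgS.
  by rewrite !mulgA.
have Ha1 n : a1 ^ (a ^+ n) = a1 * a2 ^+ n * a3 ^+ 'C(n, 2) * a4 ^+ 'C(n, 3).
  elim: n => [|n IH]; first by rewrite conjg1 !expg0 !mulg1.
  rewrite expgSr conjgM IH !conjMg !conjXg a2a a3a a4a !expgMn // conjg_mulR -a2E.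
  rewrite [in RHS]expgS binS bin1 (addnC _ n) expgD [in a4 ^+ _]binS addnC expgD.
  by rewrite !mulgA.
have a4p : a4 ^+ p = 1 by apply/eqP; rewrite -order_dvdn -o4 order_dvdG.
have pbin i : 0 < i < p -> a4 ^+ 'C(p, i) = 1 /\ p %| 'C(p, i).
  move=> ip; have pb := prime_dvd_bin p_pr ip; split=> //.
  by case/dvdnP: pb => q ->; rewrite mulnC expgM a4p expg1n.
have p2 : 0 < 2 < p by rewrite (ltn_trans _ p_gt3).
have p3 : 0 < 3 < p by [].
have a3p : a3 ^+ p = 1.
  have := Ha2 p; rewrite (pbin 2 p2).1 mulg1.
  rewrite (conjg_fixP _) ?mulKg; last by apply/commgP/commute_sym/cL4.
  by rewrite -{1}[a2]mulg1 => /mulgI.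
have a2p : a2 ^+ p = 1.
  have := Ha1 p; rewrite (pbin 3 p3).1 mulg1.
  rewrite (conjg_fixP _); last by apply/commgP/commute_sym/cL4.
  have [_ /dvdnP[q ->]] := pbin 2 p2.
  rewrite mulnC expgM a3p expg1n mulg1.
  by rewrite -{1}[a1]mulg1 => /mulgI.
have a1pL4 : a1 ^+ p \in L 4.
  apply: cLa (xpL2 _ a1G) _; apply/commgP/conjg_fixP.
  have wc x : x \in G -> commute x [~ a2, a1].
    by move=> xG; apply/commute_sym/cL4 => //; rewrite -invg_comm groupV.
  rewrite conjXg conjg_mulR -a2E (expMg_Rmul p (wc a2 a2G) (wc a1 a1G)) a2p mulg1.
  have [_ /dvdnP[q ->]] := pbin 2 p2.
  have wp : [~ a2, a1] ^+ p = 1.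
    by apply/eqP; rewrite -order_dvdn -o4 order_dvdG // -invg_comm groupV.
  by rewrite mulnC expgM wp expg1n mulg1.
have L4cyc x y : x \in L 4 -> x != 1 -> y \in L 4 -> exists n, y = x ^+ n.
  move=> xL x1 yL; apply/cycleP; apply: (subsetP _ y yL).
  have := prime_subgroupVti <[x]> (_ : prime #|L 4|); rewrite o4 => /(_ p_pr)[//|].
  move=> ti; case/eqP: x1; apply/set1P; rewrite -[[set 1]]/(1 : {set gT}) -ti.
  by rewrite inE cycle_id.
have wp : w ^+ p = 1 by apply/eqP; rewrite -order_dvdn -o4 order_dvdG.
(* Replacing a1 by a1^k turns a4 into a4^k and w into w^(k^2); both are equal for this k. *)
have [k a4w] := L4cyc w a4 wL wn1 a4L.
have copk : coprime p k.
  rewrite prime_coprime //; apply: contra a4n1 => /dvdnP[q qk].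
  by rewrite a4w qk mulnC expgM wp expg1n.
have notpow (A : {group gT}) x : x ^+ p \in A -> x \notin A -> x ^+ k \notin A.
  by move=> xp; apply: contra => xk; apply: mem_expg_coprime copk p_gt0 xp xk.
have [b1 b1E] : exists x, x = a1 ^+ k by exists (a1 ^+ k).
have b1G : b1 \in G by rewrite b1E groupX.
have b1L2 : b1 \notin L 2 by rewrite b1E; apply: notpow a1L2; apply/s32/s43.
have b1K : b1 \in CL 4 c by rewrite b1E groupX.
have [_ defG1] := gens_of cL2 cL3 aG aK1 b1G b1L2 b1K.
have [b2 b2E] : exists x, x = [~ b1, a] by exists [~ b1, a].
have [b3 b3E] : exists x, x = [~ b2, a] by exists [~ b2, a].
have [b4 b4E] : exists x, x = [~ b3, a] by exists [~ b3, a].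
have [h hL b2h] : exists2 h, h \in L 3 & b2 = a2 ^+ k * h.
  exists (a2 ^- k * b2); last by rewrite mulKVg.
  have n3 x : x \in G -> x \in 'N(L 3) by apply/subsetP/nL.
  have b2G : b2 \in G by rewrite b2E groupR.
  apply: coset_idr; first by rewrite n3 // groupM // groupV groupX.
  rewrite morphM ?n3 ?groupV ?groupX // morphV ?n3 ?groupX // morphX ?n3 //=.
  rewrite b2E morphR ?n3 // b1E morphX ?n3 //= commXg.
    by rewrite -morphR ?n3 //= -a2E mulVg.
  apply/commgP; rewrite -morphR ?n3 //= -a2E -morphR ?n3 //= coset_id //.
  exact: s43.
have b3h : exists2 h', h' \in L 4 & b3 = a3 ^+ k * h'.
  exists [~ h, a]; first exact: (@Lcomm 2).
  rewrite b3E b2h commgMl; first by rewrite commXg -a3E.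
  by rewrite commXg -a3E //; apply/commute_sym/commuteX/c23/a3L/s32.
have [h' hL' b3h'] := b3h.
have b4k : b4 = a4 ^+ k.
  rewrite b4E b3h' commgMl; last first.
    apply: commute_sym; apply: cL4 hL' _; apply: groupR => //; apply: groupX.
    exact: in3.
  rewrite commXg -a4E // (_ : [~ h', a] = 1) ?mulg1 //.
  by apply/eqP/commgP/cL4.
have b4L : b4 \in L 4 by rewrite b4k groupX.
have b3L : b3 \in L 3.
  by rewrite b3h'; apply: groupM; [apply: groupX | apply: s43].
have b2L : b2 \in L 2.
  by rewrite b2h; apply: groupM; [apply: groupX | apply: s32].
have b12 : [~ b1, b2] = b4.
  have wcG x : x \in G -> commute x w by move=> xG; apply/commute_sym/cL4.
  rewrite b2h b1E commgMr; last first.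
    rewrite (commXXg k k (wcG a1 a1G) (wcG a2 a2G)); apply: commute_sym; apply: commuteX; apply: wcG.
    exact: in3.
  rewrite (commXXg k k (wcG a1 a1G) (wcG a2 a2G)) (_ : [~ _, h] = 1) ?mul1g; last first.
    apply/eqP/commgP; apply: commute_sym; apply: commuteX; apply: commute_sym.
    exact: a1c3.
  by rewrite b4k a4w -expgM.
have gF : group_set [set x in L 2 | x ^+ p == 1].
  apply/group_setP; split=> [|x y]; first by rewrite inE group1 expg1n eqxx.
  rewrite !inE => /andP[xL /eqP xp] /andP[yL /eqP yp].
  by rewrite groupM //= expgMn ?xp ?yp ?mulg1 //; apply: (centsP cL2L2).
have s4F : L 4 \subset group gF.
  apply/subsetP=> x xL; rewrite inE s32 ?s43 //=.
  by rewrite -order_dvdn -o4 order_dvdG.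
have s3F : L 3 \subset group gF.
  by apply: (gen_index (LS 3) i34 a3L a3L4 s4F); rewrite inE s32 // a3p /=.
have exp2 : L 2 \subset group gF.
  by apply: (gen_index (LS 2) i23 a2L a2L3 s3F); rewrite inE a2L a2p /=.
have ep x : x \in L 2 -> x ^+ p = 1 by move/(subsetP exp2); rewrite inE => /andP[_ /eqP].
have b4n1 : b4 != 1.
  have : a4 \notin [1 gT]%G by rewrite inE.
  by move/notpow; rewrite a4p group1 b4k => /(_ isT); rewrite inE.
have [s as_] := L4cyc b4 _ b4L b4n1 apL4.
have [|t bt] := L4cyc b4 (b1 ^+ p) b4L b4n1.
  by rewrite b1E -expgM mulnC expgM groupX.
exists s, t, k, b2, b3, b4; rewrite -b1E; split=> //.
have c1 x y : x \in L 4 -> y \in G -> [~ y, x] = 1.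
  by move=> xL yG; apply/eqP/commgP/commute_sym/cL4.
split=> //.
- by apply/eqP/commgP/cL4.
- apply/eqP/commgP; rewrite b1E; apply: commute_sym; apply: commuteX.
  by apply: commute_sym; apply: a1c3.
- exact: c1.
- by apply/eqP/commgP; apply: c23.
- by apply: c1; rewrite ?in2.
- by apply: c1; rewrite ?in3.
- exact: ep.
- by apply/ep/s32.
- by apply/ep/s32/s43.
Qed.

Lemma max_class_phi10_gens : exists s t a a1, phi10_gens p s t G a a1.
Proof.
have [a [a1 [c [c3 [h1 h2 h3 h4]]]]] := exists_gens.
by have [s [t [k h]]] := max_class_core h1 h2 h3 h4; exists s, t, a, (a1 ^+ k).
Qed.

End MaximalClass.

Lemma phi10_relsM (p : nat) (gT rT : finGroupType) (G : {group gT})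
    (f : {morphism G >-> rT}) a a1 a2 a3 a4 :
  a \in G -> a1 \in G -> phi10_rels p a a1 a2 a3 a4 ->
  phi10_rels p (f a) (f a1) (f a2) (f a3) (f a4).
Proof.
move=> aG a1G [r2 r3 r4 r12 r40 r13 r14 r23 r24 r34 p2 p3 p4].
have a2G : a2 \in G by rewrite -r2 groupR.
have a3G : a3 \in G by rewrite -r3 groupR.
have a4G : a4 \in G by rewrite -r4 groupR.
by split; rewrite -?morphR -?morphX // ?(r2, r3, r4, r12, r40, r13, r14, r23, r24, r34, p2, p3, p4) ?morph1.
Qed.

Lemma phi10_gens_sub (p s t : nat) (gT : finGroupType) (G : {group gT}) a a1 :
  phi10_gens p s t G a a1 -> a \in G /\ a1 \in G.
Proof. by case=> [a2 [a3 [a4 [-> _ _ _]]]]; rewrite !mem_gen ?inE ?eqxx ?orbT. Qed.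

Lemma morphim_phi10_gens (p s t : nat) (gT rT : finGroupType) (G : {group gT})
    (f : {morphism G >-> rT}) a a1 :
  phi10_gens p s t G a a1 -> phi10_gens p s t (f @* G) (f a) (f a1).
Proof.
move=> g; have [aG a1G] := phi10_gens_sub g.
have [a2 [a3 [a4 [defG rels ap a1p]]]] := g.
have a4G : a4 \in G.
  by case: rels => <- <- <- _ _ _ _ _ _ _ _ _ _; rewrite !groupR.
exists (f a2), (f a3), (f a4); split.
- have sS : [set a; a1] \subset G by rewrite subUset !sub1set aG.
  transitivity (f @* <<[set a; a1]>>); first by congr (f @* _).
  by rewrite morphim_gen // morphimU !morphim_set1.
- exact: phi10_relsM rels.
- by rewrite -!morphX // ap.
- by rewrite -!morphX // a1p.
Qed.

Theorem B0_neq0_phi10_gens (p : nat) (G : finGroupType) :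
  prime p -> 3 < p -> #|G| = (p ^ 5)%N -> B0_neq0 G ->
  exists s t a a1, phi10_gens p s t [set: G] a a1.
Proof.
move=> p_pr p_gt3 oG nz.
have [phi [phiP [CP sZE']]] := extension_of_B0 p_pr oG nz.
set E := [set: extn phiP]%G in sZE'; pose f : {morphism E >-> G} := extn_proj_morphism phiP.
pose Z := ('ker f)%G; have imf : f @* E = [set: G] := extn_proj_onto phiP.
have oE : #|E| = (p ^ 6)%N by rewrite card_extn oG card_Fp // -expnSr.
have nZE : Z <| E := ker_normal f.
have oZ : #|Z| = p.
  have oG0 : 0 < #|E / Z| by rewrite cardG_gt0.
  apply/eqP; rewrite -(eqn_pmul2r oG0); apply/eqP.
  rewrite [RHS](_ : _ = (p ^ 6)%N).
    by rewrite -oE card_quotient ?normal_norm // Lagrange ?normal_sub.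
  rewrite (card_isog (first_isog f)).
  by rewrite /= imf cardsT oG -expnS.
have CP' : {in E &, forall x y, [~ x, y] \in Z -> [~ x, y] = 1}.
  move=> x y xE yE /kerP; rewrite inE => /(_ isT) fxy.
  by apply/eqP/commgP/CP/commgP; rewrite -[_.1]/(f x) -[y.1]/(f y) -morphR ?fxy.
have cZE : Z \subset 'Z(E).
  apply/subsetP=> z zZ; rewrite inE (subsetP (normal_sub nZE)) //=.
  apply/centP => x xE; apply/commgP/eqP/CP'; rewrite ?in_setT //.
  rewrite commgEl groupMl ?groupV // memJ_norm //.
  exact: (subsetP (normal_norm nZE)).
have pE : p.-group E by rewrite /pgroup oE pnatX pnat_id.
have [nZ sZ] := (normal_norm nZE, normal_sub nZE).
have Z1 : Z != 1 :> {set _} by rewrite -cardG_gt1 oZ prime_gt1.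
have oQ : #|E / Z| = (p ^ 5)%N.
  rewrite card_quotient // -divgS // oE oZ expnS mulKn ?prime_gt0 //.
have L4E : 'L_4(E) != 1.
  apply: contra (nil_class_gt3 p_pr oE oZ cZE sZE' CP') => L1.
  have /(ucn_nil_classP 3 (pgroup_nil pE)) e3 : nil_class E <= 3.
    by apply/(lcn_nil_classP 3 (pgroup_nil pE))/eqP.
  by have := ucn_comm 2 E; rewrite e3.
have L4Q := quotient_lcn4_neq1 nZ CP' L4E.
have [s [t [a [a1 g]]]] := max_class_phi10_gens p_pr p_gt3 oQ L4Q
  (fun A sA cA => quotient_no_abelian_maximal p_pr nZ sZ Z1 sZE' CP' pE sA cA).
have [h injh imh] := first_isom f.
exists s, t, (h a), (h a1).
have := morphim_phi10_gens h g; rewrite imh.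
by rewrite imf.
Qed.

(** * Isomorphism and isoclinism *)

Section CardBound.
Variables (gT : finGroupType) (p : nat).
Hypothesis p_gt0 : 0 < p.

Lemma card_joing_cycle (A : {group gT}) x :
  x \in 'N(A) -> x ^+ p \in A -> #|<[x]> <*> A| <= p * #|A|.
Proof.
move=> nAx xpA.
have sAX : A \subset <[x]> <*> A by apply: joing_subr.
have nAX : <[x]> <*> A \subset 'N(A) by rewrite join_subG cycle_subG nAx normG.
rewrite -(Lagrange sAX) mulnC leq_mul2r -card_quotient // quotientYidr ?cycle_subG //.
rewrite quotient_cycle // -[#|<[_]>|]/(#[_]) dvdn_leq ?orbT // order_dvdn.
by rewrite -morphX //= coset_id.
Qed.

Variables a a1 a2 a3 a4 : gT.
Hypothesis rels : phi10_rels p a a1 a2 a3 a4.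
Let G := <<[set a; a1]>>%G.
Let M := <<[set a2; a3; a4]>>%G.

Let mem1 (x y : gT) : [~ x, y] = 1 -> commute x y. Proof. by move/eqP/commgP. Qed.

Lemma phi10_gens_in : [/\ a \in G, a1 \in G & M \subset G].
Proof.
have aG : a \in G by rewrite mem_gen ?inE ?eqxx.
have a1G : a1 \in G by rewrite mem_gen ?inE ?eqxx ?orbT.
split=> //; rewrite gen_subG; apply/subsetP => x; rewrite !inE.
by case: rels => <- <- <- _ _ _ _ _ _ _ _ _ _ /orP[/orP[]|] /eqP->; rewrite !groupR.
Qed.

Let aM : [/\ a2 \in M, a3 \in M & a4 \in M].
Proof. by split; rewrite mem_gen ?inE ?eqxx ?orbT. Qed.

Lemma phi10_norm_der : G \subset 'N(M).
Proof.
have [m2 m3 m4] := aM; have [r2 r3 r4 r12 r40 r13 r14 _ _ _ _ _ _] := rels.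
have nM x : a2 ^ x \in M -> a3 ^ x \in M -> a4 ^ x \in M -> x \in 'N(M).
  move=> h2 h3 h4; rewrite inE -genJ gen_subG; apply/subsetP => _ /imsetP[y + ->].
  by rewrite !inE => /orP[/orP[]|] /eqP->.
rewrite gen_subG subUset !sub1set; apply/andP; split; apply: nM.
- by rewrite conjg_mulR r3 groupM.
- by rewrite conjg_mulR r4 groupM.
- by rewrite conjg_mulR r40 mulg1.
- by rewrite conjg_mulR -invg_comm r12 groupM ?groupV.
- by rewrite conjg_mulR -invg_comm r13 invg1 mulg1.
- by rewrite conjg_mulR -invg_comm r14 invg1 mulg1.
Qed.

Lemma phi10_der : G^`(1) = M :> {set gT}.
Proof.
have [m2 m3 m4] := aM; have [r2 r3 r4 r12 r40 r13 r14 _ _ _ _ _ _] := rels.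
have [aG a1G sMG] := phi10_gens_in.
have [a2G a3G] : a2 \in G /\ a3 \in G by split; apply: (subsetP sMG).
apply/eqP; rewrite eqEsubset; apply/andP; split.
  apply: (@der1_sub_gen gT G M [set a; a1] (erefl _) phi10_norm_der) => x y.
  case/set2P=> -> /set2P[] ->; rewrite ?commgg ?group1 ?r2 //.
  by rewrite -invg_comm r2 groupV.
rewrite gen_subG; apply/subsetP => x; rewrite !inE.
by case/orP=> [/orP[]|] /eqP->; rewrite -?r4 -?r3 -?r2 mem_commg // ?r2 ?r3.
Qed.

(** The order of a4 is kept as a factor: bounded by p it gives |M| <= p^3, and a4 = 1 would make G
    smaller than p^5. *)
Lemma phi10_card_der_order : #|M| <= p ^ 2 * #[a4].
Proof.
have [_ _ _ _ _ _ _ r23 r24 r34 p2 p3 p4] := rels.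
pose M3 := (<[a3]> <*> <[a4]>)%G.
have n3 : a3 \in 'N(<[a4]>).
  by rewrite (subsetP (cent_sub _)) // cent_cycle; apply/cent1P/mem1.
have n2 : a2 \in 'N(M3).
  rewrite (subsetP (cent_sub _)) //= centY !cent_cycle; apply/setIP.
  by split; apply/cent1P/mem1.
apply: leq_trans (_ : #|<[a2]> <*> M3| <= _).
  apply: subset_leq_card; rewrite gen_subG; apply/subsetP => x; rewrite !inE.
  have h3 : a3 \in M3 by rewrite mem_gen // inE cycle_id.
  have h4 : a4 \in M3 by rewrite mem_gen // inE cycle_id orbT.
  by case/orP=> [/orP[]|] /eqP->; rewrite mem_gen // inE ?cycle_id ?h3 ?h4 ?orbT.
apply: leq_trans (card_joing_cycle n2 _) _; first by rewrite p2 group1.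
rewrite expnS expn1 -mulnA leq_mul2l; apply/orP; right.
by apply: leq_trans (card_joing_cycle n3 _) _; rewrite ?p3 ?group1.
Qed.

Lemma phi10_card_der_le : #|M| <= p ^ 3.
Proof.
have [_ _ _ _ _ _ _ _ _ _ _ _ p4] := rels.
apply: leq_trans phi10_card_der_order _; rewrite (expnSr p 2) leq_mul2l.
by rewrite dvdn_leq ?orbT // order_dvdn p4.
Qed.

Section Powers.
Hypotheses (ap : a ^+ p \in M) (a1p : a1 ^+ p \in M).

Lemma phi10_card_index : #|G| <= p ^ 2 * #|M|.
Proof.
have [aG a1G sMG] := phi10_gens_in; have nGM := phi10_norm_der.
pose A1 := (<[a1]> <*> M)%G.
have n1 : a1 \in 'N(M) by apply: (subsetP nGM).
have [sMA a1A] : M \subset A1 /\ a1 \in A1.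
  by split; rewrite ?joing_subr // mem_gen // inE cycle_id.
have na : a \in 'N(A1).
  have a2M : a2 \in M by case: aM.
  have aMA : M :^ a \subset A1.
    by have /normP-> : a \in 'N(M) by apply: (subsetP nGM).
  rewrite inE -genJ gen_subG conjUg subUset aMA andbT -cycleJ cycle_subG.
  have [r2 _ _ _ _ _ _ _ _ _ _ _ _] := rels.
  by rewrite conjg_mulR r2 groupM // (subsetP sMA).
apply: leq_trans (_ : #|<[a]> <*> A1| <= _).
  apply: subset_leq_card; rewrite gen_subG subUset !sub1set.
  by rewrite !mem_gen // !inE ?cycle_id ?a1A ?orbT.
apply: leq_trans (card_joing_cycle na _) _; first by rewrite (subsetP sMA).
by rewrite expnS -mulnA leq_mul2l expn1 card_joing_cycle ?orbT.
Qed.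

Lemma phi10_card_le : #|G| <= p ^ 5.
Proof.
apply: leq_trans phi10_card_index _; rewrite (expnD p 2 3) leq_mul2l.
by rewrite phi10_card_der_le orbT.
Qed.

Lemma phi10_card_der : #|G| = (p ^ 5)%N -> #|G^`(1)| = (p ^ 3)%N.
Proof.
move=> oG; apply/eqP; rewrite phi10_der eqn_leq phi10_card_der_le /=.
rewrite -(leq_pmul2l (_ : 0 < p ^ 2)) ?expn_gt0 ?p_gt0 // -expnD -oG.
exact: phi10_card_index.
Qed.

Lemma phi10_a4_neq1 : 1 < p -> #|G| = (p ^ 5)%N -> a4 != 1.
Proof.
move=> p_gt1 oG; apply/eqP => a41; have := phi10_card_der_order.
rewrite a41 order1 muln1 -(leq_pmul2l (_ : 0 < p ^ 2)) ?expn_gt0 ?p_gt0 // -expnD.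
by move/(leq_trans phi10_card_index); rewrite oG leq_exp2l.
Qed.
End Powers.

End CardBound.

(** * Subdirect products and isoclinism *)

Section Product.
Variables (gT hT : finGroupType) (D : {group gT * hT}).

Definition proj1m : {morphism D >-> gT} := Morphism (in2W (@fst_morphM gT hT)).
Definition proj2m : {morphism D >-> hT} := Morphism (in2W (@snd_morphM gT hT)).

Lemma pairR (x y : gT * hT) : [~ x, y] = ([~ x.1, y.1], [~ x.2, y.2]).
Proof. by []. Qed.

Lemma pairX (x : gT * hT) n : x ^+ n = (x.1 ^+ n, x.2 ^+ n).
Proof.
elim: n => [|n IH]; first by rewrite !expg0.
by rewrite expgS IH !expgS.
Qed.

Lemma phi10_rels_pair p a a1 a2 a3 a4 b b1 b2 b3 b4 :
  phi10_rels p a a1 a2 a3 a4 -> phi10_rels p b b1 b2 b3 b4 ->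
  @phi10_rels p (gT * hT)%type (a, b) (a1, b1) (a2, b2) (a3, b3) (a4, b4).
Proof.
move=> [r2 r3 r4 r12 r40 r13 r14 r23 r24 r34 p2 p3 p4].
move=> [q2 q3 q4 q12 q40 q13 q14 q23 q24 q34 q2p q3p q4p].
split; rewrite ?pairR ?pairX /= ?(r2, r3, r4, r12, r40, r13, r14, r23, r24, r34, p2, p3, p4);
  by rewrite ?(q2, q3, q4, q12, q40, q13, q14, q23, q24, q34, q2p, q3p, q4p).
Qed.
End Product.

Lemma proj1m_gen (gT hT : finGroupType) a a1 (b b1 : hT) :
  proj1m <<[set (a, b); (a1, b1)]>>%G @* <<[set (a, b); (a1, b1)]>> = <<[set a; a1]>> :> {set gT}.
Proof. by rewrite morphim_gen ?subset_gen // morphimU !morphim_set1 ?mem_gen ?inE ?eqxx ?orbT. Qed.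

Lemma proj2m_gen (gT hT : finGroupType) (a a1 : gT) b b1 :
  proj2m <<[set (a, b); (a1, b1)]>>%G @* <<[set (a, b); (a1, b1)]>> = <<[set b; b1]>> :> {set hT}.
Proof. by rewrite morphim_gen ?subset_gen // morphimU !morphim_set1 ?mem_gen ?inE ?eqxx ?orbT. Qed.

Lemma phi10_in4 p (gT : finGroupType) (a a1 a2 a3 a4 : gT) n :
  phi10_rels p a a1 a2 a3 a4 -> a4 ^+ n \in <<[set a2; a3; a4]>>%G.
Proof. by rewrite groupX // mem_gen // !inE eqxx !orbT. Qed.

(* Two groups with the same presentation are compared through the subgroup of
   their product generated by the pairs of generators: it satisfies the same
   relations, so its order is also at most [p ^ 5]. *)
Lemma phi10_gens_homg p s t (gT hT : finGroupType) (G : {group gT}) (H : {group hT}) a a1 b b1 :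
  prime p -> #|G| = (p ^ 5)%N ->
  phi10_gens p s t G a a1 -> phi10_gens p s t H b b1 -> H \homg G.
Proof.
move=> p_pr oG [a2 [a3 [a4 [defG ra ap a1p]]]] [b2 [b3 [b4 [defH rb bp b1p]]]].
pose D := <<[set (a, b); (a1, b1)]>>%G; pose f := proj1m D; pose h := proj2m D.
have rD := phi10_rels_pair ra rb.
have leD : #|D| <= p ^ 5.
  have p4 n := phi10_in4 n rD.
  apply: (phi10_card_le (prime_gt0 p_pr) rD).
    by rewrite pairX /= ap bp -(pairX (a4, b4)) p4.
  by rewrite pairX /= a1p b1p -(pairX (a4, b4)) p4.
have fD : f @* D = G by rewrite [RHS]defG; apply: proj1m_gen.
have hD : h @* D = H by rewrite [RHS]defH; apply: proj2m_gen.
have injf : 'injm f.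
  by rewrite -card_im_injm fD oG eqn_leq -{1}oG -fD leq_morphim.
have isoDG : D \isog G by rewrite -fD; apply: sub_isog.
by have := homg_trans (morphim_homg h (subxx D)) (isog_hom isoDG); rewrite hD.
Qed.

Lemma phi10_gens_isog p s t (gT hT : finGroupType) (G : {group gT}) (H : {group hT}) a a1 b b1 :
  prime p -> #|G| = (p ^ 5)%N -> #|H| = (p ^ 5)%N ->
  phi10_gens p s t G a a1 -> phi10_gens p s t H b b1 -> G \isog H.
Proof.
move=> p_pr oG oH gG gH; rewrite isog_sym isogEcard oG oH leqnn andbT.
exact: phi10_gens_homg p_pr oG gG gH.
Qed.

Section Subdirect.
Variables (gT hT : finGroupType) (G : {group gT}) (H : {group hT}).
Variable D : {group gT * hT}.
Let f := proj1m D.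
Let h := proj2m D.
Hypotheses (fD : f @* D = G) (hD : h @* D = H).
Hypotheses (injf : {in D^`(1), forall x, x.1 = 1 -> x = 1}).
Hypotheses (injh : {in D^`(1), forall x, x.2 = 1 -> x = 1}).

Let fG x : x \in D -> x.1 \in G.
Proof. by move=> xD; rewrite -fD; apply: (mem_morphim f). Qed.
Let hH x : x \in D -> x.2 \in H.
Proof. by move=> xD; rewrite -hD; apply: (mem_morphim h). Qed.
Let fonto g : g \in G -> exists2 x, x \in D & x.1 = g.
Proof. by rewrite -fD => /morphimP[x _ xD ->]; exists x. Qed.
Let honto g : g \in H -> exists2 x, x \in D & x.2 = g.
Proof. by rewrite -hD => /morphimP[x _ xD ->]; exists x. Qed.

Let center12 x : x \in D -> (x.1 \in 'Z(G)) = (x.2 \in 'Z(H)).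
Proof.
move=> xD; rewrite !inE fG ?hH //=; apply/centP/centP => c y.
  case/honto=> u uD <-; apply/commgP/eqP.
  suff /(congr1 (fun v : gT * hT => v.2)) : [~ x, u] = 1 by [].
  apply: injf; first exact: mem_commg.
  by apply/eqP/commgP/c/fG.
case/fonto=> u uD <-; apply/commgP/eqP.
suff /(congr1 (fun v : gT * hT => v.1)) : [~ x, u] = 1 by [].
apply: injh; first exact: mem_commg.
by apply/eqP/commgP/c/hH.
Qed.

Let nZG : G \subset 'N('Z(G)). Proof. exact/normal_norm/center_normal. Qed.
Let nZH : H \subset 'N('Z(H)). Proof. exact/normal_norm/center_normal. Qed.

Let q1_morph : {in D &, {morph (fun x => coset 'Z(G) x.1) : x y / x * y}}.
Proof. by move=> x y xD yD; rewrite /= morphM // (subsetP nZG) ?fG. Qed.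
Let q2_morph : {in D &, {morph (fun x => coset 'Z(H) x.2) : x y / x * y}}.
Proof. by move=> x y xD yD; rewrite /= morphM // (subsetP nZH) ?hH. Qed.
Let q1 := Morphism q1_morph.
Let q2 := Morphism q2_morph.

Let kerq : 'ker q1 = 'ker q2.
Proof.
apply/setP => x; have [xD | xD] := boolP (x \in D); last first.
  by rewrite !in_setI (negPf xD).
have k1 : (x \in 'ker q1) = (x.1 \in 'Z(G)).
  apply/kerP/idP => // [|/coset_id//].
  by apply: coset_idr; rewrite (subsetP nZG) ?fG.
have k2 : (x \in 'ker q2) = (x.2 \in 'Z(H)).
  apply/kerP/idP => // [|/coset_id//].
  by apply: coset_idr; rewrite (subsetP nZH) ?hH.
by rewrite k1 k2 center12.
Qed.

Let q1D : q1 @* D = G / 'Z(G).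
Proof.
apply/setP=> y; apply/morphimP/morphimP => [[x _ xD ->]|[g ng gG ->]].
  by exists x.1; rewrite ?fG // (subsetP nZG) ?fG.
by have [x xD <-] := fonto gG; exists x.
Qed.
Let q2D : q2 @* D = H / 'Z(H).
Proof.
apply/setP=> y; apply/morphimP/morphimP => [[x _ xD ->]|[g ng gG ->]].
  by exists x.2; rewrite ?hH // (subsetP nZH) ?hH.
by have [x xD <-] := honto gG; exists x.
Qed.

(** B and C are variables so that the isomorphism of images has exactly the domain and codomain
    asked for by [isoclinic]. *)
Let factor (rT sT : finGroupType) (A : {group gT * hT}) (u : {morphism A >-> rT})
    (v : {morphism A >-> sT}) (B : {group rT}) (C : {group sT}) :
  'ker u = 'ker v -> u @* A = B -> v @* A = C ->
  exists2 w : {morphism B >-> sT}, isom B C w & {in A, forall x, w (u x) = v x}.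
Proof.
move=> kuv uB vC; have suv : 'ker u \subset 'ker v by rewrite kuv.
have m : {in B &, {morph (factm suv (subxx A)) : x y / x * y}}.
  by rewrite -uB; apply: morphM.
exists (Morphism m) => [|x xA]; last exact: factmE.
have inj : 'injm (factm suv (subxx A)) by apply/injm_factmP.
apply/isomP; split.
  apply/injmP => x y; rewrite -{1 2}uB => xB yB; exact: (injmP inj).
have uAB x : x \in A -> u x \in B by move=> xA; rewrite -uB; apply: mem_morphim.
have BuA x : x \in B -> exists2 x', x' \in A & x = u x'.
  by rewrite -uB => /morphimP[x' _ x'A ->]; exists x'.
apply/setP => y; rewrite -vC; apply/morphimP/morphimP => [[x _ + ->]|[x _ xA ->]].
  by case/BuA=> x' x'A ->; exists x'; rewrite //= factmE.
by exists (u x); rewrite ?uAB //= factmE.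
Qed.

(** For x and u in D, [x, u] is trivial as soon as one coordinate is, so x.1 is central exactly when
    x.2 is. The projections to G / Z(G) and H / Z(H) thus have the same kernel and give theta; those
    of D' to G' and H' are injective and give psi. *)
Lemma isoclinic_subdirect : isoclinic G H.
Proof.
have [theta isoT thetaE] := factor kerq q1D q2D.
pose D1 := D^`(1)%G; have sD1D : D1 \subset D := der_sub 1 D.
pose f1 := restrm_morphism sD1D f; pose h1 := restrm_morphism sD1D h.
have kfh : 'ker f1 = 'ker h1.
  have k1 : 'ker f1 = 1.
    apply/trivgP/subsetP => x xk; rewrite inE; apply/eqP.
    have xD1 : x \in D1 := dom_ker xk.
    by apply: injf => //; have := mker xk.
  have k2 : 'ker h1 = 1.
    apply/trivgP/subsetP => x xk; rewrite inE; apply/eqP.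
    have xD1 : x \in D1 := dom_ker xk.
    by apply: injh => //; have := mker xk.
  by rewrite k1 k2.
have f1D : f1 @* D1 = [~: G, G].
  by rewrite morphim_restrm setIid -fD; exact: (morphimR f (subxx D) (subxx D)).
have h1D : h1 @* D1 = [~: H, H].
  by rewrite morphim_restrm setIid -hD; exact: (morphimR h (subxx D) (subxx D)).
have [psi isoP psiE] := factor kfh f1D h1D.
exists theta, psi; split=> // g1 g2 g1G g2G k1 k2 k1H k2H.
have [x1 x1D <-] := fonto g1G; have [x2 x2D <-] := fonto g2G.
have tE x : x \in D -> theta (coset 'Z(G) x.1) = coset 'Z(H) x.2 by apply: thetaE.
rewrite !tE //.
(* Arbitrary representatives differ from the projections of x1, x2 by central factors, which
   commutators ignore. *)
have cZ x k : x \in H -> k \in H -> coset 'Z(H) k = coset 'Z(H) x ->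
    exists2 z, z \in 'Z(H) & k = z * x.
  move=> xH kH; have [nx nk] := (subsetP nZH x xH, subsetP nZH k kH).
  by move/(rcoset_kercosetP nk nx)/rcosetP.
have cc u v z w : u \in H -> v \in H -> z \in 'Z(H) -> w \in 'Z(H) ->
    [~ z * u, w * v] = [~ u, v].
  move=> uH vH /setIP[zH /centP cz] /setIP[wH /centP cw].
  have zc y : y \in H -> [~ z, y] = 1 by move=> yH; apply/eqP/commgP/cz.
  have wc y : y \in H -> [~ y, w] = 1 by move=> yH; apply/eqP/commgP/commute_sym/cw.
  by rewrite commMgJ zc ?groupM // conj1g mul1g commgMJ wc // conj1g mulg1.
case/(cZ _ _ (hH x1D) k1H) => z zZ -> /(cZ _ _ (hH x2D) k2H)[w wZ ->].
rewrite (cc _ _ _ _ (hH x1D) (hH x2D) zZ wZ).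
exact: (psiE [~ x1, x2] (mem_commg x1D x2D)).
Qed.
End Subdirect.

Lemma phi10_gens_card_der p s t (gT : finGroupType) (G : {group gT}) a a1 :
  prime p -> #|G| = (p ^ 5)%N -> phi10_gens p s t G a a1 -> #|G^`(1)| = (p ^ 3)%N.
Proof.
move=> p_pr oG [a2 [a3 [a4 [defG ra ap a1p]]]]; move: oG; rewrite defG => oG.
have p4 n := phi10_in4 n ra.
by rewrite (phi10_card_der (prime_gt0 p_pr) ra) ?ap ?a1p.
Qed.

Lemma phi10_gens_a4_neq1 p s t (gT : finGroupType) (G : {group gT}) a a1 a2 a3 a4 :
  prime p -> #|G| = (p ^ 5)%N -> G = <<[set a; a1]>> :> {set gT} ->
  phi10_rels p a a1 a2 a3 a4 -> a ^+ p = a4 ^+ s -> a1 ^+ p = a4 ^+ t -> a4 != 1.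
Proof.
move=> p_pr oG defG ra ap a1p; move: oG; rewrite defG => oG.
have p4 n := phi10_in4 n ra.
by rewrite (phi10_a4_neq1 (prime_gt0 p_pr) ra) ?ap ?a1p ?prime_gt1.
Qed.

Lemma injm_eq_card (gT rT : finGroupType) (D : {group gT}) (f : {morphism D >-> rT}) (A : {group gT}) :
  A \subset D -> #|A| <= #|f @* A| -> {in A, forall x, f x = 1 -> x = 1}.
Proof.
move=> sAD leA x xA fx; have : 'injm (restrm sAD f).
  by rewrite -card_im_injm morphim_restrm setIid eqn_leq leA leq_morphim.
by move/injmP => inj; apply: inj; rewrite ?group1 //= morph1.
Qed.

(** [phi10_rels] does not involve s and t, so the pairs of generators satisfy it even for different
    parameters. Then |D'| <= p^3 = |G'| = |H'|, and both projections are injective on D'. *)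
Lemma phi10_gens_isoclinic p s t s' t' (gT hT : finGroupType)
    (G : {group gT}) (H : {group hT}) a a1 b b1 :
  prime p -> #|G| = (p ^ 5)%N -> #|H| = (p ^ 5)%N ->
  phi10_gens p s t G a a1 -> phi10_gens p s' t' H b b1 -> isoclinic G H.
Proof.
move=> p_pr oG oH gG gH.
have oG' := phi10_gens_card_der p_pr oG gG; have oH' := phi10_gens_card_der p_pr oH gH.
case: gG => [a2 [a3 [a4 [defG ra _ _]]]]; case: gH => [b2 [b3 [b4 [defH rb _ _]]]].
pose D := <<[set (a, b); (a1, b1)]>>%G; pose f := proj1m D; pose h := proj2m D.
have rD := phi10_rels_pair ra rb.
have leD : #|D^`(1)| <= p ^ 3.
  by rewrite (phi10_der rD) (phi10_card_der_le (prime_gt0 p_pr) rD).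
have fD : f @* D = G by rewrite [RHS]defG; apply: proj1m_gen.
have hD : h @* D = H by rewrite [RHS]defH; apply: proj2m_gen.
apply: (isoclinic_subdirect fD hD).
  apply: (@injm_eq_card _ _ D f); rewrite ?der_sub //.
  by rewrite [f @* _](morphim_der f 1 (subxx D)) fD oG'.
apply: (@injm_eq_card _ _ D h); rewrite ?der_sub //.
by rewrite [h @* _](morphim_der h 1 (subxx D)) hD oH'.
Qed.

(** * Passage of the extension to isoclinic groups *)

Section Isoclinism.
Variables (G hT eT : finGroupType) (H : {group hT}) (E : {group eT}).
Variables (pi : {morphism E >-> hT}) (z : eT).
Hypotheses (imE : pi @* E = H).
Hypothesis CP : {in E &, forall x y, commute (pi x) (pi y) -> commute x y}.
Hypotheses (kz : z \in 'ker pi) (zE' : z \in E^`(1)) (z1 : z != 1).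

(** The pullback L of E and G over H / Z(H) maps onto G. As psi carries commutators of G to those of
    H, pairs of L that commute in G also commute in E. Every (x, g) in L' satisfies psi(g) = pi(x),
    so z, which is the first coordinate of some element of L', is paired there with g = 1. *)
Lemma B0_neq0_isoclinic : isoclinic [set: G] H -> B0_neq0 G.
Proof.
case=> theta [psi [isoT isoP compat]].
have piH x : x \in E -> pi x \in H by move=> xE; rewrite -imE; apply: mem_morphim.
have piOnto h : h \in H -> exists2 x, x \in E & h = pi x.
  by rewrite -imE => /morphimP[x _ xE ->]; exists x.
have [injT imT] := isomP isoT; have [injP imP] := isomP isoP.
have nZG (g : G) : g \in 'N('Z([set: G])).
  by apply: (subsetP (normal_norm (center_normal [set: G]%G))); apply: in_setT.
have nZH h : h \in H -> h \in 'N('Z(H)).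
  exact/subsetP/normal_norm/center_normal.
pose th g := theta (coset 'Z([set: G]) g).
have cG (g : G) : coset 'Z([set: G]) g \in [set: G] / 'Z([set: G]) by rewrite mem_quotient ?inE.
have thM : {morph th : x y / x * y}.
  by move=> x y; rewrite /th -(morphM theta (cG x) (cG y)) -(morphM (coset_morphism _) (nZG x) (nZG y)).
pose L0 := [set x : eT * G | (x.1 \in E) && (coset 'Z(H) (pi x.1) == th x.2)].
have gL : group_set L0.
  apply/group_setP; split=> [|[x g] [y k]].
    by rewrite inE group1 /= /th !morph1.
  rewrite !inE /= => /andP[xE /eqP ex] /andP[yE /eqP ey].
  rewrite groupM //= thM -ex -ey morphM //; apply/eqP.
  by rewrite (morphM (coset_morphism _)) ?nZH ?piH.
pose L := group gL; pose f := proj2m L.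
have LP x : x \in L -> x.1 \in E /\ coset 'Z(H) (pi x.1) = th x.2.
  by rewrite inE => /andP[xE /eqP].
have LR x y : x \in L -> y \in L -> psi [~ x.2, y.2] = [~ pi x.1, pi y.1].
  move=> /LP[xE ex] /LP[yE ey].
  by apply: (compat x.2 y.2 (in_setT _) (in_setT _)); rewrite ?piH.
have Lonto g : exists2 x, x \in E & (x, g) \in L.
  have : th g \in H / 'Z(H) by rewrite -imT mem_morphim.
  case/morphimP=> h nh hH eg; have [x xE hx] := piOnto h hH; rewrite {}hx /= in eg.
  by exists x; rewrite // inE /= xE eg eqxx.
have Eonto x : x \in E -> exists g, (x, g) \in L.
  move=> xE; have : coset 'Z(H) (pi x) \in H / 'Z(H) by rewrite mem_quotient ?piH.
  rewrite -imT => /morphimP[_ _ /morphimP[g _ _ ->] eg].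
  by exists g; rewrite inE /= xE eg eqxx.
have fL : f @* L = [set: G].
  apply/setP=> g; rewrite inE; have [x xE xL] := Lonto g.
  by apply/morphimP; exists (x, g).
apply: (@B0_neq0_of_extension G (eT * G)%type L f (z, 1)) => //.
- move=> x y xL yL cxy; have [xE _] := LP x xL; have [yE _] := LP y yL.
  have c2 : [~ x.2, y.2] = 1 by apply/eqP/commgP.
  have c1 : [~ x.1, y.1] = 1.
    apply/eqP/commgP/CP => //; apply/commgP; rewrite -(LR x y xL yL) c2 morph1.
    exact: eqxx.
  by apply/commgP; rewrite pairR c1 c2.
- apply/kerP=> //; rewrite inE /= (subsetP (subsetIl _ _) _ kz) (mker kz) /=.
  by rewrite /th !morph1.
have gK : group_set [set x : eT * G | [&& x.1 \in E, x.2 \in [~: setT, setT] & psi x.2 == pi x.1]].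
  apply/group_setP; split=> [|[x g] [y k]]; first by rewrite !inE !group1 /= !morph1 eqxx.
  rewrite !inE /= => /and3P[xE gG /eqP e1] /and3P[yE kG /eqP e2].
  by rewrite !groupM //= !morphM // e1 e2 eqxx.
have sK : L^`(1) \subset group gK.
  rewrite gen_subG; apply/subsetP => _ /imset2P[x y xL yL ->]; rewrite inE pairR /=.
  have [xE _] := LP x xL; have [yE _] := LP y yL.
  by rewrite groupR //= mem_commg ?inE //= LR // morphR.
have : z \in proj1m L @* L^`(1).
  rewrite (morphim_der (proj1m L) 1 (subxx L)) (_ : proj1m L @* L = E) //.
  apply/setP=> x; apply/morphimP/idP=> [[u _ /LP[uE _] ->] // | xE].
  by have [g xg] := Eonto x xE; exists (x, g).
case/morphimP=> -[x g] _ xL' /= zx; have := subsetP sK _ xL'.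
rewrite inE /= -zx => /and3P[_ gG']; rewrite (mker kz) => /eqP pg.
suff -> : 1 = g by rewrite zx.
by apply: (injmP injP); rewrite ?group1 // pg morph1.
by apply: contraNneq z1 => -[->].
Qed.
End Isoclinism.

(** * The presentation of Phi_10(1^5) *)

Fixpoint formula_holds (gT : finGroupType) (e : seq gT) (f : Presentation.formula) : bool :=
  match f with
  | Presentation.Eq2 s t => Presentation.eval e s == Presentation.eval e t
  | Presentation.And f1 f2 => formula_holds e f1 && formula_holds e f2
  end.

Lemma and_relE (vT : finType) (v1 v2 : vT) r :
  Presentation.and_rel v1 v2 r = (v1 == v2) && r :> bool.
Proof. by case: r => //=; rewrite andbT. Qed.

Lemma relE (gT : finGroupType) (e : seq gT) f r :
  Presentation.rel e f r = formula_holds e f && r :> bool.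
Proof.
by elim: f r => [s t|f1 IH1 f2 IH2] r; rewrite /= ?and_relE // IH1 IH2 andbA.
Qed.

Section Presentation.
Variable p : nat.

Definition phi10_hom (gT : finGroupType) (H : {set gT}) :=
  H \homg Grp (a : a1 : a2 : a3 : a4 :
    ([~ a1, a] = a2, [~ a2, a] = a3, [~ a3, a] = a4, [~ a1, a2] = a4,
     [~ a4, a], [~ a1, a3], [~ a1, a4], [~ a2, a3], [~ a2, a4], [~ a3, a4],
     a ^+ p, a1 ^+ p, a2 ^+ p, a3 ^+ p, a4 ^+ p)).

Lemma phi10_join_gens (gT : finGroupType) (a a1 a2 a3 a4 : gT) : phi10_rels p a a1 a2 a3 a4 ->
  <[a]> <*> <[a1]> <*> <[a2]> <*> <[a3]> <*> <[a4]> = <<[set a; a1]>> :> {set gT}.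
Proof.
move=> ra; have [aG a1G sMG] := phi10_gens_in ra.
have mM x : x \in [set a2; a3; a4] -> x \in <<[set a; a1]>>.
  by move=> xM; apply: (subsetP sMG); apply: mem_gen.
have [m2 m3 m4] : [/\ a2 \in <<[set a; a1]>>, a3 \in <<[set a; a1]>> & a4 \in <<[set a; a1]>>].
  by split; apply: mM; rewrite !inE eqxx ?orbT.
apply/eqP; rewrite eqEsubset; apply/andP; split.
  by rewrite !join_subG !cycle_subG aG a1G m2 m3 m4.
rewrite gen_subG subUset !sub1set -!joingA; apply/andP; split.
  by do 2![apply: (subsetP (joing_subl _ _))]; apply: cycle_id.
apply: (subsetP (joing_subl _ _)); apply: (subsetP (joing_subr _ _)).
by apply: (subsetP (joing_subl _ _)); apply: cycle_id.
Qed.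

Lemma phi10_hom_gens (gT : finGroupType) (H : {group gT}) :
  phi10_hom H -> exists a a1, phi10_gens p 0 0 H a a1.
Proof.
case/existsP=> [[[[[a a1] a2] a3] a4]].
rewrite and_relE relE andbT [formula_holds _ _]/=.
case/and5P=> /eqP/= defH /eqP r2 /eqP r3 /eqP r4 /and5P[/eqP r12 /eqP r40 /eqP r13 /eqP r14].
case/and5P=> /eqP r23 /eqP r24 /eqP r34 /eqP ap /and4P[/eqP a1p /eqP p2 /eqP p3 /eqP p4].
have ra : phi10_rels p a a1 a2 a3 a4 by split.
exists a, a1, a2, a3, a4; split=> //; by rewrite -defH (phi10_join_gens ra).
Qed.

Lemma phi10_gens_hom (gT : finGroupType) (H : {group gT}) a a1 :
  phi10_gens p 0 0 H a a1 -> phi10_hom H.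
Proof.
case=> a2 [a3 [a4 [defH ra ap a1p]]].
have := phi10_join_gens ra; rewrite -defH.
case: ra => r2 r3 r4 r12 r40 r13 r14 r23 r24 r34 p2 p3 p4 gH.
apply/existsP; exists ((((a, a1), a2), a3), a4).
rewrite and_relE relE andbT; apply/andP; split; first exact/eqP.
by rewrite /= r2 r3 r4 r12 r40 r13 r14 r23 r24 r34 ap a1p p2 p3 p4 !expg0 !eqxx.
Qed.

Hypothesis p_pr : prime p.

Lemma phi10_gens_1p5 (gT : finGroupType) (H : {group gT}) a a1 :
  #|H| = (p ^ 5)%N -> phi10_gens p 0 0 H a a1 -> Phi10_1p5 p H.
Proof.
move=> oH gH; apply: intro_isoGrp; first exact: phi10_gens_hom gH.
move=> rT K /phi10_hom_gens[b [b1 gK]].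
exact: phi10_gens_homg p_pr oH gH gK.
Qed.

Lemma phi10_1p5_isog (gT hT : finGroupType) (H : {group gT}) (H0 : {group hT}) a a1 :
  #|H0| = (p ^ 5)%N -> phi10_gens p 0 0 H0 a a1 -> Phi10_1p5 p H -> H0 \isog H.
Proof.
move=> oH0 gH0 isoH; have isoH0 := phi10_gens_1p5 oH0 gH0.
by rewrite isogEhom isoH (isoGrp_hom isoH0) isoH0 (isoGrp_hom isoH).
Qed.

End Presentation.

Local Open Scope ring_scope.

(** * Realization by the Baker-Campbell-Hausdorff product *)

(* The nilpotent Lie algebra with basis [Y, X, U = [X, Y], V = [U, Y]] in
   coordinates [(y, x, u, v)], with the Baker-Campbell-Hausdorff product.
   [coc4] and [cocx] are the coordinates of this product along the further
   basis elements [[V, Y]] and [[X, U]] of the free extension of class 4. *)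
Section Law.
Variable F : fieldType.
Hypotheses (F2 : 2%:R != 0 :> F) (F3 : 3%:R != 0 :> F).

Implicit Types g h : (F * F * F * F)%type.
Definition cy g : F := g.1.1.1.
Definition cx g : F := g.1.1.2.
Definition cu g : F := g.1.2.
Definition cv g : F := g.2.

Definition lieU g h : F := cx g * cy h - cy g * cx h.
Definition lieV g h : F := cu g * cy h - cy g * cu h.
Definition lieW4 g h : F := cv g * cy h - cy g * cv h.
Definition lieWx g h : F := cx g * cu h - cu g * cx h.

Definition bch g h : (F * F * F * F)%type :=
  (cy g + cy h, cx g + cx h, cu g + cu h + lieU g h / 2%:R,
   cv g + cv h + lieV g h / 2%:R + (cy h - cy g) * lieU g h / 12%:R).
Definition bch_inv g : (F * F * F * F)%type := (- cy g, - cx g, - cu g, - cv g).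

Definition coc4 g h : F := lieW4 g h / 2%:R + (cy h - cy g) * lieV g h / 12%:R
  - cy g * cy h * lieU g h / 24%:R.
Definition cocx g h : F := lieWx g h / 2%:R + (cx g - cx h) * lieU g h / 12%:R.

Let F12 : 12%:R != 0 :> F.
Proof. by rewrite (natrM F 4 3) (natrM F 2 2) !mulf_neq0. Qed.
Let F24 : 24%:R != 0 :> F.
Proof. by rewrite (natrM F 12 2) mulf_neq0. Qed.

Ltac unfold_bch :=
  do 4 rewrite /bch /bch_inv /coc4 /cocx /lieU /lieV /lieW4 /lieWx /cy /cx /cu /cv /=.
Ltac bch_field := unfold_bch; field; rewrite ?F2 ?F3 ?F12 ?F24 //.

Lemma bchA : associative bch.
Proof.
move=> [[[y x] u] v] [[[y' x'] u'] v'] [[[y2 x2] u2] v2].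
by congr (_, _, _, _); bch_field.
Qed.

Lemma bch0g : left_id (0, 0, 0, 0) bch.
Proof. by move=> [[[y x] u] v]; congr (_, _, _, _); bch_field. Qed.

Lemma bchNg : left_inverse (0, 0, 0, 0) bch_inv bch.
Proof. by move=> [[[y x] u] v]; congr (_, _, _, _); bch_field. Qed.

(** The [X, U] part by itself defines [cover6], of order p^6; the sum in [coc4P] identifies [V, Y]
    with [X, U] and defines the groups of order p^5. *)
Lemma cocxP g h k : cocx h k + cocx g (bch h k) = cocx g h + cocx (bch g h) k.
Proof.
by case: g h k => [[[y x] u] v] [[[y' x'] u'] v'] [[[y2 x2] u2] v2]; bch_field.
Qed.

Lemma coc4P g h k : coc4 h k + cocx h k + (coc4 g (bch h k) + cocx g (bch h k)) =
  coc4 g h + cocx g h + (coc4 (bch g h) k + cocx (bch g h) k).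
Proof.
case: g h k => [[[y x] u] v] [[[y' x'] u'] v'] [[[y2 x2] u2] v2]; bch_field.
Qed.

Definition bch_mul n g : (F * F * F * F)%type :=
  (n%:R * cy g, n%:R * cx g, n%:R * cu g, n%:R * cv g).

Lemma bch_mulS n g : bch g (bch_mul n g) = bch_mul n.+1 g.
Proof.
case: g => [[[y x] u] v]; congr (_, _, _, _);
  by rewrite /bch_mul -[n.+1]add1n natrD; bch_field.
Qed.

Lemma coc4_mul n g : coc4 g (bch_mul n g) = 0.
Proof. by case: g => [[[y x] u] v]; rewrite /bch_mul; bch_field. Qed.

Lemma cocx_mul n g : cocx g (bch_mul n g) = 0.
Proof. by case: g => [[[y x] u] v]; rewrite /bch_mul; bch_field. Qed.

(** Coordinates of the group commutator: along V here, and in [commW] along the direction common to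
    [V, Y] and [X, U]. *)
Definition commV g h : F := lieV g h + (cy g + cy h) * lieU g h / 2%:R.
Definition commW g h : F := lieW4 g h + lieWx g h - cy g * cy h * lieU g h / 12%:R
  + (cy g + cy h) * commV g h / 2%:R - (cx g + cx h) * lieU g h / 2%:R
  - (cy g + cy h) ^+ 2 * lieU g h / 12%:R.

Lemma bch_comm g h : bch g h = bch (bch h g) (0, 0, lieU g h, commV g h).
Proof.
case: g h => [[[y x] u] v] [[[y' x'] u'] v'].
by congr (_, _, _, _); rewrite /commV; bch_field.
Qed.

Lemma coc_comm g h : let c := (0, 0, lieU g h, commV g h) in
  coc4 g h + cocx g h =
  coc4 h g + cocx h g + commW g h + (coc4 (bch h g) c + cocx (bch h g) c).
Proof.
case: g h => [[[y x] u] v] [[[y' x'] u'] v'] /=.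
by rewrite /commW /commV; bch_field.
Qed.

End Law.

(** * The groups with parameters s and t *)

Section MaximalClassGroups.
Variable p : nat.
Hypotheses (p_pr : prime p) (p_gt3 : (3 < p)%N).
Local Notation F := 'F_p.

Lemma Fp_nat_neq0 n : (0 < n < p)%N -> n%:R != 0 :> F.
Proof.
case/andP=> n0 np; rewrite -(dvdn_pcharf (pchar_Fp p_pr)).
by apply/negP => /(dvdn_leq n0); rewrite leqNgt np.
Qed.

Lemma F2_neq0 : 2%:R != 0 :> F.
Proof. by apply: Fp_nat_neq0; rewrite (ltn_trans _ p_gt3). Qed.
Lemma F3_neq0 : 3%:R != 0 :> F.
Proof. exact: Fp_nat_neq0. Qed.

(** The proofs are phantom arguments: the group structure needs 2 and 3 invertible, and its instance
    reads this off the type. *)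
Definition mc4 & prime p & (3 < p)%N : Type := (F * F * F * F)%type.
Local Notation M := (mc4 p_pr p_gt3).
HB.instance Definition _ := Finite.on M.

Definition mc4_mul (g h : M) : M := bch g h.
Definition mc4_inv (g : M) : M := bch_inv g.
Definition mc4_one : M := (0, 0, 0, 0).
Lemma mc4_mulA : associative mc4_mul. Proof. exact: bchA F2_neq0 F3_neq0. Qed.
Lemma mc4_mul1 : left_id mc4_one mc4_mul. Proof. exact: bch0g F2_neq0 F3_neq0. Qed.
Lemma mc4_mulV : left_inverse mc4_one mc4_inv mc4_mul.
Proof. exact: bchNg F2_neq0 F3_neq0. Qed.
HB.instance Definition _ := Finite_isGroup.Build M mc4_mulA mc4_mul1 mc4_mulV.

Lemma mc4M (g h : M) : (g * h)%g = bch g h. Proof. by []. Qed.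
Lemma mc41 : 1%g = (0, 0, 0, 0) :> M. Proof. by []. Qed.

(** The cocycle of the extension Z / p^2 of Z / p by Z / p. *)
Definition carry (a b : F) : F := ((val a + val b) %/ p)%N%:R.

Let FpE : (Zp_trunc (pdiv p)).+2 = p. Proof. exact: Fp_cast. Qed.

Lemma val_FpD (a b : F) : val (a + b) = ((val a + val b) %% p)%N.
Proof. by congr (_ %% _)%N. Qed.

Lemma val_Fp_lt (a : F) : (val a < p)%N.
Proof. by apply: leq_trans (ltn_ord a) _; rewrite FpE. Qed.

Lemma carryC a b : carry a b = carry b a.
Proof. by rewrite /carry addnC. Qed.

Lemma carry0 a : carry a 0 = 0.
Proof. by rewrite /carry addn0 divn_small ?val_Fp_lt. Qed.

Lemma carryP a b c : carry b c + carry a (b + c) = carry a b + carry (a + b) c.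
Proof.
have p_gt0 := prime_gt0 p_pr.
have E i j k : ((j + k) %/ p + (i + (j + k) %% p) %/ p = (i + j + k) %/ p)%N.
  by rewrite -divnMDl // addnCA -divn_eq addnA.
rewrite /carry -!natrD !val_FpD E; congr _%:R.
have := E (val c) (val a) (val b); rewrite [(val c + _ %% p)%N]addnC => ->.
by rewrite -[(val c + _ + _)%N]addnA [(val c + _)%N]addnC.
Qed.

(* The terms in [s] and [t] prescribe the p-th powers of the two generators. *)
Definition phi_st (s t : nat) (g h : M) : F :=
  coc4 g h + cocx g h + s%:R * carry (cy g) (cy h) + t%:R * carry (cx g) (cx h).

Lemma phi_stP s t : cocycleF (phi_st s t).
Proof.
move=> g h k; rewrite /phi_st !mc4M.
have e := coc4P F2_neq0 F3_neq0 g h k.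
have ey := carryP (cy g) (cy h) (cy k); have ex := carryP (cx g) (cx h) (cx k).
transitivity ((coc4 h k + cocx h k + (coc4 g (bch h k) + cocx g (bch h k)))
  + s%:R * (carry (cy h) (cy k) + carry (cy g) (cy h + cy k))
  + t%:R * (carry (cx h) (cx k) + carry (cx g) (cx h + cx k))).
  by rewrite [cy (bch h k)]/= [cx (bch h k)]/=; ring.
by rewrite e ey ex [cy (bch g h)]/= [cx (bch g h)]/=; ring.
Qed.

Section Fixed_st.
Variables s t : nat.
Definition Gst : finGroupType := extn (phi_stP s t).
Implicit Types g h : Gst.

Lemma card_Gst : #|[set: Gst]| = (p ^ 5)%N.
Proof.
have oM : #|{: M}| = (p * p * p * p)%N by rewrite !card_prod !card_Fp.
by rewrite card_extn oM card_Fp // !expnS expn0 muln1 !mulnA.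
Qed.

Lemma GstM g h : (g * h)%g = ((g.1 * h.1)%g, g.2 + h.2 + phi_st s t g.1 h.1) :> Gst.
Proof. by []. Qed.

Lemma phi_st0r (g : M) : phi_st s t g mc4_one = 0.
Proof.
case: g => [[[y x] u] v]; rewrite /phi_st !carry0.
by do 2 rewrite /coc4 /cocx /lieU /lieV /lieW4 /lieWx /cy /cx /cu /cv /=; ring.
Qed.

Lemma Gst1 : 1%g = (mc4_one, 0) :> Gst.
Proof. by rewrite extn1 mc41 phi_st0r // oppr0. Qed.

Lemma GstR g h : [~ g, h]%g =
  (((0, 0, lieU g.1 h.1, commV g.1 h.1) : M), commW g.1 h.1) :> Gst.
Proof.
set c := (X in _ = X); suff e : (g * h = h * g * c)%g.
  by apply: (mulgI (h * g)%g); rewrite -e commgEl conjgE -mulgA !mulKVg.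
rewrite !GstM; congr (_, _); first exact: (bch_comm F2_neq0 F3_neq0).
have e := coc_comm F2_neq0 F3_neq0 g.1 h.1.
rewrite /= in e; rewrite /phi_st !mc4M e /=.
rewrite [carry (cy h.1) _]carryC [carry (cx h.1) _]carryC.
rewrite [cy (0, 0, _, _)]/= [cx (0, 0, _, _)]/= !carry0.
by ring.
Qed.

(** Successive carries telescope to the integer part of n y / p, which is y itself for n = p. *)
Lemma GstX g n : (g ^+ n)%g = ((bch_mul n g.1 : M),
  n%:R * g.2 + s%:R * ((n * val (cy g.1)) %/ p)%N%:R
             + t%:R * ((n * val (cx g.1)) %/ p)%N%:R) :> Gst.
Proof.
have p_gt0 := prime_gt0 p_pr.
have cS m (a : F) : carry a (m%:R * a) + ((m * val a) %/ p)%N%:R = ((m.+1 * val a) %/ p)%N%:R.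
  have va : val (m%:R * a) = ((m * val a) %% p)%N.
    have -> : m%:R * a = (m * val a)%:R :> F by rewrite natrM natr_Zp.
    exact: (val_Fp_nat p_pr).
  by rewrite /carry va -natrD addnC -divnMDl // addnCA -divn_eq mulSn.
elim: n => [|n IH].
  rewrite expg0 Gst1 /bch_mul !mul0r !mul0n !div0n !mulr0 !addr0.
  by rewrite /mc4_one.
rewrite expgS IH GstM; congr (_, _); first exact: bch_mulS F2_neq0 F3_neq0 n g.1.
rewrite /phi_st /= coc4_mul ?F2_neq0 ?F3_neq0 // cocx_mul ?F2_neq0 ?F3_neq0 //.
rewrite [cy (bch_mul _ _)]/= [cx (bch_mul _ _)]/= -!cS -[n.+1]add1n natrD.
by ring.
Qed.

End Fixed_st.
End MaximalClassGroups.

(** * Generating pairs and their parameters *)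

Section Generators.
Variables (p : nat) (p_pr : prime p) (p_gt3 : (3 < p)%N) (s t : nat).
Local Notation F := 'F_p.
Local Notation Gst := (Gst p_pr p_gt3 s t).

Definition mk (y x u v q : F) : Gst := ((y, x, u, v), q).

Lemma mkP (g : Gst) : exists y x u v q, g = mk y x u v q.
Proof. by case: g => [[[[y x] u] v] q]; exists y, x, u, v, q. Qed.

Lemma mk1 : 1%g = mk 0 0 0 0 0. Proof. exact: Gst1. Qed.

Ltac unfold_comm :=
  do 4 rewrite /commW /commV /lieU /lieV /lieW4 /lieWx /cy /cx /cu /cv /=.

(** Here and below existentials hide the lower coordinates; only leading ones matter. *)
Lemma mkR2 y x u v q y' x' u' v' q' : exists v2 q2,
  [~ mk y x u v q, mk y' x' u' v' q']%g = mk 0 0 (x * y' - y * x') v2 q2.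
Proof. by rewrite GstR /=; eexists; eexists. Qed.

Lemma mkR3 u v q y' x' u' v' q' : exists q3,
  [~ mk 0 0 u v q, mk y' x' u' v' q']%g = mk 0 0 0 (u * y') q3.
Proof.
exists (commW (mk 0 0 u v q).1 (mk y' x' u' v' q').1).
by rewrite GstR; congr (_, _, _, _, _); unfold_comm; ring.
Qed.

Lemma mkR4 v q y' x' u' v' q' :
  [~ mk 0 0 0 v q, mk y' x' u' v' q']%g = mk 0 0 0 0 (v * y').
Proof. by rewrite GstR; congr (_, _, _, _, _); unfold_comm; ring. Qed.

Lemma mkR12 x u v q u' v' q' :
  [~ mk 0 x u v q, mk 0 0 u' v' q']%g = mk 0 0 0 0 (x * u').
Proof. by rewrite GstR; congr (_, _, _, _, _); unfold_comm; ring. Qed.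

Lemma mkR13 y x u v q v' q' :
  [~ mk y x u v q, mk 0 0 0 v' q']%g = mk 0 0 0 0 (- (y * v')).
Proof. by rewrite GstR; congr (_, _, _, _, _); unfold_comm; ring. Qed.

Lemma mkR_central g q : [~ g, mk 0 0 0 0 q]%g = 1%g.
Proof.
have [y [x [u [v [q' ->]]]]] := mkP g.
by rewrite mkR13 mk1 mulr0 oppr0.
Qed.

Lemma mkX_central q n : (mk 0 0 0 0 q ^+ n)%g = mk 0 0 0 0 (n%:R * q).
Proof.
rewrite GstX /bch_mul /= !mulr0 !muln0 !div0n !mulr0 !addr0.
by [].
Qed.

Lemma mkXp y x u v q : (mk y x u v q ^+ p)%g = mk 0 0 0 0 (s%:R * y + t%:R * x).
Proof.
have p0 : p%:R = 0 :> F by rewrite pchar_Fp_0.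
rewrite GstX /bch_mul p0 /= !mul0r !mulKn ?prime_gt0 // add0r.
by rewrite /mk !natr_Zp.
Qed.

Lemma mk_inj5 q q' : mk 0 0 0 0 q = mk 0 0 0 0 q' -> q = q'.
Proof. by case. Qed.

Lemma Fp_solve (a b : F) : a != 0 -> exists n : nat, b + n%:R * a = 0.
Proof.
move=> a0; exists (- b / a : F); rewrite natr_Zp divfK // subrr.
by [].
Qed.

Lemma mkM y x u v q y' x' u' v' q' : exists u2 v2 q2,
  (mk y x u v q * mk y' x' u' v' q')%g = mk (y + y') (x + x') u2 v2 q2.
Proof. by do 3 eexists. Qed.

Lemma mkMu u v q u' v' q' : exists v2 q2,
  (mk 0 0 u v q * mk 0 0 u' v' q')%g = mk 0 0 (u + u') v2 q2.
Proof.
do 2 eexists; rewrite GstM mc4M /bch /=; unfold_comm.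
by rewrite !addr0 !mul0r subr0 mul0r addr0.
Qed.

Lemma mkMv v q v' q' : exists q2,
  (mk 0 0 0 v q * mk 0 0 0 v' q')%g = mk 0 0 0 (v + v') q2.
Proof.
eexists; rewrite GstM mc4M /bch /=; unfold_comm.
by rewrite !(addr0, mul0r, subr0, mulr0).
Qed.

Lemma mkMq q q' : (mk 0 0 0 0 q * mk 0 0 0 0 q')%g = mk 0 0 0 0 (q + q').
Proof.
rewrite GstM mc4M /bch /phi_st /coc4 /cocx /=; unfold_comm.
by rewrite !carry0 // !(addr0, mul0r, subr0, mulr0).
Qed.

Lemma mkX y x u v q n : exists q2,
  (mk y x u v q ^+ n)%g = mk (n%:R * y) (n%:R * x) (n%:R * u) (n%:R * v) q2.
Proof. by eexists; rewrite GstX. Qed.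

Ltac rw_mkM lem := match goal with
  |- context [(mk ?a ?b ?c ?d ?e * mk ?a' ?b' ?c' ?d' ?e')%g] =>
     lem a b c d e a' b' c' d' e' end.

(** Triangular elimination: powers of the five elements clear the coordinates of any element one
    after the other. *)
Lemma Gst_gen (X : {group Gst}) y x u v q x1 u1 v1 q1 u2 v2 q2 v3 q3 q4 :
  y != 0 -> x1 != 0 -> u2 != 0 -> v3 != 0 -> q4 != 0 ->
  mk y x u v q \in X -> mk 0 x1 u1 v1 q1 \in X -> mk 0 0 u2 v2 q2 \in X ->
  mk 0 0 0 v3 q3 \in X -> mk 0 0 0 0 q4 \in X -> X = [set: Gst] :> {set _}.
Proof.
move=> y0 x10 u20 v30 q40 aX a1X a2X a3X a4X; apply/setP=> g; rewrite inE.
have [y' [x' [u' [v' [q' ->]]]]] := mkP g.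
have [n ny] := Fp_solve y' y0; rewrite -(groupMr _ (groupX n aX)).
have [? ->] := mkX y x u v q n; rw_mkM ltac:(fun a b c d e a' b' c' d' e' =>
  have [? [? [? ->]]] := mkM a b c d e a' b' c' d' e').
rewrite ny; move: (x' + _) => x''; have [m mx] := Fp_solve x'' x10.
rewrite -(groupMr _ (groupX m a1X)).
have [? ->] := mkX 0 x1 u1 v1 q1 m; rw_mkM ltac:(fun a b c d e a' b' c' d' e' =>
  have [? [? [? ->]]] := mkM a b c d e a' b' c' d' e').
rewrite mx mulr0 addr0; match goal with |- context [mk 0 0 ?w _ _] => move: w => u'' end.
have [k ku] := Fp_solve u'' u20; rewrite -(groupMr _ (groupX k a2X)).
have [? ->] := mkX 0 0 u2 v2 q2 k; rewrite !mulr0.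
rw_mkM ltac:(fun a b c d e a' b' c' d' e' =>
  have [? [? ->]] := mkMu c d e c' d' e'); rewrite ku.
match goal with |- context [mk 0 0 0 ?w _] => move: w => v'' end.
have [l lv] := Fp_solve v'' v30; rewrite -(groupMr _ (groupX l a3X)).
have [? ->] := mkX 0 0 0 v3 q3 l; rewrite !mulr0; rw_mkM ltac:(fun a b c d e a' b' c' d' e' =>
  have [? ->] := mkMv d e d' e'); rewrite lv.
match goal with |- context [mk 0 0 0 0 ?w] => move: w => q'' end.
have [r rq] := Fp_solve q'' q40; rewrite -(groupMr _ (groupX r a4X)).
by rewrite mkX_central mkMq rq -mk1 group1.
Qed.

(* The change of generators [b = a ^ i * a1 ^ j], [b1 = a1 ^ (i ^ 2)]. *)
Lemma Gst_phi10_gens s' t' (i j : F) : i != 0 ->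
  s'%:R * i ^+ 5 = s%:R * i + t%:R * j -> t'%:R * i ^+ 3 = t%:R ->
  exists b b1, phi10_gens p s' t' [set: Gst] b b1.
Proof.
move=> i0 es et; exists (mk i j 0 0 0), (mk 0 (i ^+ 2) 0 0 0).
have [v2 [q2 e2]] := mkR2 0 (i ^+ 2) 0 0 0 i j 0 0 0.
rewrite mul0r subr0 -exprSr in e2.
have [q3 e3] := mkR3 (i ^+ 3) v2 q2 i j 0 0 0; rewrite -exprSr in e3.
have e4 := mkR4 (i ^+ 4) q3 i j 0 0 0; rewrite -exprSr in e4.
(* The scaling of a1 by i^2 is what makes [b1, b2], with i^2 i^3, agree with [b3, b], with i^4 i. *)
have e12 := mkR12 (i ^+ 2) 0 0 0 (i ^+ 3) v2 q2; rewrite -exprD in e12.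
have e13 := mkR13 0 (i ^+ 2) 0 0 0 (i ^+ 4) q3; rewrite mul0r oppr0 in e13.
set b := mk i j 0 0 0 in e2 e3 e4 *; set b1 := mk 0 (i ^+ 2) 0 0 0 in e2 e12 e13 *.
exists (mk 0 0 (i ^+ 3) v2 q2), (mk 0 0 0 (i ^+ 4) q3), (mk 0 0 0 0 (i ^+ 5)).
have nz k : i ^+ k != 0 by rewrite expf_neq0.
split.
- apply/esym; apply: (@Gst_gen <<[set b; b1]>>%G i j 0 0 0 (i ^+ 2) 0 0 0
    (i ^+ 3) v2 q2 (i ^+ 4) q3 (i ^+ 5)) => //;
    have bG : b \in <<[set b; b1]>>%g by rewrite mem_gen ?inE ?eqxx.
  + exact: bG.
  + by rewrite mem_gen ?inE ?eqxx ?orbT.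
  + by rewrite -e2 groupR // mem_gen ?inE ?eqxx ?orbT.
  + by rewrite -e3 -e2 !groupR // mem_gen ?inE ?eqxx ?orbT.
  + by rewrite -e4 -e3 -e2 !groupR // mem_gen ?inE ?eqxx ?orbT.
- rewrite -mk1 in e13; split; rewrite ?mkR_central ?mkXp ?mulr0 ?addr0 -?mk1 //.
    by rewrite mkR4 mul0r mk1.
  by rewrite mkR13 mul0r oppr0 mk1.
- by rewrite mkXp mkX_central -es.
by rewrite mkXp mkX_central mulr0 add0r -et -mulrA -exprD.
Qed.

(** In coordinates b = (i, j, ...) and b1 = (k0, k, ...), the relation [b1, b3] = 1 forces k0 = 0
    and [b1, b2] = b4 forces k = i^2. Then b4 has last coordinate i^5, and the p-th powers give the
    two equations. *)
Lemma Gst_invariants s' t' b b1 : phi10_gens p s' t' [set: Gst] b b1 ->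
  exists i j : F, [/\ i != 0, s'%:R * i ^+ 5 = s%:R * i + t%:R * j &
    t'%:R * i ^+ 3 = t%:R].
Proof.
move=> gb; have [b2 [b3 [b4 [defG rb bp b1p]]]] := gb.
have b41 := phi10_gens_a4_neq1 p_pr (card_Gst p_pr p_gt3 s t) defG rb bp b1p.
case: rb => r2 r3 r4 r12 _ r13 _ _ _ _ _ _ _.
have [i [j [u [v [q be]]]]] := mkP b; have [k0 [k [u1 [v1 [q1 b1e]]]]] := mkP b1.
have [v2 [q2 b2e]] := mkR2 k0 k u1 v1 q1 i j u v q.
rewrite -be -b1e r2 in b2e; set d := k * i - k0 * j in b2e.
have [q3 b3e] := mkR3 d v2 q2 i j u v q; rewrite -be -b2e r3 in b3e.
have b4e := mkR4 (d * i) q3 i j u v q; rewrite -be -b3e r4 in b4e.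
have nz : d * i * i != 0 by apply: contraNneq b41 => e; rewrite b4e e -mk1.
move: (nz); rewrite !mulf_eq0 orbC => /norP[i0 /norP[d0 _]].
have k00 : k0 = 0.
  have := mkR13 k0 k u1 v1 q1 (d * i) q3; rewrite -b1e -b3e r13 mk1 => /mk_inj5/esym/eqP.
  by rewrite oppr_eq0 !mulf_eq0 (negPf d0) (negPf i0) !orbF => /eqP.
have dE : d = k * i by rewrite /d k00 mul0r subr0.
have ki : k = i ^+ 2.
  have := mkR12 k u1 v1 q1 d v2 q2; rewrite -{1}k00 -b1e -b2e r12 b4e => /mk_inj5.
  have kn : k * i != 0 by rewrite -dE.
  rewrite dE => e; apply: (mulIf kn).
  by rewrite -e; ring.
have b4i : b4 = mk 0 0 0 0 (i ^+ 5) by rewrite b4e dE ki; congr (mk _ _ _ _ _); ring.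
exists i, j; split=> //.
  by move: bp; rewrite be mkXp b4i mkX_central => /mk_inj5.
have := b1p; rewrite b1e mkXp k00 mulr0 add0r b4i mkX_central => /mk_inj5 e.
have i20 : i ^+ 2 != 0 by rewrite expf_neq0.
by apply: (mulIf i20); rewrite -mulrA -exprD -e ki.
Qed.

End Generators.

(** * The extension of Phi_10(1^5) *)

Section Cover.
Variables (p : nat) (p_pr : prime p) (p_gt3 : (3 < p)%N).
Local Notation F := 'F_p.
Local Notation H0 := (Gst p_pr p_gt3 0 0).
Let F2 := F2_neq0 p_pr p_gt3.
Let F3 := F3_neq0 p_pr p_gt3.

Definition phi_x (g h : H0) : F := cocx g.1 h.1.

Lemma phi_xP : cocycleF phi_x.
Proof. by move=> g h k; apply: cocxP. Qed.

Definition cover6 : finGroupType := extn phi_xP.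
Implicit Types x y : cover6.

Lemma cover6M x y : (x * y)%g = ((x.1 * y.1)%g, x.2 + y.2 + phi_x x.1 y.1) :> cover6.
Proof. by []. Qed.

Lemma cover6R x y : [~ x, y]%g =
  ([~ x.1, y.1]%g, lieWx x.1.1 y.1.1 - (cx x.1.1 + cx y.1.1) * lieU x.1.1 y.1.1 / 2%:R) :> cover6.
Proof.
set c := (X in _ = X); suff e : (x * y = y * x * c)%g.
  by apply: (mulgI (y * x)%g); rewrite -e commgEl conjgE -mulgA !mulKVg.
rewrite !cover6M; congr (_, _).
  by rewrite /= commgEl conjgE -mulgA !mulKVg.
rewrite /c /phi_x GstR /=; move: x.2 y.2 => q q'.
case: x.1.1 y.1.1 => [[[y1 x1] u] v] [[[y2 x2] u2] v2].
have F12 : 12%:R != 0 :> F by rewrite (natrM F 4 3) (natrM F 2 2) !mulf_neq0.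
rewrite mc4M; do 4 rewrite /bch /cocx /lieU /lieWx /cy /cx /cu /cv /=.
by field; rewrite F12 F2.
Qed.

(** On a commuting pair [lieU], [lieV] and the sum of [lieW4] and [lieWx] vanish. As [lieU], [lieV],
    [lieWx] are the 2 x 2 minors of the coordinates (y, x, u), [lieWx] vanishes if some y is
    nonzero; otherwise [lieW4] is 0, so [lieWx] is too. The cocycle is then symmetric on the
    pair. *)
Lemma cover6_commute x y : commute x.1 y.1 -> commute x y.
Proof.
move=> cxy; have /commgP/eqP e := cxy; rewrite GstR Gst1 in e.
have eU : lieU x.1.1 y.1.1 = 0 := congr1 (fun g : H0 => cu g.1) e.
have eV : commV x.1.1 y.1.1 = 0 := congr1 (fun g : H0 => cv g.1) e.
have eW : commW x.1.1 y.1.1 = 0 := congr1 (fun g : H0 => g.2) e.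
apply: extnC => //; rewrite /phi_x.
have lV : lieV x.1.1 y.1.1 = 0 by move: eV; rewrite /commV eU mulr0 mul0r addr0.
have lW : lieW4 x.1.1 y.1.1 + lieWx x.1.1 y.1.1 = 0.
  by move: eW; rewrite /commW eU eV !(mulr0, mul0r, subr0, addr0).
suff l0 : lieWx x.1.1 y.1.1 = 0.
  rewrite /cocx eU l0; move: eU l0; rewrite /lieU /lieWx => eU l0.
  have -> : cx y.1.1 * cu x.1.1 - cu y.1.1 * cx x.1.1 = 0.
    by rewrite -[RHS]oppr0 -l0; ring.
  have -> : cx y.1.1 * cy x.1.1 - cy y.1.1 * cx x.1.1 = 0.
    by rewrite -[RHS]oppr0 -eU; ring.
  by rewrite !mulr0 !mul0r.
clear eV eW; move: eU lV lW; case: x.1.1 y.1.1 => [[[y1 x1] u] v] [[[y2 x2] u2] v2].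
rewrite /lieU /lieV /lieW4 /lieWx /cy /cx /cu /cv /= => eU eV eW.
have [y10|y10] := eqVneq y1 0; last first.
  apply: (mulfI y10); rewrite mulr0.
  transitivity (u * (x1 * y2 - y1 * x2) - x1 * (u * y2 - y1 * u2)); first by ring.
  by rewrite eU eV !mulr0 subr0.
have [y20|y20] := eqVneq y2 0; last first.
  apply: (mulfI y20); rewrite mulr0.
  transitivity (u2 * (x1 * y2 - y1 * x2) - x2 * (u * y2 - y1 * u2)); first by ring.
  by rewrite eU eV !mulr0 subr0.
by move: eW; rewrite y10 y20 => <-; ring.
Qed.

Lemma phi10_gens00 : exists b b1, phi10_gens p 0 0 [set: H0] b b1.
Proof.
apply: (@Gst_phi10_gens p p_pr p_gt3 0 0 0 0 1 0); rewrite ?oner_neq0 ?mul0r ?add0r //.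
Qed.

(** The commutators [a1, a2] and [a3, a] agree in [H0] and differ in the new coordinate; z is their
    quotient. *)
Lemma cover6_der : exists2 z : cover6,
  z \in ('ker (@extn_proj _ _ _ phi_xP))%g /\ z \in [set: cover6]^`(1)%g & z != 1%g.
Proof.
pose a : H0 := mk p_pr p_gt3 0 0 1 0 0 0 0; pose a1 : H0 := mk p_pr p_gt3 0 0 0 1 0 0 0.
pose A : cover6 := (a, 0); pose A1 : cover6 := (a1, 0).
have [v2 [q2 e2]] := mkR2 p_pr p_gt3 0 0 0 1 0 0 0 1 0 0 0 0.
rewrite !(mulr1, mulr0, subr0) in e2.
have [q3 e3] := mkR3 p_pr p_gt3 0 0 1 v2 q2 1 0 0 0 0; rewrite mulr1 in e3.
have [n2 E2] : exists n2, [~ A1, A]%g = (mk p_pr p_gt3 0 0 0 0 1 v2 q2, n2) :> cover6.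
  by eexists; rewrite cover6R e2.
have [n3 E3] : exists n3, [~ [~ A1, A], A]%g = (mk p_pr p_gt3 0 0 0 0 0 1 q3, n3) :> cover6.
  by eexists; rewrite E2 cover6R e3.
have E4 : [~ [~ [~ A1, A], A], A]%g = (mk p_pr p_gt3 0 0 0 0 0 0 1, 0) :> cover6.
  rewrite E3 cover6R mkR4 mulr1; congr (_, _).
  by rewrite /lieWx /lieU /cx /cu /cy /=; ring.
have E12 : [~ A1, [~ A1, A]]%g = (mk p_pr p_gt3 0 0 0 0 0 0 1, 1) :> cover6.
  rewrite E2 cover6R mkR12 mulr1; congr (_, _).
  by rewrite /lieWx /lieU /cx /cu /cy /=; ring.
exists ([~ A1, [~ A1, A]] * [~ [~ [~ A1, A], A], A]^-1)%g; last first.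
  apply/eqP => /(canRL (mulgKV _)); rewrite mul1g E4 E12 => /(congr1 snd) /= /eqP.
  by rewrite oner_eq0.
split; last by rewrite groupM ?groupV // mem_commg ?inE.
apply/kerP; rewrite ?in_setT // E4 E12.
exact: (mulgV (mk p_pr p_gt3 0 0 0 0 0 0 1)).
Qed.

End Cover.

Lemma in_Phi10_B0_neq0 (p : nat) (G : finGroupType) :
  prime p -> (3 < p)%N -> in_Phi10 p [set: G] -> B0_neq0 G.
Proof.
move=> p_pr p_gt3 [hT [H [presH isoGH]]].
have [b [b1 gH0]] := phi10_gens00 p_pr p_gt3.
have isoH := phi10_1p5_isog p_pr (card_Gst p_pr p_gt3 0 0) gH0 presH.
have [f injf imf] := isogP isoH.
have [z [kz zE'] z1] := cover6_der p_pr p_gt3.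
set E := [set: cover6 p_pr p_gt3]%G in zE'.
have gM : {in E &, {morph (fun x => f x.1) : x y / (x * y)%g}}.
  by move=> x y _ _; rewrite -morphM ?in_setT.
pose g := Morphism gM.
apply: (@B0_neq0_isoclinic _ _ _ H E g z) => //.
- rewrite -imf; apply/setP => h.
  apply/morphimP/morphimP => [[x _ _ ->]|[k _ _ ->]]; first by exists x.1; rewrite ?in_setT.
  by exists ((k, 0%R) : cover6 p_pr p_gt3); rewrite ?in_setT.
- move=> x y _ _ cxy; apply: cover6_commute.
  by apply: (injmP injf); rewrite ?in_setT // !morphM ?in_setT.
- apply/kerP; rewrite ?in_setT //=; have := mker kz; rewrite /= /extn_proj => ->.
  exact: morph1.
Qed.

(** * Counting *)

Section PowerClasses.
Variable p : nat.
Hypothesis p_pr : prime p.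
Local Notation F := 'F_p.

Lemma Fp_fermat (x : F) : x != 0 -> x ^+ (p - 1) = 1.
Proof.
move=> x0; have e : x ^+ p = x.
  by rewrite -[RHS]expf_card; congr (_ ^+ _); rewrite card_Fp.
have pS : (p - 1).+1 = p by rewrite subn1 prednK ?prime_gt0.
by apply: (mulfI x0); rewrite -exprS mulr1 -[RHS]e; congr (_ ^+ _).
Qed.

Lemma Fp_prim_root : exists g : F, (p - 1).-primitive_root g.
Proof.
have p1 : (0 < p - 1)%N by rewrite subn_gt0 prime_gt1.
have c : (size (enum [pred x : F | x != 0]%R) = p - 1)%N.
  by rewrite -cardE (cardC1 (0 : F)) card_Fp // subn1.
have /hasP[g _ gP] : has (p - 1).-primitive_root (enum [pred x : F | x != 0]).
  apply: has_prim_root; rewrite ?c ?enum_uniq //.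
  by apply/allP => x; rewrite mem_enum inE => x0; rewrite unity_rootE; apply/eqP/Fp_fermat.
by exists g.
Qed.

Variable g : F.
Hypothesis gP : (p - 1).-primitive_root g.

Lemma prim_root_neq0 n : g ^+ n != 0.
Proof.
rewrite expf_neq0 //; apply/eqP => g0; have := prim_expr_order gP.
rewrite g0 expr0n subn_eq0 leqNgt prime_gt1 //= => /eqP.
Qed.

Lemma prim_root_onto (x : F) : x != 0 -> exists e, x = g ^+ e.
Proof.
by move=> /Fp_fermat e; have [i ->] := prim_rootP gP e; exists i.
Qed.

(** By Bezout, m-th powers of nonzero elements are the powers of g^d, d = gcd(p - 1, m). *)
Lemma power_class m (x : F) : (0 < m)%N -> x != 0 ->
  exists i r, [/\ i != 0, (r < gcdn (p - 1) m)%N & x * i ^+ m = g ^+ r].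
Proof.
move=> m_gt0 /prim_root_onto[e ->]; set d := gcdn _ _.
have d_gt0 : (0 < d)%N by rewrite gcdn_gt0 m_gt0 orbT.
have [km kn kE _] := egcdnP (p - 1) m_gt0.
exists ((g ^+ (e %/ d * km))^-1), (e %% d)%N; split.
- by rewrite invr_eq0 prim_root_neq0.
- exact: ltn_pmod.
have -> : (g ^+ (e %/ d * km))^-1 ^+ m = (g ^+ (e %/ d * d))^-1.
  rewrite exprVn -exprM -mulnA kE gcdnC -/d; congr _^-1.
  by rewrite mulnDr exprD mulnA [X in g ^+ X * _]mulnC exprM (prim_expr_order gP) expr1n mul1r.
by rewrite {1}(divn_eq e d) exprD mulrAC mulfV ?prim_root_neq0 // mul1r.
Qed.

Lemma power_class_inj m a b (i : F) : i != 0 ->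
  (a < gcdn (p - 1) m)%N -> (b < gcdn (p - 1) m)%N ->
  g ^+ a * i ^+ m = g ^+ b -> a = b.
Proof.
move=> /prim_root_onto[c ->] la lb; rewrite -exprM -exprD => /eqP.
rewrite (eq_prim_root_expr gP) => /eqP e; set d := gcdn _ _ in la lb.
have dp : (d %| p - 1)%N by apply: dvdn_gcdl.
have : (a + c * m = b %[mod d])%N by rewrite -(modn_dvdm _ dp) e modn_dvdm.
rewrite -modnDmr (eqP (dvdn_mull c (dvdn_gcdr (p - 1) m) : _ %% d == 0)%N) addn0.
by rewrite !modn_small.
Qed.

Local Notation m4 := (gcdn (p - 1) 4).
Local Notation m3 := (gcdn (p - 1) 3).

Definition class_params k : F * F :=
  if (k < m4)%N then (g ^+ k, 0)
  else if (k < m4 + m3)%N then (0, g ^+ (k - m4)) else (0, 0).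

(** The equations relate parameters of isomorphic groups: t vanishes for both or for neither, its
    class modulo cubes is fixed, and for t = 0 division by i leaves s modulo fourth powers. *)
Lemma class_params_inj k l (i j : F) : (k < m4 + m3 + 1)%N -> (l < m4 + m3 + 1)%N ->
  i != 0 -> (class_params k).1 * i ^+ 5 = (class_params l).1 * i + (class_params l).2 * j ->
  (class_params k).2 * i ^+ 3 = (class_params l).2 -> k = l.
Proof.
have last n : (n < m4 + m3 + 1)%N -> (m4 + m3 <= n)%N -> n = (m4 + m3)%N.
  by rewrite addn1 ltnS => a b; apply/eqP; rewrite eqn_leq a.
have sub n : (n < m4 + m3)%N -> (m4 <= n)%N -> (n - m4 < m3)%N.
  by move=> a b; rewrite ltn_subLR.
move=> kn ln i0; have i5 : i ^+ 5 != 0 by rewrite expf_neq0.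
have i3 : i ^+ 3 != 0 by rewrite expf_neq0.
have g0 n x : x != 0 -> g ^+ n * x = 0 -> False.
  by move=> x0 /eqP; rewrite mulf_eq0 (negPf x0) (negPf (prim_root_neq0 n)).
have g0' n : 0 = g ^+ n -> False by move/esym/eqP; rewrite (negPf (prim_root_neq0 n)).
rewrite /class_params; case: (ltnP k m4) => k4; [|case: ltnP => k3];
  (case: (ltnP l m4) => l4; [|case: ltnP => l3]) => /=; rewrite ?mul0r ?addr0 ?add0r //.
- rewrite (exprSr i) mulrA => /(mulIf i0) e _.
  exact: power_class_inj i0 k4 l4 e.
- by move=> _ /g0'.
- by move=> /(g0 _ _ i5).
- by move=> _ /(g0 _ _ i3).
- move=> _ /(power_class_inj i0 (sub _ k3 k4) (sub _ l3 l4)) e.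
  by rewrite -(subnKC k4) e subnKC.
- by move=> _ /(g0 _ _ i3).
- by move=> /esym /(g0 _ _ i0).
- by move=> _ /g0'.
- by rewrite (last k) // (last l).
Qed.

Lemma class_params_onto (s t : F) : exists i j k,
  [/\ (k < m4 + m3 + 1)%N, i != 0, s * i ^+ 5 = (class_params k).1 * i + (class_params k).2 * j
    & t * i ^+ 3 = (class_params k).2].
Proof.
have [->|t0] := eqVneq t 0; last first.
  have [//|i [r [i0 lr e]]] := @power_class 3 t _ t0.
  (* The representative has first parameter 0, so j absorbs s. *)
  exists i, (s * i ^+ 5 / g ^+ r), (m4 + r)%N.
  rewrite /class_params (ltnNge _ m4) leq_addr /= ltn_add2l lr /= addKn; split=> //.
  - by rewrite addn1 ltnS leq_add2l ltnW.
  - by rewrite mul0r add0r [RHS]mulrCA mulfV ?prim_root_neq0 // mulr1.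
have [->|s0] := eqVneq s 0.
  exists 1, 0, (m4 + m3)%N; rewrite /class_params (ltnNge _ m4) leq_addr ltnn /= !mul0r addr0.
  by rewrite addn1; split; rewrite ?oner_neq0.
have [//|i [r [i0 lr e]]] := @power_class 4 s _ s0.
exists i, 0, r; rewrite /class_params lr /= mulr0 addr0 mul0r; split=> //.
  by rewrite addn1 ltnS ltnW // (leq_trans lr) ?leq_addr.
by rewrite (exprSr i) mulrA e.
Qed.

End PowerClasses.

Lemma phi10_gens_in_Phi10 p s t (gT : finGroupType) (G : {group gT}) a a1 :
  prime p -> (3 < p)%N -> #|G| = (p ^ 5)%N ->
  phi10_gens p s t G a a1 -> in_Phi10 p G.
Proof.
move=> p_pr p_gt3 oG gG; have [b [b1 gH]] := phi10_gens00 p_pr p_gt3.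
have oH := card_Gst p_pr p_gt3 0 0.
exists (Gst p_pr p_gt3 0 0), [set: Gst p_pr p_gt3 0 0]%G; split.
  exact: phi10_gens_1p5 oH gH.
exact: phi10_gens_isoclinic p_pr oG oH gG gH.
Qed.

Lemma Gst_in_Phi10 p (p_pr : prime p) (p_gt3 : (3 < p)%N) s t :
  in_Phi10 p [set: Gst p_pr p_gt3 s t].
Proof.
have [||b [b1 gG]] := @Gst_phi10_gens p p_pr p_gt3 s t s t 1 0 (oner_neq0 _).
- by rewrite expr1n !mulr1 mulr0 addr0.
- by rewrite expr1n mulr1.
exact: phi10_gens_in_Phi10 p_pr p_gt3 (card_Gst p_pr p_gt3 s t) gG.
Qed.

Theorem theorem1p2 (p : nat) (p_pr : prime p) (p_gt3 : (3 < p)%N) :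
  (forall G : finGroupType, #|G| = (p ^ 5)%N ->
     (B0_neq0 G <-> in_Phi10 p [set: G])) /\
  num_isoclasses (fun G : finGroupType => #|G| = (p ^ 5)%N /\ B0_neq0 G)
    (gcdn (p - 1) 4 + gcdn (p - 1) 3 + 1)%N.
Proof.
have [g gP] := Fp_prim_root p_pr.
split=> [G oG|].
  split=> [/(B0_neq0_phi10_gens p_pr p_gt3 oG)[s [t [a [a1 gG]]]]|].
    by apply: phi10_gens_in_Phi10 gG; rewrite ?cardsT.
  exact: in_Phi10_B0_neq0.
exists (fun k => Gst p_pr p_gt3 (class_params g k).1 (class_params g k).2); split=> [k|k l iso|G [oG B0G]].
- rewrite -cardsT card_Gst; split=> //.
  exact: in_Phi10_B0_neq0 (Gst_in_Phi10 _ _ _ _).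
(* The trivial change i = 1, j = 0 gives standard generators, whose images under the isomorphism
   [Gst_invariants] compares. *)
- have [||b [b1 gk]] := @Gst_phi10_gens p p_pr p_gt3 (class_params g k).1 (class_params g k).2
    (class_params g k).1 (class_params g k).2 1 0 (oner_neq0 _).
  + by rewrite expr1n !mulr1 mulr0 addr0.
  + by rewrite expr1n mulr1.
  have [f injf fk] := isogP iso; have := morphim_phi10_gens f gk.
  rewrite fk => /Gst_invariants[i [j [i0]]]; rewrite !natr_Zp => es et.
  exact/val_inj/(class_params_inj p_pr gP (ltn_ord k) (ltn_ord l) i0 es et).
have [s [t [a [a1 gG]]]] := B0_neq0_phi10_gens p_pr p_gt3 oG B0G.
have [i [j [k [lk i0 es et]]]] := class_params_onto p_pr gP s%:R t%:R.
exists (Ordinal lk); rewrite -cardsT in oG.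
have [||b [b1 gk]] := @Gst_phi10_gens p p_pr p_gt3 (class_params g k).1 (class_params g k).2 s t i j i0.
- by rewrite !natr_Zp.
- by rewrite !natr_Zp.
exact: phi10_gens_isog p_pr oG (card_Gst _ _ _ _) gG gk.
Qed.
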